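(* There exists $n_0$ such that, for all $n\ge n_0$, $H_n$ is the unique graph (up to isomorphism) on $n$ vertices with the maximum number of holes.
   Context: All graphs are finite and simple. A hole is an induced cycle of length at least 4. $N_B(x)$ denotes the neighbourhood of $x$ in $B$. A graph $B$ is a cyclic braid if there exist $k\ge 3$ and a partition $B_1,\dots,B_k$ of $V(B)$ such that for every $1\le i\le k$ and every $x\in B_i$ we have $B_{i-1}\cup B_{i+1}\subseteq N_B(x)\subseteq B_{i-1}\cup B_i\cup B_{i+1}$, indices modulo $k$. The sets $B_i$ are the clusters, and $k$ is the length. A cyclic braid is empty if it has no edges inside its clusters. For $n\ge 8$ the $n$-vertex graph $H_n$ is defined as follows, where $k\ge 3$: $H_{3k}$ is the empty cyclic braid of length $k$ in which every cluster has size 3; $H_{3k+1}$ is the empty cyclic braid of length $k$ with $k-1$ clusters of size 3 and one cluster of size 4; $H_{3k-1}$ is the empty cyclic braid of length $k$ with $k-1$ clusters of size 3 and one cluster of size 2. *)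

(* Defs.v *)
From mathcomp Require Import all_boot.
From mathcomp Require Import zify.

Set Implicit Arguments.
Unset Strict Implicit.
Unset Printing Implicit Defensive.

Record sgraph := SGraph {
  vertex :> finType;
  adj : rel vertex;
  adj_sym : symmetric adj;
  adj_irrefl : irreflexive adj }.

Arguments adj {G} x y : rename.

Definition nbh (G : sgraph) (x : G) : {set G} := [set y | adj x y].

Definition isomorphic (G H : sgraph) : Prop :=
  exists2 f : G -> H, bijective f & forall x y, adj (f x) (f y) = adj x y.

(* An induced cycle is determined by its vertex set, so holes are counted as
   vertex sets: S is a hole when its elements can be listed without repetition
   as a cyclic sequence c of length at least 4 whose cyclically consecutive
   pairs are exactly the adjacent pairs of S. *)
Definition hole (G : sgraph) (S : {set G}) : bool :=
  (4 <= #|S|) &&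
  [exists c : #|S|.-tuple G,
    [&& uniq c, S == [set x in c] &
     [forall x in S, forall y in S,
        adj x y == ((y == next c x) || (x == next c y))]]].

Definition num_holes (G : sgraph) : nat := #|[set S : {set G} | hole S]|.

Definition max_holes (n : nat) (G : sgraph) : Prop :=
  #|G| = n /\ forall G' : sgraph, #|G'| = n -> num_holes G' <= num_holes G.

(* ordS and ord_pred are successor and predecessor modulo k on 'I_k. *)
Definition cyclic_braid (G : sgraph) (k : nat) (B : 'I_k -> {set G}) : Prop :=
  [/\ 3 <= k,
      forall i, B i != set0,
      forall i j, i != j -> [disjoint B i & B j],
      \bigcup_i B i = [set: G]
    & forall i x, x \in B i ->
        B (ord_pred i) :|: B (ordS i) \subset nbh x /\
        nbh x \subset B (ord_pred i) :|: B i :|: B (ordS i)].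

Definition empty_cyclic_braid (G : sgraph) (k : nat) (B : 'I_k -> {set G})
    : Prop :=
  cyclic_braid B /\ forall i x y, x \in B i -> y \in B i -> ~~ adj x y.

(* The empty cyclic braid of length k whose i-th cluster has size s i: a vertex
   is a pair of a cluster index and an index inside that cluster. The conjunct
   tag u != tag v is redundant for 2 <= k; it makes the relation irreflexive
   for the degenerate values of k too. *)
Section EmptyBraid.
Variables (k : nat) (s : 'I_k -> nat).

Definition braid_vertex : finType := {i : 'I_k & 'I_(s i)}.

Definition braid_adj (u v : braid_vertex) : bool :=
  (tag u != tag v) && ((tag v == ordS (tag u)) || (tag u == ordS (tag v))).

Fact braid_adj_sym : symmetric braid_adj.
Proof. by move=> u v; rewrite /braid_adj eq_sym orbC. Qed.

Fact braid_adj_irrefl : irreflexive braid_adj.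
Proof. by move=> u; rewrite /braid_adj eqxx. Qed.

Definition empty_braid : sgraph := SGraph braid_adj_sym braid_adj_irrefl.

Definition cluster (i : 'I_k) : {set empty_braid} :=
  [set u : braid_vertex | tag u == i].

Lemma card_cluster i : #|cluster i| = s i.
Proof.
have -> : cluster i = [set Tagged (fun j => 'I_(s j)) x | x : 'I_(s i)].
  apply/setP=> u; rewrite inE; apply/eqP/imsetP => [ui|[x _ ->]]//.
  by case: u ui => j y /= ji; subst j; exists y.
by rewrite card_imset ?card_ord //; exact: eq_from_Tagged.
Qed.

Lemma empty_braidP : 3 <= k -> (forall i, 0 < s i) ->
  empty_cyclic_braid cluster.
Proof.
move=> k3 s0.
have nS (i : 'I_k) : ordS i != i.
  apply/eqP=> /(congr1 val) /=; have := ltn_ord i.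
  rewrite leq_eqVlt => /predU1P[e|lt]; first by rewrite e modnn; lia.
  by rewrite modn_small //; lia.
have nbhE i (x : empty_braid) : x \in cluster i ->
    nbh x = cluster (ord_pred i) :|: cluster (ordS i).
  rewrite inE => /eqP xi; subst i; apply/setP=> y; rewrite !inE /= /braid_adj.
  rewrite -(inj_eq (@ordS_inj k) (tag y) (ord_pred _)) ord_predK.
  rewrite (eq_sym (ordS (tag y)) (tag x)) [RHS]orbC.
  have [-> /=|//] := eqVneq (tag x) (tag y).
  by rewrite !(eq_sym (tag y)) (negbTE (nS _)).
split; last first.
  move=> i x y; rewrite !inE => /eqP xi /eqP yi.
  by rewrite /= /braid_adj xi yi eqxx.
split=> //.
- by move=> i; rewrite -card_gt0 card_cluster.
- move=> i j ij; rewrite -setI_eq0; apply/eqP/setP=> u; rewrite !inE.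
  by apply/andP=> -[/eqP ui /eqP uj]; rewrite -ui -uj eqxx in ij.
- by apply/setP=> u; rewrite inE; apply/bigcupP; exists (tag u); rewrite ?inE.
- by move=> i x xi; rewrite (nbhE _ _ xi) setUAC subsetUl.
Qed.

End EmptyBraid.

(* For n = 3k, 3k+1 or 3k-1 the length k is (n+1)/3; the exceptional cluster is
   the last one, and the position is immaterial by rotation. *)
Definition Hgraph_length (n : nat) : nat := n.+1 %/ 3.

Definition Hgraph_size (n : nat) (i : 'I_(Hgraph_length n)) : nat :=
  if i.+1 == Hgraph_length n then
    match n %% 3 with 0 => 3 | 1 => 4 | _ => 2 end
  else 3.

Definition Hgraph (n : nat) : sgraph := empty_braid (@Hgraph_size n).

Lemma Hgraph_braidP n : 8 <= n -> empty_cyclic_braid (@cluster _ (@Hgraph_size n)).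
Proof.
move=> n8; apply: empty_braidP => [|i]; first by rewrite /Hgraph_length; lia.
by rewrite /Hgraph_size; case: ifP => // _; case: (n %% 3) => [|[|m]].
Qed.

Lemma card_Hgraph n : 8 <= n -> #|Hgraph n| = n.
Proof.
move=> n8; rewrite card_tagged sumnE big_map big_enum /=.
under eq_bigr => i _ do rewrite card_ord.
have kE : Hgraph_length n = (Hgraph_length n).-1.+1 by rewrite /Hgraph_length; lia.
have nE := divn_eq n 3; have n3 : n %% 3 < 3 by rewrite ltn_mod.
pose F j := if j.+1 == Hgraph_length n then
    match n %% 3 with 0 => 3 | 1 => 4 | _ => 2 end else 3.
rewrite -(big_mkord xpredT F) kE big_nat_recr //= {2}/F -kE eqxx.
rewrite big_nat (eq_bigr (fun=> 3)) => [|j /= jk]; last first.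
  by rewrite /F ifN //; lia.
rewrite -big_nat sum_nat_const_nat /Hgraph_length.
by case: (n %% 3) n3 nE => [|[|[|m]]] //=; lia.
Qed.

(* Main.v *)
(** Branching over induced paths shows that a graph of order n has at most
    poly(n) 3^(n/3) holes: extending a path by one of d neighbours makes d vertices
    unavailable, and the product of numbers with sum n is largest when they equal
    3. If G has at least as many holes as H_n and its degrees are O(log n), then a
    potential argument yields a long path along which almost all branchings are
    into three vertices with the same continuations. With the low degrees it
    follows that G contains a long braid segment with clusters of size 3. A hole
    of length other than 4 that meets this segment runs through it and leaves at
    its ends, so up to a negligible number of others the holes are at most 27 times
    as many as the induced paths through the rest W of the graph. There are at most
    [tgrow #|W| / 3] of these, and fewer by a constant factor unless W is
    partitioned into layers that are completely joined consecutively; hence G is a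
    cyclic braid for which the product of the cluster sizes is the largest
    possible. Among these, edges inside clusters and two clusters of size 2 instead
    of one of size 4 are excluded by counting holes of length 4. A vertex of large
    degree lies in so few holes that deleting it loses almost nothing, whereas the
    bound decreases by a factor of 3/4. *)
Require Import Defs.
From mathcomp Require Import all_boot.
From mathcomp Require Import all_order all_algebra.
From mathcomp Require Import zify ring lra.

Set Implicit Arguments.
Unset Strict Implicit.
Unset Printing Implicit Defensive.

(** * Holes and induced paths *)

(** The potential needs weights of its own. For [tgrow] a branching into 2 or 4 may lose nothing;
    with [rgrow] every branching except into 3 loses a constant factor, at the price of a bounded
    factor overall. The main obstacle is that three choices with different continuations need not
    lose anything at once: the loss shows only when the path later meets the neighbourhood of a
    choice not taken. Such a neighbourhood is therefore recorded as a class, and the factor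
    [th ^ mass] charges for it in advance.

    If G has at least as many holes as H_n, some pair of ends is joined by more than tgrow(n) / (4
    n^3) induced paths. Every event costs a constant factor, so some long path has only O(log n)
    events. As degrees are O(log n) too, only polylogarithmically many steps are spoiled by them,
    and a path of polylogarithmic length contains a run of good steps so long that 3 to its length
    beats n^3.

    A deficit of any constant factor then settles the comparison with H_n; lower-order terms matter
    only among braids whose cluster sizes have the largest product. *)

Definition hole_cycle (G : sgraph) (c : seq G) : Prop :=
  [/\ uniq c, 4 <= size c &
      {in c &, forall x y, adj x y = (y == next c x) || (x == next c y)}].

Lemma holeP (G : sgraph) (S : {set G}) :
  reflect (exists2 c, hole_cycle c & S = [set x in c]) (hole S).
Proof.
apply: (iffP andP) => [[S4 /existsP[c /and3P[uc /eqP Sc H]]]|[c [uc c4 H] Sc]].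
  exists c => //; split=> //; first by rewrite size_tuple.
  move=> x y xc yc; move/forallP/(_ x)/implyP: H; rewrite {1}Sc inE => /(_ xc).
  by move/forallP/(_ y)/implyP; rewrite {1}Sc inE => /(_ yc) /eqP.
have cS : #|S| = size c by rewrite Sc cardsE; apply/card_uniqP.
split; first by rewrite cS.
have ct : size c == #|S| by rewrite cS.
apply/existsP; exists (Tuple ct); apply/and3P; split=> //=; first exact/eqP.
apply/forallP=> x; apply/implyP; rewrite {1}Sc inE => xc.
apply/forallP=> y; apply/implyP; rewrite {1}Sc inE => yc.
by apply/eqP; exact: H.
Qed.

Lemma adjC (G : sgraph) (x y : G) : adj x y = adj y x.
Proof. exact: adj_sym. Qed.

Lemma adjxx (G : sgraph) (x : G) : adj x x = false.
Proof. exact: adj_irrefl. Qed.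

(** Only the graph induced on [S] matters. So [f] may fail to respect adjacency elsewhere, as does
    the map of a braid with edges inside its parts to H_n. *)
Lemma hole_transfer (G H : sgraph) (f : G -> H) (S : {set G}) :
  {in S &, injective f} -> {in S &, forall x y, adj (f x) (f y) = adj x y} ->
  hole S -> hole (f @: S).
Proof.
move=> fI fA /holeP[c [uc c4 H0] Sc]; apply/holeP; exists (map f c); last first.
  rewrite Sc; apply/setP=> y; rewrite inE; apply/imsetP/mapP => -[x];
    by rewrite ?inE => xc ->; exists x; rewrite ?inE.
have cI : {in c &, injective f} by move=> x y xc yc; apply: fI; rewrite Sc inE.
split; rewrite ?size_map // ?map_inj_in_uniq //.
move=> _ _ /mapP[x xc ->] /mapP[y yc ->].
have nmap z : z \in c -> next (map f c) (f z) = f (next c z).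
  move=> zc; rewrite !next_nth map_f // zc.
  have idx : index (f z) (map f c) = index z c.
    have iz : index (f z) (map f c) < size c.
      by rewrite -(size_map f c) index_mem map_f.
    by rewrite -{2}(nth_index_map z cI zc) index_uniq.
  case: c cI zc idx {uc c4 H0 Sc yc xc} => [//|a c] cI zc idx.
  rewrite idx /=; have [lt|ge] := ltnP (index z (a :: c)) (size c).
    by rewrite (nth_map a).
  by rewrite !nth_default ?size_map.
have inc z : z \in c -> next c z \in c by rewrite mem_next.
have fE u v : u \in c -> v \in c -> (f u == f v) = (u == v).
  by move=> uc' vc; apply/eqP/eqP => [|->//]; exact: cI.
by rewrite fA ?Sc ?inE // H0 // !nmap // !fE ?inc.
Qed.

Lemma next_nthE (T : eqType) (x0 : T) (c : seq T) i : uniq c -> i < size c ->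
  next c (nth x0 c i) = nth x0 c (i.+1 %% size c).
Proof.
move=> uc ic; rewrite next_nth mem_nth // index_uniq //.
case: c uc ic => [//|a c] _ /= ic.
have [e|ne] := eqVneq i (size c).
  by rewrite e modnn nth_default.
by rewrite modn_small /=; [apply: set_nth_default; lia|lia].
Qed.

Section Holes.
Variable G : sgraph.
Implicit Types (x y v a b s t : G) (S T W : {set G}) (p c : seq G).

Lemma nth_uniqG x0 c i j : uniq c -> i < size c -> j < size c ->
  (nth x0 c i == nth x0 c j) = (i == j).
Proof. by move=> uc ic jc; rewrite nth_uniq. Qed.

Lemma nthPG x0 c x : x \in c -> exists2 i, i < size c & nth x0 c i = x.
Proof. by move=> /(nthP x0). Qed.

Lemma hole_indexed S v : hole S -> v \in S ->
  exists c, [/\ uniq c, 4 <= size c, S = [set x in c], head v c = v &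
    forall i j, i < size c -> j < size c -> adj (nth v c i) (nth v c j) =
      (j == i.+1 %% size c) || (i == j.+1 %% size c)].
Proof.
move=> /holeP[c0 [uc c4 H] Sc]; rewrite Sc inE => /rot_to[k c' def_c].
exists (rot k c0); split.
- by rewrite rot_uniq.
- by rewrite size_rot.
- by apply/setP=> x; rewrite !inE mem_rot.
- by rewrite def_c.
move=> i j; rewrite size_rot => ic jc.
have ur : uniq (rot k c0) by rewrite rot_uniq.
have c0S : 0 < size c0 by lia.
rewrite H; do ?by rewrite -(mem_rot k) mem_nth ?size_rot.
have nr := next_rot k uc; rewrite -!nr !next_nthE ?size_rot // !nth_uniqG ?size_rot //;
  by rewrite ltn_mod.
Qed.

Lemma hole_card S : hole S -> 4 <= #|S|.
Proof. by case/andP. Qed.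

Lemma hole_nbrs S v : hole S -> v \in S ->
  exists a b, [/\ a != b, a \in S, b \in S, ~~ adj a b &
    forall x, x \in S -> adj v x = (x == a) || (x == b)].
Proof.
move=> hS vS; have [c [uc c4 Sc hv H]] := hole_indexed hS vS.
have v0 : nth v c 0 = v by rewrite nth0.
have inS i : i < size c -> nth v c i \in S by move=> ?; rewrite Sc inE mem_nth.
exists (nth v c 1), (nth v c (size c).-1).
have m1 i : i.+1 < size c -> i.+1 %% size c = i.+1 by move=> ?; rewrite modn_small.
have sc : (size c).-1.+1 = size c by lia.
split; [ | by apply: inS; lia | by apply: inS; lia | | ].
- by rewrite nth_uniqG //; lia.
- by rewrite H; [rewrite sc modnn m1; lia|lia|lia].
move=> x; rewrite Sc inE => /(nthPG v)[j jc <-].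
rewrite -{1}v0 H //; last by lia.
rewrite !nth_uniqG //; try lia.
rewrite m1; last by exact: leq_trans c4.
congr (_ || _); have [e|ne] := eqVneq j (size c).-1; first by rewrite e sc modnn.
by rewrite m1; lia.
Qed.

(** A cycle is connected: following its cyclic list from a vertex of [T] never leaves [T]. *)
Lemma hole_closed S T : hole S -> T \subset S -> T != set0 ->
  (forall x y, x \in T -> y \in S -> adj x y -> y \in T) -> T = S.
Proof.
move=> hS TS /set0Pn[v vT] H; have vS := subsetP TS _ vT.
have [c [uc c4 Sc hv Ha]] := hole_indexed hS vS.
apply/eqP; rewrite eqEsubset TS; apply/subsetP=> x.
rewrite {1}Sc inE => /(nthPG v)[j jc <-].
elim: j jc => [|j IH] jc; first by rewrite nth0 hv.
apply: H (IH _) _ _; first by lia.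
  by rewrite Sc inE mem_nth.
by rewrite Ha; [rewrite modn_small // eqxx|lia|].
Qed.

(** Each of the four vertices already has its two hole neighbours among them, so [hole_closed]
    applies. *)
Lemma hole_C4 S x y z w : hole S -> x \in S -> y \in S -> z \in S -> w \in S ->
  x != z -> y != w ->
  adj x y -> adj y z -> adj z w -> adj w x -> S = [set x; y; z; w].
Proof.
move=> hS xS yS zS wS xz yw xy yz zw wx; apply/esym/hole_closed => //.
- by apply/subsetP=> u; rewrite !inE => /orP[/orP[/orP[]|]|] /eqP->.
- by apply/set0Pn; exists x; rewrite !inE eqxx.
have nb a b e d : a \in S -> b \in S -> e \in S -> b != e -> adj a b ->
    adj a e -> d \in S -> adj a d -> (d == b) || (d == e).
  move=> aS bS cS bc ab ac dS ad; have [p [q [pq pS qS npq Hn]]] := hole_nbrs hS aS.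
  move: ab ac ad; rewrite !Hn //.
  by move=> /orP[]/eqP E1 /orP[]/eqP E2 /orP[]/eqP E3; move: bc;
    rewrite E1 E2 E3 ?eqxx ?orbT.
have xw : adj x w by rewrite adjC.
have yx : adj y x by rewrite adjC.
have zy : adj z y by rewrite adjC.
have wz : adj w z by rewrite adjC.
have zx : z != x by rewrite eq_sym.
move=> u d; rewrite !inE => /orP[/orP[/orP[]|]|] /eqP-> dS ad.
- by have /orP[->|->] := nb x y w d xS yS wS yw xy xw dS ad; rewrite ?orbT.
- by have /orP[->|->] := nb y x z d yS xS zS xz yx yz dS ad; rewrite ?orbT.
- by have /orP[->|->] := nb z y w d zS yS wS yw zy zw dS ad; rewrite ?orbT.
- by have /orP[->|->] := nb w z x d wS zS xS zx wz wx dS ad; rewrite ?orbT.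
Qed.

Lemma hole_notri S x y z : hole S -> x \in S -> y \in S -> z \in S ->
  adj x y -> adj y z -> adj x z -> False.
Proof.
move=> hS xS yS zS xy yz xz; have [p [q [pq pS qS /negP npq Hn]]] := hole_nbrs hS xS.
move: (xy) (xz); rewrite !Hn // => /orP[]/eqP E1 /orP[]/eqP E2; subst.
- by rewrite adjxx in yz.
- by [].
- by rewrite adjC in yz.
- by rewrite adjxx in yz.
Qed.

(* p lists the interior of an induced path from s to t, with p inside W: the
   vertices of W adjacent to s, other than the next one, become unavailable. *)
Fixpoint ipath t s W p : bool :=
  if p is a :: p' then
    [&& ~~ adj s t, a \in nbh s :&: W & ipath t a (W :\: nbh s) p']
  else adj s t.

(** Vertices that are not next to [s] in the list are not adjacent to it, so they remain available
    when [nbh s] is removed. *)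
Lemma ipath_nth t s W p :
  (forall i j, i < j <= (size p).+1 ->
     adj (nth s (s :: rcons p t) i) (nth s (s :: rcons p t) j) = (j == i.+1)) ->
  {subset p <= W} -> ipath t s W p.
Proof.
elim: p s W => [|a p IH] s W H sub /=; first by rewrite (H 0 1).
apply/and3P; split.
- have := H 0 (size p).+2; rewrite /= nth_rcons ltnn eqxx => -> //.
- by rewrite !inE sub ?inE ?eqxx // andbT; apply: (H 0 1).
apply: IH => [i j ij|y yp].
  have := H i.+1 j.+1; rewrite /= eqSS => <- //.
  by congr (adj _ _); apply: set_nth_default; rewrite /= size_rcons; lia.
rewrite !inE sub ?inE ?yp ?orbT // andbT.
have [k kp <-] := nthPG s yp.
have := H 0 k.+2; rewrite /= nth_rcons kp => ->//.
by lia.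
Qed.

(** A cycle without [v] is an induced path between the neighbours of [v]. Both directions are given
    because [crossing_paths] prescribes the part in which the path starts. *)
Lemma hole_ipath S v : hole S -> v \in S ->
  exists a b p, [/\ adj v a && adj v b, a != b,
    S = v |: (a |: (b |: [set x in p])),
    uniq [:: v, a, b & p] &
    forall W, {subset p <= W} -> ipath b a W p /\ ipath a b W (rev p)].
Proof.
move=> hS vS; have [c [uc c4 Sc hv Ha]] := hole_indexed hS vS.
case: c uc c4 Sc hv Ha => [//|v' [//|a q]] uc c4 Sc /= hv; subst v'.
case/lastP: q uc c4 Sc => [//|p b] uc c4 Sc Ha; exists a, b, p.
have sc : size [:: v, a & rcons p b] = (size p).+3 by rewrite /= size_rcons.
have A1 : adj v a.
  by rewrite (Ha 0 1) /= ?size_rcons.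
have A2 : adj v b.
  have := Ha 0 (size p).+2; rewrite /= !size_rcons nth_rcons ltnn eqxx => -> //.
  by rewrite modnn.
have ub : uniq [:: v, a, b & p].
  have : perm_eq [:: v, a & rcons p b] [:: v, a, b & p].
    by rewrite !perm_cons perm_rcons.
  by move/perm_uniq <-.
split=> //.
- by rewrite A1 A2.
- by move: ub; rewrite /= !inE !negb_or => /and4P[_ /andP[]].
- by rewrite Sc; apply/setP=> x; rewrite !inE mem_rcons inE.
have Hadj i j : i < j <= (size p).+1 ->
    adj (nth v (a :: rcons p b) i) (nth v (a :: rcons p b) j) = (j == i.+1).
  move=> /andP[ij jp].
  have E : (j == i.+1) =
      (j.+1 == i.+2 %% (size p).+3) || (i.+1 == j.+2 %% (size p).+3).
    clear -ij jp; rewrite (@modn_small i.+2); last by lia.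
    rewrite eqSS; have [->|ne] := eqVneq j (size p).+1; first by rewrite modnn orbF.
    by rewrite modn_small; lia.
  have i2 : i.+1 < (size p).+3 by clear -ij jp; lia.
  have j2 : j.+1 < (size p).+3 by [].
  by have := Ha i.+1 j.+1; rewrite /= size_rcons E => <-.
have nthE x y i : i <= (size p).+1 ->
    nth x (a :: rcons p b) i = nth y (a :: rcons p b) i.
  by move=> ip; apply: set_nth_default; rewrite /= size_rcons.
have revE : b :: rcons (rev p) a = rev (a :: rcons p b).
  by rewrite rev_cons rev_rcons.
move=> W sub; split; apply: ipath_nth; do ?by [].
- move=> i j ij; have /andP[lt le] := ij; rewrite !(nthE _ v) ?Hadj //.
  exact: leq_trans (ltnW lt) le.
- rewrite size_rev revE => i j ij; have /andP[lt le] := ij.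
  have le' := leq_trans (ltnW lt) le.
  rewrite !nth_rev /= ?size_rcons // !subSS.
  rewrite !(nthE _ v) ?leq_subr // adjC Hadj; last by rewrite leq_subr andbT; lia.
  by lia.
- by move=> x; rewrite mem_rev; apply: sub.
Qed.

End Holes.

(** * Counting induced paths *)

(* Three times the largest product of positive integers with sum m, that is 3^k,
   4 * 3^(k-1) or 2 * 3^k; only m = 1 differs (4/3 instead of 1), which makes
   [tgrow_le] valid for all d and m. *)
Definition tgrow (m : nat) : nat :=
  match m %% 3 with 0 => 3 | 1 => 4 | _ => 6 end * 3 ^ (m %/ 3).

Lemma tgrowD3 m : tgrow m.+3 = 3 * tgrow m.
Proof.
rewrite /tgrow -addn3 modnDr divnDr // divnn /= addn1 expnS.
by rewrite mulnCA.
Qed.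

Lemma tgrow_ind3 (P : nat -> Prop) :
  P 0 -> P 1 -> P 2 -> (forall m, P m -> P m.+3) -> forall m, P m.
Proof.
move=> P0 P1 P2 PS m; suff: [/\ P m, P m.+1 & P m.+2] by case.
by elim: m => // m [? ? ?]; split=> //; apply: PS.
Qed.

Lemma tgrow_gt0 m : 2 < tgrow m.
Proof. by elim/tgrow_ind3: m => // m; rewrite tgrowD3; lia. Qed.

Lemma tgrow_pred m : 4 * tgrow m <= 3 * tgrow m.+1.
Proof. by elim/tgrow_ind3: m => // m; rewrite !tgrowD3; lia. Qed.

Lemma leq_tgrow m n : m <= n -> tgrow m <= tgrow n.
Proof.
elim: n => [|n IH]; first by rewrite leqn0 => /eqP->.
rewrite leq_eqVlt => /predU1P[->//|/IH le]; have := tgrow_pred n; lia.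
Qed.

Lemma tgrow_step2 m : 2 * tgrow m <= tgrow m.+2.
Proof. by elim/tgrow_ind3: m => // m; rewrite !tgrowD3; lia. Qed.

Lemma tgrow_step_big d m : 6 * (d.+4.+1 * tgrow m) <= 5 * tgrow (d.+4.+1 + m).
Proof.
elim/tgrow_ind3: d => [| | |d IH].
- by rewrite !addSn add0n !tgrowD3; have := tgrow_step2 m; lia.
- by rewrite !addSn add0n !tgrowD3; lia.
- by rewrite !addSn add0n !tgrowD3; have := tgrow_pred m; lia.
have -> : d.+3.+4.+1 + m = (d.+4.+1 + m).+3 by lia.
rewrite tgrowD3; have : d.+3.+4.+1 * tgrow m <= 3 * (d.+4.+1 * tgrow m).
  by rewrite mulnA leq_mul2r; lia.
by move: IH; lia.
Qed.

(** The second argument is the total, with the [d] choices included. These are the branchings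
    without loss: up to the convention for 1, [d] is a factor of some largest product with this sum.
    All others lose at least 1/9, the extreme case being 2 * 4 in place of 3 * 3. *)
Definition tight (d m : nat) :=
  [|| d == 3, (d == 2) && (m %% 3 != 0) | (d == 4) && (m %% 3 == 1)].

Lemma tgrow_two m :
  if m.+2 %% 3 != 0 then 2 * tgrow m = tgrow m.+2
  else 9 * (2 * tgrow m) <= 8 * tgrow m.+2.
Proof.
elim/tgrow_ind3: m => // m IH; rewrite (tgrowD3 m) (tgrowD3 m.+2).
by rewrite -(addn3 m.+2) modnDr; case: ifP IH => _; lia.
Qed.

Lemma tgrow_four m :
  if m.+4 %% 3 == 1 then 4 * tgrow m = tgrow m.+4
  else 9 * (4 * tgrow m) <= 8 * tgrow m.+4.
Proof.
elim/tgrow_ind3: m => // m IH; rewrite (tgrowD3 m) (tgrowD3 m.+4).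
by rewrite -(addn3 m.+4) modnDr; case: ifP IH => _; lia.
Qed.

Lemma tgrow_step d m : 
  if tight d (d + m) then d * tgrow m = tgrow (d + m)
  else 9 * (d * tgrow m) <= 8 * tgrow (d + m).
Proof.
case: d => [|[|[|[|[|d]]]]].
- by rewrite /tight /=; lia.
- by rewrite /tight /= add1n; have := tgrow_pred m; lia.
- by have := tgrow_two m; rewrite /tight add2n /= orbF.
- by rewrite /tight /= !addSn add0n tgrowD3.
- by have := tgrow_four m; rewrite /tight !addSn add0n.
have := tgrow_step_big d m; rewrite /tight /=; lia.
Qed.

Lemma tgrow_le d m : d * tgrow m <= tgrow (d + m).
Proof. by have := tgrow_step d m; case: ifP => _; lia. Qed.

Section Paths.
Variables (G : sgraph) (t : G).
Implicit Types (x y u v a b s : G) (S W : {set G}) (p : seq G).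

(** [k] is fuel and bounds the length; [k = #|G|] is enough to list every induced path. *)
Fixpoint paths k s W : seq (seq G) :=
  if adj s t then [:: [::]] else
  if k is k'.+1 then
    flatten [seq [seq a :: p | p <- paths k' a (W :\: nbh s)]
                | a <- enum (nbh s :&: W)]
  else [::].

Lemma mem_paths k s W p : size p <= k -> ipath t s W p -> p \in paths k s W.
Proof.
elim: p k s W => [|a p IH] k s W /=; first by case: k => [|k] _ /= ->.
case: k => // k; rewrite ltnS => pk /and3P[/negbTE /= -> aA ip].
apply/flatten_mapP; exists a; first by rewrite mem_enum.
by apply/mapP; exists p => //; apply: IH.
Qed.

Lemma size_paths k s W : size (paths k.+1 s W) =
  if adj s t then 1
  else \sum_(a in nbh s :&: W) size (paths k a (W :\: nbh s)).
Proof.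
rewrite /=; case: ifP => // _; rewrite size_flatten /shape -map_comp sumnE.
by rewrite big_map big_enum /=; apply: eq_bigr => a _; rewrite size_map.
Qed.

Lemma card_step s W : #|nbh s :&: W| + #|W :\: nbh s| = #|W|.
Proof. by rewrite setIC cardsID. Qed.

Lemma paths_le k s W : 3 * size (paths k s W) <= tgrow #|W|.
Proof.
elim: k s W => [|k IH] s W.
  by rewrite /=; case: ifP => _ //=; have := tgrow_gt0 #|W|; lia.
rewrite size_paths; case: ifP => _; first by have := tgrow_gt0 #|W|; lia.
rewrite big_distrr /= -(card_step s W); apply: leq_trans (tgrow_le _ _).
by rewrite -sum_nat_const; apply: leq_sum => a _; apply: IH.
Qed.

(* rk witnesses that s, the vertices of W and t form layers 0, 1..r, r+1 in
   which consecutive layers are completely joined and others are not joined *)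
Definition layered s W (rk : G -> nat) r :=
  [/\ rk s = 0, rk t = r.+1, forall x, x \in W -> 0 < rk x <= r,
      forall i, 0 < i <= r -> exists2 x, x \in W & rk x = i &
      {in s |: (t |: W) &, forall x y, (rk y = (rk x).+1 -> adj x y) /\
                                       ((rk x).+1 < rk y -> ~~ adj x y)}].

Definition layer W (rk : G -> nat) i := [set x in W | rk x == i].

Section Layered.
Variables (s0 : G) (W0 : {set G}) (rk : G -> nat) (r : nat).
Hypothesis lay : layered s0 W0 rk r.

Lemma layered_adj x y : x \in W0 -> y \in W0 -> rk y = (rk x).+1 -> adj x y.
Proof.
case: lay => _ _ _ _ H xW yW e; case: (H x y); rewrite ?inE ?xW ?yW ?orbT //.
by move/(_ e).
Qed.

Lemma layered_le x y : x \in W0 -> y \in W0 -> adj x y -> rk y <= (rk x).+1.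
Proof.
case: lay => _ _ _ _ H xW yW a; rewrite leqNgt; apply/negP => lt.
by case: (H x y); rewrite ?inE ?xW ?yW ?orbT // => _ /(_ lt); rewrite a.
Qed.

Lemma layered_t x : x \in W0 -> adj x t = (rk x == r).
Proof.
case: lay => _ rt Hr _ H xW; have /andP[_ xr] := Hr _ xW.
case: (H x t); rewrite ?inE ?xW ?eqxx ?orbT // rt => H1 H2.
apply/idP/eqP => [a|e]; last by apply: H1; rewrite e.
by apply/eqP; rewrite eqn_leq xr leqNgt; apply/negP=> lt; move: (H2 lt); rewrite a.
Qed.

(** The rank grows by at most one along an edge and [t] is adjacent to rank [r] only, so a path
    cannot jump over an exhausted layer. *)
Lemma paths_gap k j u W : W \subset W0 -> u \in W0 -> rk u <= j -> j < r ->
  (forall x, x \in W -> rk x != j.+1) -> paths k u W = [::].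
Proof.
elim: k u W => [|k IH] u W WW uW uj jr gap /=.
  by rewrite layered_t // ifF //; lia.
rewrite layered_t // ifF; last by lia.
have nil_ a : a \in enum (nbh u :&: W) -> paths k a (W :\: nbh u) = [::].
  rewrite mem_enum !inE => /andP[ua aW]; have aW0 := subsetP WW _ aW.
  apply: IH => //.
  - by apply: subset_trans WW; rewrite subsetDl.
  - by have := layered_le uW aW0 ua; have := gap _ aW; lia.
  - by move=> x; rewrite inE => /andP[_ /gap].
elim: (enum _) nil_ => //= a e IHe nil_; rewrite nil_ ?mem_head //=.
by apply: IHe => b be; apply: nil_; rewrite inE be orbT.
Qed.

Definition above W j := [set x in W | j < rk x].

(** Leaving [u] removes all of the next layer. A path that does not step up at once is therefore
    stuck by [paths_gap], and vertices of rank at most [rk u] are of no use. *)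
Lemma paths_above k u W : W \subset W0 -> u \in W0 ->
  3 * size (paths k u W) <= tgrow #|above W (rk u)|.
Proof.
elim: k u W => [|k IH] u W WW uW.
  by rewrite /=; case: ifP => _ //=; have := tgrow_gt0 #|above W (rk u)|; lia.
rewrite size_paths; case: ifP => ut.
  by have := tgrow_gt0 #|above W (rk u)|; lia.
have ur : rk u < r.
  have [_ _ Hr _ _] := lay; have /andP[_] := Hr _ uW.
  by rewrite leq_eqVlt => /predU1P[e|//]; rewrite layered_t // e eqxx in ut.
pose L := layer W rk (rk u).+1.
have LW : L \subset nbh u :&: W.
  apply/subsetP=> x; rewrite !inE => /andP[xW /eqP e]; rewrite xW andbT.
  by apply: layered_adj => //; apply: subsetP WW _ xW.
have WDW : W :\: nbh u \subset W0 by apply: subset_trans WW; rewrite subsetDl.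
rewrite (bigID (fun a => rk a == (rk u).+1)) /= [X in _ + X]big1 ?addn0; last first.
  move=> a; rewrite !inE -andbA => /and3P[ua aW ne].
  have aW0 := subsetP WW _ aW.
  rewrite (@paths_gap k (rk u) a (W :\: nbh u)) //.
    by have := layered_le uW aW0 ua; lia.
  move=> x; rewrite !inE => /andP[nux xW]; apply/eqP=> e; case/negP: nux.
  by apply: layered_adj => //; apply: subsetP WW _ xW.
rewrite (eq_bigl (mem L)); last first.
  move=> a; rewrite /= [RHS]inE !inE; case: (boolP (rk a == _)) => e; rewrite ?andbF // !andbT.
  apply/andP/idP => [[]//|aW]; split=> //.
  by apply: layered_adj; rewrite ?(eqP e) //; apply: subsetP WW _ aW.
have -> : #|above W (rk u)| = #|L| + #|above W (rk u).+1|.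
  rewrite -cardsUI [X in _ + X](_ : _ = 0) ?addn0; last first.
    by apply: eq_card0 => x; rewrite !inE; lia.
  by apply: eq_card => x; rewrite !inE; case: (x \in W) => //=; lia.
rewrite big_distrr /=; apply: leq_trans (tgrow_le _ _).
rewrite -sum_nat_const; apply: leq_sum => a; rewrite inE => /andP[aW /eqP ra].
apply: leq_trans (IH _ _ WDW (subsetP WW _ aW)) _; rewrite ra.
apply/leq_tgrow/subset_leq_card/subsetP=> x; rewrite !inE.
by case/andP=> /andP[_ ->] ->.
Qed.

End Layered.
End Paths.

(** One of at most four equal shares is at least a quarter of the whole, so saving 1/(c+1) of one
    share saves 1/(4(c+1)) of the sum. *)
Lemma one_deficient c e d T P S : 0 < d <= 4 -> S <= P + d.-1 * T ->
  c.+1 * P <= c * T -> 4 * c.+1 <= e.+1 -> e.+1 * S <= e * (d * T).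
Proof.
case: d => // d /andP[_ d4]; rewrite /= => le1 le2 ce.
set Q := d.+1 * T.
have QE : Q = T + d * T by rewrite /Q mulSn.
have Q4 : Q <= 4 * T by rewrite leq_mul2r d4 orbT.
have h1 : c.+1 * S + T <= c.+1 * Q.
  have : c.+1 * S <= c.+1 * (P + d * T) by rewrite leq_mul2l le1 orbT.
  by rewrite QE !mulnDr [c.+1 * T]mulSn; lia.
have h2 : 4 * c.+1 * S + Q <= 4 * c.+1 * Q by rewrite -!mulnA; lia.
have SQ : S <= Q.
  rewrite -(@leq_pmul2l (4 * c.+1)) //; apply: leq_trans h2; exact: leq_addr.
have h3 : (e.+1 - 4 * c.+1) * S <= (e.+1 - 4 * c.+1) * Q by rewrite leq_mul2l SQ orbT.
have h4 X : e.+1 * X = (e.+1 - 4 * c.+1) * X + 4 * c.+1 * X by rewrite -mulnDl subnK.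
rewrite -(leq_add2r Q) [e * Q + Q]addnC -mulSn !h4.
by move: (leq_add h3 h2); rewrite addnA.
Qed.

(** * Stability: nearly optimal path counts force layers *)

Section Stability.
Variables (G : sgraph) (t : G).
Implicit Types (x y u v a b s : G) (S W : {set G}) (p : seq G).

Lemma tgrow_gt3 m : 0 < m -> 3 < tgrow m.
Proof.
case: m => // m _; have := tgrow_pred m; have := tgrow_gt0 m; lia.
Qed.

Lemma layered_nil s W : s != t -> adj s t -> W = set0 ->
  exists rk r, layered t s W rk r /\
    3 * \prod_(i < r) #|layer W rk i.+1| = tgrow #|W|.
Proof.
move=> st a ->; exists (fun x => if x == t then 1 else 0), 0; split; last first.
  by rewrite big_ord0 cards0.
split; rewrite ?eqxx ?(negbTE st) //.
- by move=> x; rewrite inE.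
- by move=> i; lia.
move=> x y; rewrite !inE !orbF => /orP[]/eqP-> /orP[]/eqP->;
  by rewrite ?eqxx ?(negbTE st).
Qed.

(** Let [Y] be the set of choices at [b]. If some [x] outside [Y] has rank at most that of some [y]
    in [Y], the branch at [y] cannot use [x] by [paths_above] and loses a factor 3/4. Otherwise [Y]
    is closed downwards in rank; not being the first layer, it contains the first two, and the
    branch at a vertex of rank 1 is stuck by [paths_gap]. With [one_deficient], 3/4 on one branch
    becomes 15/16. *)
Lemma sibling_small k s W rk r b :
  layered t s W rk r -> t \notin W ->
  ~~ ((adj b t == (r == 0)) && (nbh b :&: W == layer W rk 1)) ->
  16 * (3 * size (paths t k b W)) <= 15 * tgrow #|W|.
Proof.
move=> lay tW neq.
have [rs rt Hr Hsurj Hadj] := lay.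
have small1 : adj b t -> 16 * (3 * 1) <= 15 * tgrow #|W|.
  move=> bt; suff /tgrow_gt3 : 0 < #|W| by lia.
  rewrite card_gt0; apply/eqP => W0; case/negP: neq.
  have r0 : r = 0.
    by case: (r) Hsurj => // r' /(_ 1 isT)[x]; rewrite W0 inE.
  rewrite bt r0 eqxx /=; apply/eqP/setP=> x; rewrite !inE W0 inE andbF.
  by [].
case: k => [|k]; first by rewrite /=; case: ifP => bt; [exact: small1|rewrite !muln0].
rewrite size_paths; case: ifP => bt; first exact: small1.
set Y := nbh b :&: W; set W' := W :\: nbh b.
have step := tgrow_step #|Y| #|W'|; rewrite card_step in step.
have le_ y : 3 * size (paths t k y W') <= tgrow #|W'| by apply: paths_le.
case: ifP step => [tgt eqY|_ leY]; last first.
  have : 3 * (\sum_(a in Y) size (paths t k a W')) <= #|Y| * tgrow #|W'|.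
    by rewrite big_distrr /= -sum_nat_const; apply: leq_sum => y _; apply: le_.
  by lia.
have Y4 : 0 < #|Y| <= 4.
  by move: tgt; rewrite /tight => /or3P[/eqP->|/andP[/eqP-> _]|/andP[/eqP-> _]].
suff [y0 y0Y y0s] : exists2 y0, y0 \in Y &
    4 * (3 * size (paths t k y0 W')) <= 3 * tgrow #|W'|.
  have : 3 * (\sum_(a in Y) size (paths t k a W')) <=
      3 * size (paths t k y0 W') + #|Y|.-1 * tgrow #|W'|.
    rewrite (bigD1 y0) //= mulnDr leq_add2l big_distrr /=.
    have -> : #|Y|.-1 = #|Y :\ y0| by rewrite (cardsD1 y0 Y) y0Y.
    rewrite -sum_nat_const (eq_bigl (fun a => a \in Y :\ y0)); last first.
      by move=> a; rewrite in_setD1 andbC.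
    by apply: leq_sum => y _; apply: le_.
  by move=> /(one_deficient Y4)/(_ y0s); rewrite -eqY; apply.
have YW y : y \in Y -> y \in W by rewrite inE => /andP[].
have W'W : W' \subset W by rewrite subsetDl.
case: (boolP [exists y in Y, exists x in W', rk x <= rk y]) => [|H].
  case/existsP=> y /andP[yY /existsP[x /andP[xW' le]]]; exists y => //.
  apply: leq_trans (leq_mul (leqnn 4) (paths_above lay k W'W (YW _ yY))) _.
  have lt : #|above rk W' (rk y)| < #|W'|.
    apply: proper_card; apply/properP; split; first by apply/subsetP=> z; rewrite inE => /andP[].
    by exists x; rewrite // inE xW' /= -leqNgt.
  have := tgrow_pred #|above rk W' (rk y)|; have := leq_tgrow lt; lia.
have all_in y x : y \in Y -> x \in W -> rk x <= rk y -> x \in Y.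
  move=> yY xW le; apply: contraNT H => xY; apply/existsP; exists y.
  rewrite yY; apply/existsP; exists x; rewrite le !inE xW !andbT.
  by move: xY; rewrite !inE xW andbT.
have [y yY] : exists y, y \in Y by apply/set0Pn; rewrite -card_gt0; case/andP: Y4.
have /andP[ry yr] := Hr _ (YW _ yY).
have r0 : 0 < r by apply: leq_trans yr.
have [y1 y1W ry1] := Hsurj 1 r0.
have LY : layer W rk 1 \subset Y.
  apply/subsetP=> x; rewrite inE => /andP[xW /eqP rx].
  by apply: all_in yY xW _; rewrite rx.
have y1Y : y1 \in Y by apply: (subsetP LY); rewrite inE y1W ry1.
have [y2 y2Y ry2] : exists2 y2, y2 \in Y & 2 <= rk y2.
  apply/exists_inP; apply: contraNT neq; rewrite negb_exists_in => /forall_inP Hn.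
  rewrite bt (_ : (r == 0) = false); last by case: (r) r0.
  rewrite eqxx /= -/Y eqEsubset LY andbT; apply/subsetP=> x xY.
  rewrite inE YW // eqn_leq; have := Hn _ xY; have /andP[] := Hr _ (YW _ xY).
  by move=> -> _; rewrite andbT -ltnNge ltnS.
exists y1 => //; rewrite (@paths_gap _ _ _ _ _ _ lay k 1 y1 W' W'W y1W) ?ry1 //.
  by have /andP[_] := Hr _ (YW _ y2Y); apply: leq_trans.
move=> x xW'; apply/eqP=> rx.
have xW := subsetP W'W _ xW'.
have : x \in Y by apply: all_in y2Y xW _; rewrite rx.
by move: xW'; rewrite !inE => /andP[/negbTE ->].
Qed.

(** Unless all branches are deficient, some [a0] has a layering of the remaining set. A choice [b]
    that is joined differently to this layering is deficient by [sibling_small]; 15/16 on one of at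
    most four branches gives 63/64, which is below 99/100. If there is no such [b], the choices at
    [s] form a new first layer. *)
Lemma paths_stable k s W : s \notin W -> t \notin W -> s != t ->
  100 * (3 * size (paths t k s W)) <= 99 * tgrow #|W| \/
  exists rk r, layered t s W rk r /\
    3 * \prod_(i < r) #|layer W rk i.+1| = tgrow #|W|.
Proof.
elim: k s W => [|k IH] s W sW tW st.
  rewrite /=; case: ifP => [a|_]; last by left; rewrite !muln0.
  have [W0|] := eqVneq W set0; first by right; apply: layered_nil.
  by rewrite -card_gt0 => /tgrow_gt3 ?; left; rewrite /=; lia.
rewrite size_paths; case: ifP => [a|nst].
  have [W0|] := eqVneq W set0; first by right; apply: layered_nil.
  by rewrite -card_gt0 => /tgrow_gt3 ?; left; rewrite /=; lia.
set A := nbh s :&: W; set W' := W :\: nbh s.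
have le_ y : 3 * size (paths t k y W') <= tgrow #|W'| by apply: paths_le.
have step := tgrow_step #|A| #|W'|; rewrite card_step in step.
case: ifP step => [tgt eqA|_ leA]; last first.
  have : 3 * (\sum_(a in A) size (paths t k a W')) <= #|A| * tgrow #|W'|.
    by rewrite big_distrr /= -sum_nat_const; apply: leq_sum => y _; apply: le_.
  by left; lia.
have A4 : 0 < #|A| <= 4.
  by move: tgt; rewrite /tight => /or3P[/eqP->|/andP[/eqP-> _]|/andP[/eqP-> _]].
case: (boolP [forall a in A, 100 * (3 * size (paths t k a W')) <= 99 * tgrow #|W'|]) =>
    [/forall_inP Hall|].
  left; rewrite -eqA mulnA big_distrr /= mulnCA -sum_nat_const.
  by apply: leq_sum => a aA; rewrite -mulnA; apply: Hall.
rewrite negb_forall_in => /exists_inP[a0 a0A big].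
have [a0s a0W] : adj s a0 /\ a0 \in W by move: a0A; rewrite !inE => /andP[].
have tW' : t \notin W' by rewrite inE negb_and tW orbT.
have AW b : b \in A -> b \in W by rewrite inE => /andP[].
have AnW' b : b \in A -> b \notin W' by rewrite !inE => /andP[->].
have At b : b \in A -> b != t by move=> /AW bW; apply: contraNneq tW => <-.
have [le|[rk [r [lay prodE]]]] := IH a0 W' (AnW' _ a0A) tW' (At _ a0A).
  by rewrite le in big.
pose same b := (adj b t == (r == 0)) && (nbh b :&: W' == layer W' rk 1).
case: (boolP [forall b in A, same b]) => [/forall_inP Hsame|]; last first.
  rewrite negb_forall_in => /exists_inP[b bA nb]; left.
  have sm := sibling_small k lay tW' nb.
  have : 3 * (\sum_(a in A) size (paths t k a W')) <=
      3 * size (paths t k b W') + #|A|.-1 * tgrow #|W'|.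
    rewrite (bigD1 b) //= mulnDr leq_add2l big_distrr /=.
    have -> : #|A|.-1 = #|A :\ b| by rewrite (cardsD1 b A) bA.
    rewrite -sum_nat_const (eq_bigl (fun a => a \in A :\ b)); last first.
      by move=> a; rewrite in_setD1 andbC.
    by apply: leq_sum => y _; apply: le_.
  by move=> /(one_deficient A4)/(_ sm); rewrite -eqA; apply.
right; have [rs rt Hr Hsurj Hadj] := lay.
pose rk' x := if x == s then 0 else if x \in A then 1 else (rk x).+1.
have sA : s \notin A by apply: contra sW => /AW.
have rkA b : b \in A -> rk' b = 1.
  by move=> bA; rewrite /rk' bA; case: eqP bA => // ->; rewrite (negbTE sA).
have rkW' x : x \in W' -> rk' x = (rk x).+1.
  move=> xW'; rewrite /rk'; case: eqP => [e|_].
    by move: xW'; rewrite e inE (negbTE sW) andbF.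
  by case: ifP => // /AnW'; rewrite xW'.
have rkt : rk' t = r.+2.
  rewrite /rk' eq_sym (negbTE st) rt; case: ifP => // /AW; by rewrite (negbTE tW).
have Wcase x : x \in W -> (x \in A) || (x \in W').
  by move=> xW; rewrite !inE xW !andbT orbN.
have rks : rk' s = 0 by rewrite /rk' eqxx.
have adjb b x : b \in A -> x \in W' -> adj b x = (rk x == 1).
  move=> bA xW'; have /andP[_ /eqP/setP/(_ x)] := Hsame _ bA.
  by rewrite in_setI xW' andbT in_set [in RHS]in_set xW'.
have adjbt b : b \in A -> adj b t = (r == 0).
  by move=> bA; have /andP[/eqP-> _] := Hsame _ bA.
have sW' x : x \in W' -> ~~ adj s x by rewrite !inE => /andP[].
exists rk', r.+1; split; last first.
  rewrite big_ord_recl /= mulnCA.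
  have -> : layer W rk' 1 = A.
    apply/setP=> x; rewrite inE; apply/andP/idP => [[/Wcase/orP[//|xW'] /eqP]|xA].
      by rewrite rkW' // => -[e]; have := Hr _ xW'; rewrite e.
    by rewrite AW ?rkA.
  rewrite -eqA -prodE; congr (_ * (_ * _)); apply: eq_bigr => i _.
  apply: eq_card => x; rewrite !inE /bump /= add1n.
  have [xW|] /= := boolP (x \in W); last by rewrite andbF.
  case/orP: (Wcase _ xW) => [xA|xW'].
    by rewrite rkA //; move: xA; rewrite !inE => /andP[-> _].
  by rewrite rkW' // eqSS; move: xW'; rewrite !inE => /andP[->].
split=> //.
- move=> x /Wcase/orP[/rkA->//|xW']; by rewrite rkW' //; case/andP: (Hr _ xW').
- case=> [//|[|i]] /andP[_ ir]; first by exists a0; rewrite ?rkA.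
  have [x xW' e] := Hsurj i.+1 ir.
  by exists x; rewrite ?rkW' ?e //; move: xW'; rewrite inE => /andP[].
have sym_case x y : x \in s |: (t |: W) -> y \in s |: (t |: W) ->
    [\/ x = s, x = t, x \in A | x \in W'] /\ [\/ y = s, y = t, y \in A | y \in W'].
  rewrite !in_setU1 => hx hy; split.
    case/or3P: hx => [/eqP|/eqP|/Wcase/orP[]];
      by [constructor 1|constructor 2|constructor 3|constructor 4].
  case/or3P: hy => [/eqP|/eqP|/Wcase/orP[]];
    by [constructor 1|constructor 2|constructor 3|constructor 4].
move=> x y xU yU; have [hx hy] := sym_case _ _ xU yU.
case: hx => [->|->|xA|xW'].
- rewrite rks; case: hy => [->|->|yA|yW'].
  + by rewrite rks.
  + by rewrite rkt nst.
  + by rewrite rkA //; move: yA; rewrite !inE => /andP[->].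
  + by rewrite rkW' // sW' //; split=> // -[e]; have := Hr _ yW'; rewrite e.
- rewrite rkt; case: hy => [->|->|yA|yW'].
  + by rewrite rks.
  + by rewrite rkt; split=> [/eqP|]; [rewrite ltn_eqF|rewrite ltnNge leqnSn].
  + by rewrite rkA.
  + rewrite rkW' //; split=> [[e]|].
      by have /andP[_] := Hr _ yW'; rewrite e leqNgt ltnS leqnSn.
    have /andP[_ le] := Hr _ yW'; rewrite ltnS => lt.
    by move: (leq_trans lt le); rewrite ltnNge -addn2 leq_addr.
- rewrite (rkA _ xA); case: hy => [->|->|yA|yW'].
  + by rewrite rks.
  + by rewrite rkt adjbt //; case: (r).
  + by rewrite (rkA _ yA).
  + by rewrite (rkW' _ yW') adjb //; split=> [[->]//|]; rewrite ltnS; case: eqP => // ->.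
- rewrite (rkW' _ xW'); case: hy => [->|->|yA|yW'].
  + by rewrite rks.
  + case: (Hadj x t); rewrite ?in_setU1 ?xW' ?eqxx ?orbT // rkt rt => H1 H2.
    by split=> [[e]|]; [apply: H1; rewrite e|apply: H2].
  + by rewrite (rkA _ yA); split=> // -[e]; have := Hr _ xW'; rewrite -e.
  + case: (Hadj x y); rewrite ?in_setU1 ?xW' ?yW' ?orbT // (rkW' _ yW') => H1 H2.
    by split=> [[e]|]; [apply: H1; rewrite e|apply: H2].
Qed.

End Stability.

(** * The potential of a path *)

Section BranchingWeights.
Import Order.TTheory GRing.Theory Num.Theory.

(* 36 times 3^k, (13/9) 3^k or (25/12) 3^k. Against these weights, only
   branching into exactly 3 is free of loss: see [rgrow_lossy]. *)
Definition rgrow (m : nat) : nat :=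
  match m %% 3 with 0 => 36 | 1 => 52 | _ => 75 end * 3 ^ (m %/ 3).

Lemma rgrowD3 m : rgrow m.+3 = 3 * rgrow m.
Proof. by rewrite /rgrow -addn3 modnDr divnDr // divnn /= addn1 expnS mulnCA. Qed.

Lemma rgrow_pred m : 36 * rgrow m <= 25 * rgrow m.+1.
Proof. by elim/tgrow_ind3: m => // m; rewrite !rgrowD3; lia. Qed.

Lemma rgrow_step2 m : 27 * rgrow m <= 13 * rgrow m.+2.
Proof. by elim/tgrow_ind3: m => // m; rewrite !rgrowD3; lia. Qed.

Lemma rgrow_tgrow m : rgrow m <= 13 * tgrow m.
Proof. by elim/tgrow_ind3: m => // m; rewrite rgrowD3 tgrowD3; lia. Qed.

Local Open Scope ring_scope.

Section Discount.
Variables (R : realFieldType) (th : R).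
Hypotheses (th_lo : 100 * (100 * (1 - th)) <= 1) (th_lt1 : th < 1).

Lemma th_gt0 : 0 < th. Proof. by move: th_lo; lra. Qed.
Lemma th_le1 : th <= 1. Proof. exact: ltW. Qed.
Lemma thX_gt0 n : 0 < th ^+ n. Proof. exact: exprn_gt0 th_gt0. Qed.
Lemma thX_le1 n : th ^+ n <= 1. Proof. by apply: exprn_ile1; rewrite ?th_le1 ?ltW ?th_gt0. Qed.

(** Bernoulli's inequality. *)
Lemma thX_ge n : 1 - n%:R * (1 - th) <= th ^+ n.
Proof.
elim: n => [|n IH]; first by rewrite expr0 mul0r subr0.
have -> : th ^+ n.+1 = th ^+ n - (1 - th) * th ^+ n.
  by rewrite exprS mulrBl mul1r opprB addrC subrK.
rewrite -natr1 mulrDl mul1r opprD addrA; apply: lerB; first exact: IH.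
by rewrite ler_piMr ?thX_le1 // subr_ge0 th_le1.
Qed.

Lemma thX_ge_small n c : (n <= c)%N -> 100 * (100 * (1 - th ^+ n)) <= c%:R.
Proof.
move=> nc; have h := thX_ge n.
have h1 : n%:R * (1 - th) <= c%:R * (1 - th).
  by rewrite ler_wpM2r ?ler_nat // subr_ge0 th_le1.
have h2 : c%:R * (100 * (100 * (1 - th))) <= c%:R * 1 :> R.
  by rewrite ler_wpM2l ?ler0n.
move: h1 h2; rewrite mulr1.
move: h; move: (c%:R : R) (n%:R * (1 - th)) (th ^+ n) => C N A; lra.
Qed.

(** At [th = 1] both sides are 3 and the derivatives are 7 and 6, so below 1 the left side falls
    faster. This is the extreme case of [th_three], where the exponents deviate from [E] by -2, -2
    and 5. *)
Lemma th_seven : th ^+ 7 + 2 <= 3 * th ^+ 2.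
Proof.
have -> : th ^+ 7 + 2 =
    3 * th ^+ 2 + (th - 1) * (th ^+ 6 + th ^+ 5 + th ^+ 4 + th ^+ 3 + th ^+ 2 - 2 * th - 2).
  by ring.
rewrite gerDl; apply: mulr_le0_ge0; first by rewrite subr_le0 th_le1.
have := thX_ge 6; have := thX_ge 5; have := thX_ge 4; have := thX_ge 3.
by have := thX_ge 2; have := th_le1; move: th_lo; lra.
Qed.

Lemma leq_thX m n : (m <= n)%N -> th ^+ n <= th ^+ m.
Proof. by move=> mn; apply: ler_wiXn2l; rewrite ?th_le1 ?ltW ?th_gt0. Qed.

Lemma th_two a b : th ^+ a + th ^+ b <= th ^+ (a + b) + 1.
Proof. have := thX_le1 a; have := thX_le1 b; rewrite exprD; nra. Qed.

(** By convexity of [th ^ n] in [n] the sum is largest when two exponents are as small as allowed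
    and the third takes the rest; [th_two] moves them there. *)
Lemma th_three E x y z : (E <= x + 2)%N -> (E <= y + 2)%N -> (E <= z + 2)%N ->
  (3 * E < x + y + z)%N -> th ^+ x + th ^+ y + th ^+ z <= 3 * th ^+ E.
Proof.
move=> /subnKC xE /subnKC yE /subnKC zE lt.
rewrite -(ler_pM2r (thX_gt0 2)) !mulrDl -mulrA -!exprD -xE -yE -zE !exprD.
set a := (x + 2 - E)%N in xE *; set b := (y + 2 - E)%N in yE *.
set c := (z + 2 - E)%N in zE *.
have abc : (7 <= a + b + c)%N by lia.
suff : th ^+ a + th ^+ b + th ^+ c <= 3 * th ^+ 2.
  move/(ler_wpM2l (ltW (thX_gt0 E))); rewrite !mulrDr; lra.
have h1 := th_two a b; have h2 := th_two (a + b) c; have h3 := leq_thX abc.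
have := th_seven.
by lra.
Qed.

Lemma rgrow_lossy d m : d != 3%N ->
  100 * (d%:R * (rgrow m)%:R) <= 97 * (th ^+ (4 * d + 1) * (rgrow (d + m))%:R).
Proof.
(* A saving of 1/27 survives the powers of [th] up to 30: 26/27 divided by 997/1000 is still less
   than 97/100. *)
have P (n : nat) x y : (n <= 30)%N -> (27 * x <= 26 * y)%N ->
    100 * x%:R <= 97 * (th ^+ n * y%:R) :> R.
  move=> n30 le; have := thX_ge_small n30.
  have : (27%:R * x%:R : R) <= 26%:R * y%:R by rewrite -!natrM ler_nat.
  have : (0 : R) <= y%:R by rewrite ler0n.
  move: (th ^+ n) (x%:R : R) (y%:R : R) => A X Y Y0 h1 h2.
  have h4 : 997 / 1000 <= A by lra.
  by have := ler_wpM2r Y0 h4; lra.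
case: d => [|[|[|[//|d _]]]].
- move=> _; rewrite mul0r mulr0; apply: mulr_ge0 => //; apply: mulr_ge0 => //.
  by rewrite ltW ?thX_gt0.
- by move=> _; rewrite -natrM; apply: P => //; have := rgrow_pred m; rewrite add1n; lia.
- by move=> _; rewrite -natrM; apply: P => //; have := rgrow_step2 m; rewrite add2n; lia.
elim/tgrow_ind3: d => [| | |d IH].
- rewrite -natrM; apply: P => //.
  by have := rgrow_pred m; rewrite !addSn add0n rgrowD3; lia.
- rewrite -natrM; apply: P => //.
  by have := rgrow_step2 m; rewrite !addSn add0n rgrowD3; lia.
- rewrite -natrM; apply: P => //.
  by rewrite !addSn add0n !rgrowD3; lia.
(* The exponent is unbounded, hence induction: three more choices at most double the left side,
   while [rgrow] triples, which absorbs [th ^ 12]. *)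
have -> : (4 * d.+3.+4 + 1 = 12 + (4 * d.+4 + 1))%N by lia.
have -> : (d.+3.+4 + m = (d.+4 + m).+3)%N by lia.
move: (4 * d.+4 + 1)%N IH => N IH; rewrite exprD rgrowD3 natrM.
have h1 : d.+3.+4%:R * (rgrow m)%:R <= 2 * (d.+4%:R * (rgrow m)%:R) :> R.
  by rewrite mulrA ler_wpM2r ?ler0n // -natrM ler_nat; lia.
have h2 := thX_ge_small (leqnn 12).
have h3 : 0 <= th ^+ N * (rgrow (d.+4 + m))%:R.
  by apply: mulr_ge0; rewrite ?ler0n // ltW ?thX_gt0.
rewrite -[th ^+ 12 * _ * _]mulrA [th ^+ N * (3 * _)]mulrCA.
move: (th ^+ N * _) (d.+3.+4%:R * _) (d.+4%:R * _) (th ^+ 12) h1 h2 h3 IH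
  => X Y Z A h1 h2 h3 IH; nra.
Qed.

(** Each vertex multiplies [rgrow] by at least 36/25, more than [th ^ 4] takes away. This is needed
    when a path ends while classes of mass up to [4 * m] survive. *)
Lemma rgrow_th m : 1 <= 97 / 100 * ((rgrow m)%:R * th ^+ (4 * m)).
Proof.
suff : 36 <= (rgrow m)%:R * th ^+ (4 * m) by lra.
elim: m => [|m IH]; first by rewrite muln0 expr0 mulr1 (_ : rgrow 0 = 36%N).
rewrite mulnS exprD; have h := thX_ge_small (leqnn 4).
have : 36 * (rgrow m)%:R <= 25 * (rgrow m.+1)%:R :> R.
  by rewrite -[36]/(36%:R) -[25]/(25%:R) -!natrM ler_nat rgrow_pred.
have : (0 : R) <= (rgrow m.+1)%:R by rewrite ler0n.
have := thX_gt0 (4 * m).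
move: h IH; move: (th ^+ (4 * m)) (th ^+ 4) ((rgrow m)%:R : R) ((rgrow m.+1)%:R : R)
  => A B X Y h IH A0 Y0 XY.
have h1 : 36 * 36 <= 25 * (Y * A) by nra.
have h2 : 0 <= Y * A by nra.
nra.
Qed.

End Discount.

End BranchingWeights.

(** * Disjoint classes carried along a path *)

Section EventClasses.
Import Order.TTheory GRing.Theory Num.Theory.

Section States.
Variables (G : sgraph).
Implicit Types (x y u v a b s : G) (S W Y : {set G}) (p : seq G) (C : seq {set G}).

Definition ternary s W := #|nbh s :&: W| == 3.
Definition ternary1 s W :=
  ternary s W && [forall a in nbh s :&: W, ternary a (W :\: nbh s)].
(** Three levels of ternary branching: a class created at [s] consists of vertices on the third
    level, whose ternarity bounds their degrees outside the class. *)
Definition perfect s W :=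
  ternary1 s W && [forall a in nbh s :&: W, ternary1 a (W :\: nbh s)].

(** Summed over three choices, the weight of a class that is hit but not exhausted exceeds three
    times its old weight. From size 3, two choices leave size 2 or one leaves size 1, which gives 4
    against 3; from size 2, two choices leave size 1, which gives 8 against 6. *)
Definition weight (n : nat) : nat := match n with 1 => 4 | 2 => 2 | 3 => 1 | _ => 0 end.

(* A state (s, W, C) of the exploration of a path has a current vertex s, a set W
   of available vertices and a list C of disjoint classes. When s is perfect and
   the path goes on to a, a class is the neighbourhood in the remaining set of
   another choice b, provided that it is not the one of a: it is evidence that
   the graph is not a braid here. An event is the visit of a vertex that is not
   perfect, or the creation of a class. *)
Definition survivors s a C : seq {set G} :=
  [seq Y :\: nbh s | Y <- C & (a \notin Y) && ~~ (Y \subset nbh s)].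

Definition created s W a C : seq {set G} :=
  if perfect s W then
    if [pick b in nbh s :&: W |
         (nbh b :&: (W :\: nbh s) != nbh a :&: (W :\: nbh s)) &&
         all (fun Y => [disjoint nbh b :&: (W :\: nbh s) & Y]) (survivors s a C)]
    is Some b then [:: nbh b :&: (W :\: nbh s)] else [::]
  else [::].

Definition next_classes s W a C := created s W a C ++ survivors s a C.

Definition event s W a C : nat := if perfect s W then size (created s W a C) else 1.

Fixpoint events s W C p : nat :=
  if p is a :: p' then
    event s W a C + events a (W :\: nbh s) (next_classes s W a C) p'
  else 0.

Definition light s W Y y := #|nbh y :&: ((s |: W) :\: Y)| <= 3.

(** The vertices of [Y] adjacent to [s] leave the class at the next step, so only the others must be
    light. One light vertex is required in any case, for [dominated_class]. *)
Definition valid s W Y :=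
  [&& Y \subset W, 0 < #|Y| <= 3, [forall y in Y, (y \in nbh s) || light s W Y y]
    & [exists y in Y, light s W Y y]].

Definition valid_state s W C :=
  [/\ s \notin W, all (valid s W) C & forall x, count (fun Y : {set G} => x \in Y) C <= 1].

Definition mass C := \sum_(Y <- C) weight #|Y|.

Lemma ternary1P s W a : ternary1 s W -> a \in nbh s :&: W ->
  #|nbh a :&: (W :\: nbh s)| = 3.
Proof. by case/andP=> _ /forall_inP H /H /eqP. Qed.

Lemma perfect1 s W : perfect s W -> ternary1 s W.
Proof. by case/andP. Qed.

Lemma light_mono s a W Y y : a \in nbh s :&: W -> a \notin Y ->
  light s W Y y -> light a (W :\: nbh s) (Y :\: nbh s) y.
Proof.
rewrite inE => /andP[_ aW] aY; apply: leq_trans.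
apply/subset_leq_card/setIS/subsetP=> z; rewrite !inE.
case: (eqVneq z a) => [->|_] /=; first by rewrite aY aW !orbT.
by case: (adj s z) => //= /andP[-> ->]; rewrite orbT.
Qed.

Lemma valid_survivor s W a Y : a \in nbh s :&: W -> valid s W Y ->
  a \notin Y -> ~~ (Y \subset nbh s) -> valid a (W :\: nbh s) (Y :\: nbh s).
Proof.
move=> aA /and4P[YW /andP[Y0 Y3] /forall_inP Hl _] aY Ys.
have lt y : y \in Y :\: nbh s -> light a (W :\: nbh s) (Y :\: nbh s) y.
  rewrite inE => /andP[yns yY]; apply: light_mono => //.
  by have := Hl _ yY; rewrite (negbTE yns).
have [y yY'] : exists y, y \in Y :\: nbh s.
  by case/subsetPn: Ys => y yY yns; exists y; rewrite inE yns.
apply/and4P; split.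
- exact: setSD.
- rewrite card_gt0; apply/andP; split; first by apply/set0Pn; exists y.
  by apply: leq_trans Y3; rewrite subset_leq_card ?subsetDl.
- by apply/forall_inP=> z zY; rewrite lt ?orbT.
- by apply/exists_inP; exists y; rewrite ?lt.
Qed.

Lemma createdP s W a C Y : Y \in created s W a C ->
  perfect s W /\ exists b, [/\ b \in nbh s :&: W, Y = nbh b :&: (W :\: nbh s),
    Y != nbh a :&: (W :\: nbh s) &
    all (fun Z : {set G} => [disjoint Y & Z]) (survivors s a C)].
Proof.
rewrite /created; case: ifP => // pf; case: pickP => // b /andP[bA /andP[ne dj]].
by rewrite inE => /eqP->; split=> //; exists b.
Qed.

(** Two different neighbourhoods of size 3, so the class has a vertex not adjacent to [a]. Such a
    vertex has three neighbours outside the class by the third level of [perfect], and [a] adds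
    none. *)
Lemma valid_created s W a C Y : a \in nbh s :&: W -> Y \in created s W a C ->
  valid a (W :\: nbh s) Y.
Proof.
move=> aA /createdP[pf [b [bA -> ne _]]].
set W' := W :\: nbh s in ne *.
have t1 := perfect1 pf.
have ca : #|nbh a :&: W'| = 3 by apply: ternary1P aA.
have cb : #|nbh b :&: W'| = 3 by apply: ternary1P bA.
have lt y : y \in nbh b :&: W' -> y \notin nbh a -> light a W' (nbh b :&: W') y.
  move=> yb yna; have /andP[_ /forall_inP/(_ _ bA) t1b] := pf.
  rewrite /light -(ternary1P t1b yb) subset_leq_card //.
  apply/subsetP=> z; rewrite !inE => /and3P[yz H /orP[/eqP e|zW]].
    by move: yna; rewrite inE adjC -e yz.
  by move: H; rewrite yz zW andbT => ->.
apply/and4P; split; first exact: subsetIr.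
- by rewrite cb.
- by apply/forall_inP=> y yY; case: (boolP (y \in nbh a)) => //= yna; apply: lt.
have [y yb yna] : exists2 y, y \in nbh b :&: W' & y \notin nbh a :&: W'.
  apply/subsetPn; apply: contra ne => sub.
  by rewrite eqEcard sub ca cb.
apply/exists_inP; exists y => //; apply: lt => //.
by move: yna; rewrite inE; move: yb; rewrite inE => /andP[_ ->]; rewrite andbT.
Qed.

Lemma next_valid s W a C : valid_state s W C -> a \in nbh s :&: W ->
  valid_state a (W :\: nbh s) (next_classes s W a C).
Proof.
move=> [sW vC cC] aA; split.
- by rewrite inE negb_and negbK; case/setIP: aA => ->.
- rewrite all_cat; apply/andP; split; first by apply/allP=> Y; apply: valid_created aA.
  rewrite all_map all_filter; apply: sub_all vC => Y vY /=.
  by apply/implyP=> /andP[? ?]; apply: valid_survivor.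
move=> x; rewrite count_cat.
have le1 : count (fun Y : {set G} => x \in Y) (survivors s a C) <= 1.
  rewrite count_map count_filter; apply: leq_trans (cC x).
  by apply: sub_count => Y /= /andP[]; rewrite inE => /andP[].
case E: (created s W a C) => [|Y [|Z q]]; rewrite ?add0n //=; last first.
  by move: E; rewrite /created; case: ifP => // _; case: pickP.
have /createdP[_ [b [_ _ _ dj]]] : Y \in created s W a C by rewrite E inE.
case xY: (x \in Y); rewrite /= ?addn0 ?add0n //.
rewrite (_ : count _ _ = 0) //; apply/eqP; rewrite -leqn0 leqNgt -has_count.
apply/hasPn=> Z /(allP dj); rewrite disjoint_sym => dZ; apply/negP=> xZ.
by move/pred0P/(_ x): dZ; rewrite /= xZ xY.
Qed.

Lemma sum_count_le s W C (A : {set G}) : valid_state s W C ->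
  \sum_(Y <- C) #|Y :&: A| <= #|A|.
Proof.
move=> [_ _ cC]; rewrite -sum1_card.
rewrite (eq_bigr (fun Y : {set G} => \sum_(x in A) (x \in Y : nat))) => [|Y _].
  rewrite exchange_big /=; apply: leq_sum => x _.
  by rewrite -big_mkcond /= sum1_count; apply: cC.
rewrite -sum1_card (eq_bigl (fun x => (x \in A) && (x \in Y))); last first.
  by move=> x; rewrite inE andbC.
by rewrite big_mkcondr.
Qed.

Lemma mass_le s W C : valid_state s W C -> mass C <= 4 * #|W|.
Proof.
move=> vs; apply: leq_trans (_ : 4 * \sum_(Y <- C) #|Y :&: W| <= _); last first.
  by rewrite leq_mul2l /= (sum_count_le _ vs).
have [_ /allP vC _] := vs.
rewrite big_distrr /= /mass !big_seq; apply: leq_sum => Y /vC /and4P[YW /andP[Y0 _] _ _].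
rewrite (setIidPl YW); case: #|Y| Y0 => [|[|[|[|n]]]] //=; lia.
Qed.

Definition kept s a Y : nat :=
  if (a \notin Y) && ~~ (Y \subset nbh s) then weight #|Y :\: nbh s| else 0.

Lemma mass_survivors s a C : mass (survivors s a C) = \sum_(Y <- C) kept s a Y.
Proof. by rewrite /mass /survivors big_map big_filter big_mkcond. Qed.

Lemma mass_next s W a C : a \in nbh s :&: W -> 
  mass (next_classes s W a C) = size (created s W a C) + mass (survivors s a C).
Proof.
move=> aA; rewrite /mass big_cat /=; congr (_ + _).
case E: (created s W a C) => [|Y [|Z q]]; rewrite ?big_nil //.
  have /createdP[pf [b [bA -> _ _]]] : Y \in created s W a C by rewrite E inE.
  by rewrite big_seq1 (ternary1P (perfect1 pf) bA).
by move: E; rewrite /created; case: ifP => // _; case: pickP.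
Qed.

Lemma setID_int s W Y : Y \subset W -> Y :\: nbh s = Y :\: (nbh s :&: W).
Proof.
move=> YW; apply/setP=> x; rewrite !inE.
by case xY: (x \in Y); rewrite ?andbF ?andbT // (subsetP YW _ xY) andbT.
Qed.

Lemma weight_mono m n : 0 < m -> m <= n -> n <= 3 -> weight n <= weight m.
Proof. by case: m => [|[|[|[|m]]]] //; case: n => [|[|[|[|n]]]]. Qed.

Lemma weight4 n : weight n <= 4.
Proof. by case: n => [|[|[|[|n]]]]. Qed.

Lemma kept_untouched s W a Y : a \in nbh s :&: W -> valid s W Y ->
  #|Y :&: (nbh s :&: W)| = 0 -> kept s a Y = weight #|Y|.
Proof.
move=> aA /and4P[YW /andP[Y0 _] _ _] /eqP; rewrite cards_eq0 => /eqP dj.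
have aY : a \notin Y.
  by apply/negP=> aY; have := in_set0 a; rewrite -dj inE aY aA.
have DY : Y :\: nbh s = Y.
  by apply/setDidPl; rewrite -setI_eq0 -dj setIA [_ :&: W](setIidPl _) // subIset ?YW.
rewrite /kept aY /= DY; case: ifP => // /negbFE.
by rewrite -setD_eq0 DY => /eqP e; move: Y0; rewrite e cards0.
Qed.

(** The classes are disjoint, so at most [#|nbh s :&: W|] of them are touched; the others keep their
    weight. *)
Lemma loss_any s W a C : valid_state s W C -> a \in nbh s :&: W ->
  mass C <= mass (survivors s a C) + 4 * #|nbh s :&: W|.
Proof.
move=> vs aA; have [_ /allP vC _] := vs.
apply: leq_trans (_ : \sum_(Y <- C) kept s a Y + 4 * \sum_(Y <- C) #|Y :&: (nbh s :&: W)| <= _).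
  rewrite big_distrr -big_split /= /mass !big_seq; apply: leq_sum => Y /vC vY.
  case E: #|Y :&: (nbh s :&: W)| => [|n].
    by rewrite (kept_untouched aA vY E) leq_addr.
  by apply: leq_trans (weight4 _) _; rewrite mulnS addnCA leq_addr.
by rewrite mass_survivors leq_add2l leq_mul2l /= (sum_count_le _ vs).
Qed.

(* A light vertex of Y has at most three neighbours outside Y, one of which is s,
   hence at most two ways to go on once Y is dominated. *)
Lemma dominated_class s W Y : valid s W Y -> s \notin W -> Y \subset nbh s ->
  exists2 y, y \in nbh s :&: W & ~~ ternary y (W :\: nbh s).
Proof.
move=> /and4P[YW _ _ /exists_inP[y yY lt]] sW Ys; exists y.
  by rewrite inE (subsetP Ys) ?(subsetP YW).
apply/negP=> /eqP c3; move: lt; rewrite /light leqNgt => /negP[].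
rewrite -[X in X < _]c3 proper_card //; apply/properP; split.
  apply/subsetP=> z; rewrite !inE => /and3P[-> zs ->].
  by rewrite orbT andbT /=; apply: contra zs => /(subsetP Ys); rewrite inE.
exists s; rewrite !inE ?eqxx ?(negbTE sW) ?andbF //.
rewrite andbT /= adjC; move/(subsetP Ys): yY; rewrite inE => -> /=.
by apply: contra sW => /(subsetP YW).
Qed.

Lemma ternary1_hit s W C Y : valid_state s W C -> ternary1 s W -> Y \in C ->
  ~~ (Y \subset nbh s).
Proof.
move=> [sW /allP vC _] /andP[_ /forall_inP t1] YC; apply/negP=> Ys.
have [y yA] := dominated_class (vC _ YC) sW Ys.
by rewrite t1.
Qed.

(** If the path enters [Y] at [a], then [Y] has another vertex outside [nbh s], so the weight lost
    is at most 2. *)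
Lemma kept_le s a Y W : ~~ (Y \subset nbh s) -> valid s W Y -> a \in nbh s ->
  weight #|Y| <= kept s a Y + 2 * (a \in Y).
Proof.
move=> Ys /and4P[YW /andP[Y0 Y3] _ _] aA; rewrite /kept Ys andbT.
have D0 : 0 < #|Y :\: nbh s|.
  by rewrite card_gt0; apply: contra Ys; rewrite setD_eq0.
case: (boolP (a \in Y)) => aY /=; last first.
  by rewrite addn0 weight_mono // subset_leq_card ?subsetDl.
have : 1 < #|Y|.
  rewrite -(cardsID (nbh s) Y); have : 0 < #|Y :&: nbh s|.
    by rewrite card_gt0; apply/set0Pn; exists a; rewrite inE aY.
  by lia.
by case: #|Y| Y3 => [|[|[|[|n]]]].
Qed.

Lemma loss_ternary1 s W a C : valid_state s W C -> ternary1 s W ->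
  a \in nbh s :&: W -> mass C <= mass (survivors s a C) + 2.
Proof.
move=> vs t1 aA; have [_ /allP vC cC] := vs.
apply: leq_trans (_ : \sum_(Y <- C) kept s a Y + 2 * \sum_(Y <- C) (a \in Y : nat) <= _).
  rewrite big_distrr -big_split /= /mass !big_seq; apply: leq_sum => Y YC.
  apply: kept_le (vC _ YC) _; first exact: ternary1_hit vs t1 YC.
  by case/setIP: aA.
rewrite mass_survivors leq_add2l -[X in _ <= X]muln1 leq_mul2l /=.
by rewrite -big_mkcond /= sum1_count; apply: cC.
Qed.

Lemma kept_sum s W Y : valid s W Y -> ternary s W -> ~~ (Y \subset nbh s) ->
  3 * weight #|Y| + (0 < #|Y :&: (nbh s :&: W)|) <= \sum_(a in nbh s :&: W) kept s a Y.
Proof.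
move=> vY /eqP t0 Ys; have /and4P[YW /andP[Y0 Y3] _ _] := vY.
rewrite /kept Ys; under eq_bigr do rewrite andbT.
rewrite -big_mkcondr /= sum_nat_const (setID_int _ YW).
set A := nbh s :&: W in t0 *.
have -> : #|[pred i | (i \in A) && (i \notin Y)]| = #|A :\: Y|.
  by apply: eq_card => x; rewrite [RHS]inE andbC.
have h1 := cardsID Y A; have h2 := cardsID A Y; rewrite [A :&: Y]setIC in h1.
have h3 : 0 < #|Y :\: A|.
  rewrite card_gt0 -(setID_int _ YW); apply: contra Ys; by rewrite setD_eq0.
rewrite t0 in h1.
move: h1 h2 h3 Y3; move: #|Y :&: A| #|A :\: Y| #|Y :\: A| #|Y| => i d j n h1 h2 h3 Y3.
have -> : d = 3 - i by lia.
have : i < 3 by lia.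
by move: h2 Y3 h3 => <-; case: i {h1} => [|[|[|i]]] //; case: j => [|[|[|[|j]]]].
Qed.

End States.

End EventClasses.

(** * Paths weighted by their events *)

Section PathPotential.
Import Order.TTheory GRing.Theory Num.Theory.

Local Open Scope ring_scope.

Lemma sum_paths (V : nmodType) (G : sgraph) (t : G) k s W (F : seq G -> V) :
  \sum_(p <- paths t k.+1 s W) F p = if adj s t then F [::] else
  \sum_(a in nbh s :&: W) \sum_(p <- paths t k a (W :\: nbh s)) F (a :: p).
Proof.
rewrite /=; case: ifP => _; first by rewrite big_seq1.
rewrite big_flatten /= big_map big_enum /=.
by apply: eq_bigr => a _; rewrite big_map.
Qed.

Lemma sum3_one (R : realFieldType) (T : finType) (A : {set T}) (f : T -> R) a0 X c :
  #|A| = 3%N -> a0 \in A -> (forall a, a \in A -> f a <= X) -> f a0 <= c ->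
  \sum_(a in A) f a <= c + 2 * X.
Proof.
move=> A3 aA H H0; rewrite (bigD1 a0) //=; apply: lerD => //.
rewrite (eq_bigl (fun a => a \in A :\ a0)); last first.
  by move=> a; rewrite in_setD1 andbC.
apply: le_trans (_ : \sum_(a in A :\ a0) X <= _).
  by apply: ler_sum => a; rewrite in_setD1 => /andP[_ /H].
rewrite sumr_const (_ : #|A :\ a0| = 2%N) ?mulr_natl //.
by move: A3; rewrite (cardsD1 a0) aA => -[].
Qed.

Lemma sum3_all (R : realFieldType) (T : finType) (A : {set T}) :
  #|A| = 3%N -> exists a b c, [/\ a \in A, b \in A, c \in A,
    forall f : T -> R, \sum_(x in A) f x = f a + f b + f c &
    forall f : T -> nat, (\sum_(x in A) f x = f a + f b + f c)%N].
Proof.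
rewrite cardE; case E: (enum A) => [|a [|b [|c [|d q]]]] // _.
exists a, b, c.
have inA x : (x \in A) = (x \in [:: a; b; c]) by rewrite -E mem_enum.
split; rewrite ?inA ?inE ?eqxx ?orbT //.
  by move=> f; rewrite -big_enum E !big_cons big_nil /= addr0 addrA.
by move=> f; rewrite -big_enum E !big_cons big_nil /= addn0 addnA.
Qed.

Section Potential.
Variables (R : realFieldType) (th : R) (G : sgraph) (t : G).
Hypotheses (th_lo : 100 * (100 * (1 - th)) <= 1) (th_lt1 : th < 1).
Implicit Types (x y u v a b s : G) (S W Y : {set G}) (p : seq G) (C : seq {set G}).

(* A branching that is not ternary saves a constant factor. The rate accounts for
   one that occurs now, or after one or two more steps. *)
Definition rate s W : R :=
  if ~~ ternary s W then 97 / 100 else if ~~ ternary1 s W then 992 / 1000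
  else if ~~ perfect s W then 999 / 1000 else 1.

Lemma rate_bounds s W : 97 / 100 <= rate s W <= 1.
Proof. by rewrite /rate; do 3?[case: ifP => _]; apply/andP; split; lra. Qed.

Let thp n : 0 < th ^+ n. Proof. exact: thX_gt0. Qed.
Let thn : th != 0. Proof. by rewrite gt_eqF // th_gt0. Qed.

Lemma terminal s W C : valid_state s W C ->
  1 <= (rgrow #|W|)%:R * th ^+ mass C * rate s W.
Proof.
move=> vs; have /andP[rlo _] := rate_bounds s W.
have h1 := rgrow_th th_lo th_lt1 #|W|.
have h2 := leq_thX th_lo th_lt1 (mass_le vs).
have h3 : (0 : R) <= (rgrow #|W|)%:R by rewrite ler0n.
have h4 := ler_wpM2l h3 h2.
have h5 : 0 <= (rgrow #|W|)%:R * th ^+ mass C by rewrite mulr_ge0 // ltW.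
have h6 := ler_wpM2l h5 rlo; lra.
Qed.

(* Every event costs the factor th^-1. At a vertex that is not perfect it is paid
   by the rates, at the creation of a class by its weight. At a perfect vertex the
   weight of the surviving classes does not decrease on average over the three
   choices, and it increases if some class is hit; then [th_three] applies. *)
Lemma potential k s W C : valid_state s W C ->
  \sum_(p <- paths t k s W) th^-1 ^+ events s W C p <=
    (rgrow #|W|)%:R * th ^+ mass C * rate s W.
Proof.
elim: k s W C => [|k IH] s W C vs.
all: have base := terminal vs.
- rewrite /=; case: ifP => _; first by rewrite big_seq1.
  by rewrite big_nil; lra.
rewrite sum_paths; case: ifP => // _.
set A := nbh s :&: W; set W' := W :\: nbh s.
set r' := (rgrow #|W'|)%:R : R.
have r'0 : 0 <= r' by rewrite ler0n.
pose S a := \sum_(p <- paths t k a W') th^-1 ^+ events s W C (a :: p).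
rewrite -/(\sum_(a in A) S a).
have inv n : th^-1 ^+ n * th ^+ n = 1 by rewrite -exprMn mulVf ?expr1n.
have Sa a : a \in A -> S a <= r' * (if perfect s W then 1 else th^-1) *
    th ^+ mass (survivors s a C) * rate a W'.
  move=> aA; have := IH a W' _ (next_valid vs aA); rewrite (mass_next _ aA).
  rewrite /S; under [X in _ -> X <= _]eq_bigr do rewrite /= exprD.
  rewrite -big_distrr /= -/W' => le.
  have e0 : 0 <= th^-1 ^+ event s W a C by rewrite exprn_ge0 // invr_ge0 ltW // -[th]expr1.
  apply: le_trans (ler_wpM2l e0 le) _.
  rewrite exprD /event; case: ifP => pf.
    move: (inv (size (created s W a C))); move: (th^-1 ^+ _) (th ^+ size _) => u v uv.
    rewrite -/r' (_ : u * _ = r' * 1 * th ^+ mass (survivors s a C) * rate a W' * (u * v)).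
      by rewrite uv !mulr1.
    by move: (th ^+ _) (rate _ _) => X Y; ring.
  rewrite /created pf /= expr0 mul1r expr1 -/r'.
  move: (th ^+ _) (rate _ _) (th^-1) => X Y Z.
  by rewrite le_eqVlt; apply/orP; left; apply/eqP; ring.
set E := th ^+ mass C; have E0 : 0 < E by apply: thp.
have rE0 : 0 <= r' * E by rewrite mulr_ge0 // ltW.
have cardW : (#|A| + #|W'| = #|W|)%N by apply: card_step.
(* The power [th ^ n] covers the mass lost and one further factor [th] the event. *)
have loss n a : a \in A -> ~~ perfect s W ->
    (mass C <= mass (survivors s a C) + n)%N ->
    th ^+ (n + 1) * S a <= r' * E * rate a W'.
  move=> aA npf le; have := Sa a aA; rewrite (negbTE npf) => le1.
  apply: le_trans (ler_wpM2l (ltW (thp _)) le1) _.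
  have /andP[ra _] := rate_bounds a W'.
  have ra0 : 0 <= rate a W' by lra.
  rewrite exprD expr1.
  have -> : th ^+ n * th * (r' * th^-1 * th ^+ mass (survivors s a C) * rate a W') =
      r' * th ^+ (mass (survivors s a C) + n) * rate a W' * (th * th^-1).
    rewrite exprD; move: (th ^+ n) (th ^+ mass _) (rate _ _) (th^-1) => X Y Z T; ring.
  rewrite mulfV // mulr1 ler_wpM2r // ler_wpM2l //; exact: leq_thX.
case: (boolP (ternary s W)) => t0; last first.
  have npf : ~~ perfect s W by apply: contra t0 => /perfect1/andP[].
  have -> : rate s W = 97 / 100 by rewrite /rate t0.
  set n := (4 * #|A|)%N.
  rewrite -(ler_pM2l (thp (n + 1))) mulr_sumr.
  apply: le_trans (_ : \sum_(a in A) r' * E <= _).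
    apply: ler_sum => a aA; apply: le_trans (loss n a aA npf (loss_any vs aA)) _.
    by rewrite ler_piMr //; case/andP: (rate_bounds a W').
  rewrite sumr_const -[_ *+ _]mulr_natl.
  have := rgrow_lossy th_lo th_lt1 #|W'| t0; rewrite cardW -/r' -/n.
  move/(ler_wpM2r (ltW E0)); set X := th ^+ _; lra.
have A3 : #|A| = 3%N by apply/eqP.
have r3 : (rgrow #|W|)%:R = 3 * r'.
  by rewrite -cardW A3 addSn add2n rgrowD3 natrM.
have rle a : rate a W' <= 1 by case/andP: (rate_bounds a W').
case: (boolP (ternary1 s W)) => t1; last first.
  have npf : ~~ perfect s W by apply: contra t1 => /perfect1.
  have -> : rate s W = 992 / 1000 by rewrite /rate t0 t1.
  have [a0 a0A nt] : exists2 a, a \in A & ~~ ternary a W'.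
    by apply/exists_inP; rewrite -negb_forall_in; move: t1; rewrite /ternary1 t0.
  (* Three choices destroy mass at most 12. One child has rate 97/100, so the average is 99/100, and
     dividing by [th ^ 13] stays below 992/1000. *)
  rewrite -(ler_pM2l (thp (12 + 1))) mulr_sumr r3.
  apply: le_trans (sum3_one (X := r' * E) (c := r' * E * (97 / 100)) A3 a0A _ _) _.
  - move=> a aA; apply: le_trans (loss 12%N a aA npf _) _; last by rewrite ler_piMr.
    by have := loss_any vs aA; rewrite -/A A3.
  - apply: le_trans (loss 12%N a0 a0A npf _) _; last by rewrite /rate nt.
    by have := loss_any vs a0A; rewrite -/A A3.
  have := thX_ge_small th_lo th_lt1 (leqnn (12 + 1)).
  move: (th ^+ (12 + 1)) => B hB.
  have hB' : 998 / 1000 <= B by lra.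
  have := ler_wpM2l rE0 hB'; rewrite [r' * E]mulrC; lra.
case: (boolP (perfect s W)) => pf; last first.
  have -> : rate s W = 999 / 1000 by rewrite /rate t0 t1 pf.
  have [a0 a0A nt] : exists2 a, a \in A & ~~ ternary1 a W'.
    by apply/exists_inP; rewrite -negb_forall_in; move: pf; rewrite /perfect t1.
  have ra0 : rate a0 W' <= 992 / 1000 by rewrite /rate nt; case: ifP => _; lra.
  (* Now at most mass 2 is lost, by [loss_ternary1], and the average (2 + 0.992) / 3 divided by
     [th ^ 3] stays below 999/1000. *)
  rewrite -(ler_pM2l (thp (2 + 1))) mulr_sumr r3.
  apply: le_trans (sum3_one (X := r' * E) (c := r' * E * (992 / 1000)) A3 a0A _ _) _.
  - move=> a aA; apply: le_trans (loss 2%N a aA pf _) _; last by rewrite ler_piMr.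
    exact: loss_ternary1 vs t1 aA.
  - apply: le_trans (loss 2%N a0 a0A pf _) _; last by rewrite ler_wpM2l.
    exact: loss_ternary1 vs t1 a0A.
  have := thX_ge_small th_lo th_lt1 (leqnn (2 + 1)).
  move: (th ^+ (2 + 1)) => B hB.
  have hB' : 999 / 1000 <= B by lra.
  have := ler_wpM2l rE0 hB'; rewrite [r' * E]mulrC; lra.
have -> : rate s W = 1 by rewrite /rate t0 t1 pf.
rewrite mulr1 r3.
apply: le_trans (_ : \sum_(a in A) r' * th ^+ mass (survivors s a C) <= _).
  apply: ler_sum => a aA; apply: le_trans (Sa a aA) _.
  by rewrite pf mulr1 ler_piMr // mulr_ge0 // ltW.
rewrite -mulr_sumr -mulrA mulrCA -/E ler_wpM2l //.
have [_ /allP vC _] := vs.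
have nsub Y : Y \in C -> ~~ (Y \subset nbh s) := ternary1_hit vs t1.
case: (boolP (has (fun Y : {set G} => 0 < #|Y :&: A|)%N C)) => [/hasP[Y0 Y0C Y0A]|/hasPn Hno].
  have [a [b [c [aA bA cA Hf Hn]]]] := sum3_all R A3; rewrite Hf.
  apply: (th_three th_lo th_lt1); try exact: loss_ternary1 vs t1 _.
  rewrite -(Hn (fun a => mass (survivors s a C))).
  under eq_bigr do rewrite mass_survivors.
  rewrite exchange_big /=.
  apply: leq_trans (_ : (\sum_(Y <- C) (3 * weight #|Y| + (0 < #|Y :&: A|)) <= _)%N); last first.
    rewrite !big_seq; apply: leq_sum => Y YC.
    exact: kept_sum (vC _ YC) t0 (nsub _ YC).
  rewrite big_split /= -big_distrr /= -/(mass C) -addn1 leq_add2l.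
  by rewrite (big_rem Y0) //= Y0A.
rewrite (eq_bigr (fun=> E)) => [|a aA]; first by rewrite sumr_const A3 mulr_natl.
congr (_ ^+ _); rewrite mass_survivors /mass !big_seq; apply: eq_bigr => Y YC.
apply: kept_untouched aA (vC _ YC) _; apply/eqP.
by rewrite -leqn0 leqNgt Hno.
Qed.

End Potential.

End PathPotential.

(** * Braid segments *)

Definition segment (G : sgraph) (B : nat -> {set G}) (M : nat) : Prop :=
  [/\ forall j, j < M -> #|B j| = 3,
      forall i j, i < M -> j < M -> i != j -> [disjoint B i & B j] &
      forall j x, j.+2 < M -> x \in B j.+1 ->
        B j :|: B j.+2 \subset nbh x /\
        nbh x \subset B j :|: B j.+1 :|: B j.+2].

Lemma card_hits (T : finType) (A : nat -> {set T}) (X : {set T}) l (P : pred 'I_l) :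
  (forall i j x, x \in A i -> x \in A j -> i = j) ->
  (forall i, P i -> exists2 x, x \in A i & x \in X) ->
  #|P| <= #|X|.
Proof.
move=> dj hit; case: (pickP (fun x : T => true)) => [x0 _|no]; last first.
  rewrite (_ : #|P| = 0) //; apply: eq_card0 => i.
  by apply/negbTE/negP=> /hit[x]; have := no x.
pose f (i : 'I_l) := odflt x0 [pick x in A i :&: X].
have fP i : i \in P -> f i \in A i :&: X.
  move=> /hit[x xA xX]; rewrite /f; case: pickP => [//|/(_ x)].
  by rewrite inE xA xX.
rewrite -(card_in_imset (f := f) (D := P)) => [|i j iP jP e].
  by apply/subset_leq_card/subsetP=> _ /imsetP[i iP ->]; case/setIP: (fP _ iP).
apply: val_inj; apply: (dj _ _ (f i)); first by case/setIP: (fP _ iP).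
by rewrite e; case/setIP: (fP _ jP).
Qed.

(** Pigeonhole over [bad.+1] consecutive blocks of length [M]. *)
Lemma good_window (good : pred nat) l M bad :
  #|[pred i : 'I_l | ~~ good i]| <= bad -> bad.+1 * M <= l ->
  exists i0, i0 + M <= l /\ forall i, i0 <= i < i0 + M -> good i.
Proof.
move=> nb le; case: (boolP [exists j : 'I_bad.+1, [forall i : 'I_l,
   (j * M <= i < j * M + M) ==> good i]]) => [/existsP[j /forallP H]|].
  have jl : j * M + M <= l.
    by apply: leq_trans le; rewrite -mulSnr leq_mul2r ltn_ord orbT.
  exists (j * M); split=> // i ij.
  have il : i < l by apply: leq_trans jl; case/andP: ij.
  by have := H (Ordinal il); rewrite /= ij.
rewrite negb_exists => /forallP Hn.
suff : bad.+1 <= #|[pred i : 'I_l | ~~ good i]| by move=> h; have := leq_trans h nb; rewrite ltnn.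
pose f (j : 'I_bad.+1) := [pick i : 'I_l | (j * M <= i < j * M + M) && ~~ good i].
have fP j : exists2 i, f j = Some i & (j * M <= i < j * M + M) && ~~ good i.
  have := Hn j; rewrite negb_forall => /existsP[i]; rewrite negb_imply => Hi.
  by rewrite /f; case: pickP => [i' Hi'|/(_ i)]; [exists i'|rewrite Hi].
have fI : injective f.
  move=> j1 j2 e.
  have [i1 e1 /andP[h1 _]] := fP j1; have [i2 e2 /andP[h2 _]] := fP j2.
  move: e; rewrite e1 e2 => -[e]; rewrite -e in h2; apply: val_inj => /=.
  move: h1 h2; rewrite -!mulSnr => /andP[a1 b1] /andP[a2 b2].
  have M0 : 0 < M by case: (M) a1 b1 => // a1; rewrite !muln0.
  have := leq_ltn_trans a1 b2; have := leq_ltn_trans a2 b1.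
  by rewrite !ltn_pmul2r //; lia.
have e1 := card_imset 'I_bad.+1 fI; rewrite card_ord in e1.
have e2 := card_imset [pred i : 'I_l | ~~ good i] (@Some_inj _).
rewrite -e1 -e2; apply/subset_leq_card/subsetP=> _ /imsetP[j _ ->].
by have [i -> /andP[_ Hi]] := fP j; apply: imset_f.
Qed.

Section Segment.
Variables (G : sgraph) (s0 : G) (W0 : {set G}) (p : seq G).
Implicit Types (x y u v a b s : G) (S W Y : {set G}) (C : seq {set G}).

Let src i := nth s0 (s0 :: p) i.
Fixpoint rest i := if i is i'.+1 then rest i' :\: nbh (src i') else W0.
Let dom i := nbh (src i) :&: rest i.
Fixpoint classes i := if i is i'.+1 then
  next_classes (src i') (rest i') (src i) (classes i') else [::].
Let cls i := created (src i) (rest i) (src i.+1) (classes i).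

Lemma events_sum i : i <= size p -> events s0 W0 [::] p =
  \sum_(j < i) event (src j) (rest j) (src j.+1) (classes j) +
  events (src i) (rest i) (classes i) (drop i p).
Proof.
elim: i => [|i IH] ip; first by rewrite big_ord0 drop0.
rewrite (IH (ltnW ip)) (drop_nth s0) //= big_ord_recr /= -addnA.
by [].
Qed.

Lemma rest_sub i j : i <= j -> rest j \subset rest i.
Proof.
elim: j => [|j IH]; first by rewrite leqn0 => /eqP->.
rewrite leq_eqVlt => /predU1P[->//|/IH]; apply: subset_trans.
exact: subsetDl.
Qed.

Lemma dom_disj i j x : x \in dom i -> x \in dom j -> i = j.
Proof.
suff H (a b : nat) : a < b -> x \in dom a -> x \in dom b -> False.
  by move=> xi xj; case: (ltngtP i j) => // lt; [case: (H i j)|case: (H j i)].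
move=> ab; rewrite !inE => /andP[xs _] /andP[_ /(subsetP (rest_sub ab))].
by rewrite /= inE inE xs.
Qed.

Lemma rest_or_dom i x : x \in W0 -> x \in rest i \/ exists2 j, j < i & x \in dom j.
Proof.
move=> xW; elim: i => [|i [IH|[j ji xj]]]; first by left.
  case: (boolP (x \in nbh (src i))) => h; last by left; rewrite /= inE h.
  by right; exists i; rewrite // inE h.
by right; exists j => //; apply: ltnW.
Qed.

(** The choices at step [i] look like a cluster of size 3: all of them have the same
    continuations. *)
Definition clean i := (#|dom i| == 3) &&
  [forall b in dom i, nbh b :&: rest i.+1 == nbh (src i.+1) :&: rest i.+1].

Let U : {set G} := \bigcup_(j < size p) \bigcup_(Y <- cls j) Y.

Lemma size_cls j : size (cls j) <= 1.
Proof. by rewrite /cls /created; case: ifP => // _; case: pickP. Qed.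

Lemma event_cls j : size (cls j) <= event (src j) (rest j) (src j.+1) (classes j).
Proof. by rewrite /event; case: ifP => // pf; rewrite /cls /created pf. Qed.

Lemma events_ge : \sum_(j < size p) event (src j) (rest j) (src j.+1) (classes j)
  <= events s0 W0 [::] p.
Proof. by rewrite (events_sum (leqnn _)) leq_addr. Qed.

Lemma card_U : #|U| <= 3 * events s0 W0 [::] p.
Proof.
apply: leq_trans (_ : 3 * \sum_(j < size p) size (cls j) <= _); last first.
  rewrite leq_mul2l /=; apply: leq_trans events_ge.
  by apply: leq_sum => j _; apply: event_cls.
rewrite /U big_distrr /=.
elim/big_rec2: _ => [|j m A _ le]; first by rewrite cards0.
apply: leq_trans (leq_card_setU _ _) _; apply: leq_add le.
case E: (cls j) (size_cls j) => [|Y [|//]] _; first by rewrite big_nil cards0.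
rewrite big_seq1 muln1.
have /createdP[pf [b [bA -> _ _]]] : Y \in cls j by rewrite E inE.
by rewrite (ternary1P (perfect1 pf) bA).
Qed.

Lemma classes_U i Y : i <= size p -> Y \in classes i -> Y \subset U.
Proof.
elim: i Y => [|i IH] Y ip //=; rewrite mem_cat => /orP[Yc|/mapP[Z]].
  apply/subsetP=> x xY; apply/bigcupP; exists (Ordinal ip) => //=.
  move: Yc; rewrite -/(cls i) => Yc; rewrite (big_rem Y) //=.
  by rewrite inE xY.
rewrite mem_filter => /andP[_ /(IH _ (ltnW ip)) ZU] ->.
by apply: subset_trans ZU; apply: subsetDl.
Qed.

(** If no class is created at a perfect vertex although some choice [b] has a different
    neighbourhood, that neighbourhood must meet a surviving class. Survivors are subsets of classes
    created earlier, hence of [U]. *)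
Lemma not_clean i : i < size p -> ~~ clean i ->
  0 < event (src i) (rest i) (src i.+1) (classes i) \/
  exists2 b, b \in dom i & exists2 y, y \in U & adj y b.
Proof.
move=> ip ncl; rewrite /event; case: ifP => pf; last by left.
have t1 := perfect1 pf; have /andP[t0 _] := t1.
have [b bA ne] : exists2 b, b \in dom i &
    nbh b :&: rest i.+1 != nbh (src i.+1) :&: rest i.+1.
  by apply/exists_inP; rewrite -negb_forall_in; move: ncl; rewrite /clean -/(ternary _ _) t0.
rewrite /created pf; case: pickP => [//|/(_ b)] /=; first by left.
rewrite -[_ :&: rest i]/(dom i) bA ne /= => /allPn[Y YS].
rewrite -setI_eq0 => /set0Pn[y]; rewrite !inE => /andP[/andP[yb _] yY]; right.
exists b => //; exists y; last by rewrite adjC.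
move: YS => /mapP[Z]; rewrite mem_filter => /andP[_ ZC] YE.
apply: (subsetP (classes_U (ltnW ip) ZC)); move: yY; rewrite YE inE.
by case/andP.
Qed.

Variables (D T : nat).
Hypothesis degD : forall x : G, #|nbh x| <= D.
Hypothesis evT : events s0 W0 [::] p <= T.
Hypothesis W0c : #|~: W0| <= D.+1.

Lemma card_nbhs (S : {set G}) : #|\bigcup_(x in S) nbh x| <= D * #|S|.
Proof.
rewrite mulnC -sum_nat_const; elim/big_rec2: _ => [|x A m xS le].
  by rewrite cards0.
by apply: leq_trans (leq_card_setU _ _) _; apply: leq_add (degD x) le.
Qed.

(** At most [T] steps have events. At the others a choice is adjacent to [U], which has at most
    [3 * T] vertices and so at most [3 * T * D] neighbours; distinct steps use distinct ones, as the
    choice sets are disjoint. *)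
Lemma card_not_clean :
  #|[pred i : 'I_(size p) | ~~ clean i]| <= T * (1 + 3 * D).
Proof.
pose E (i : 'I_(size p)) := 0 < event (src i) (rest i) (src i.+1) (classes i).
pose H (i : 'I_(size p)) := [exists b in dom i, [exists y in U, adj y b]].
have sub : [pred i : 'I_(size p) | ~~ clean i] \subset [predU [pred i | E i] & [pred i | H i]].
  apply/subsetP=> i; rewrite !inE => /(not_clean (ltn_ord i))[e|[b bA [y yU a]]].
    by apply/orP; left.
  apply/orP; right; apply/exists_inP; exists b => //.
  by apply/exists_inP; exists y.
apply: leq_trans (subset_leq_card sub) _.
apply: leq_trans (_ : #|[pred i | E i]| + #|[pred i | H i]| <= _).
  by rewrite -cardUI leq_addr.
have c1 : #|[pred i | E i]| <= T.
  apply: leq_trans evT; apply: leq_trans events_ge.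
  rewrite -sum1_card big_mkcond /=; apply: leq_sum => i _.
  by rewrite inE /E; case: (event _ _ _ _).
have c2 : #|[pred i | H i]| <= T * (3 * D).
  apply: leq_trans (card_hits (A := dom) (X := \bigcup_(x in U) nbh x) (P := H) _ _) _.
  - by move=> i j x; apply: dom_disj.
  - move=> i /exists_inP[b bA /exists_inP[y yU a]]; exists b => //.
    by apply/bigcupP; exists y; rewrite // inE.
  apply: leq_trans (card_nbhs U) _; have := card_U.
  by move=> h; rewrite mulnCA mulnA mulnC leq_mul2r; lia.
by rewrite mulnDr muln1 leq_add.
Qed.

(** The vertices about which clean steps say nothing: those outside [W0] and those removed at a step
    that is not clean. A good step has no choice adjacent to them. *)
Let Z : {set G} := ~: W0 :|: \bigcup_(i < size p | ~~ clean i) dom i.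

Lemma card_Z : #|Z| <= D.+1 + D * (T * (1 + 3 * D)).
Proof.
apply: leq_trans (leq_card_setU _ _) _; apply: leq_add => //.
apply: leq_trans (_ : D * #|[pred i : 'I_(size p) | ~~ clean i]| <= _); last first.
  by rewrite leq_mul2l card_not_clean orbT.
rewrite mulnC -sum_nat_const; elim/big_rec2: _ => [|i A m _ le].
  by rewrite cards0.
apply: leq_trans (leq_card_setU _ _) _; apply: leq_add le.
by apply: leq_trans (degD (src i)); rewrite subset_leq_card ?subsetIl.
Qed.

Let good i := clean i && ~~ [exists b in dom i, [exists z in Z, adj z b]].

Lemma card_not_good : #|[pred i : 'I_(size p) | ~~ good i]| <=
  T * (1 + 3 * D) + D * (D.+1 + D * (T * (1 + 3 * D))).
Proof.
pose H (i : 'I_(size p)) := [exists b in dom i, [exists y in Z, adj y b]].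
have sub : [pred i : 'I_(size p) | ~~ good i] \subset
    [predU [pred i : 'I_(size p) | ~~ clean i] & [pred i | H i]].
  by apply/subsetP=> i; rewrite !inE /good negb_and negbK.
apply: leq_trans (subset_leq_card sub) _.
apply: leq_trans (_ : #|[pred i : 'I_(size p) | ~~ clean i]| + #|[pred i | H i]| <= _).
  by rewrite -cardUI leq_addr.
have c2 : #|[pred i | H i]| <= D * (D.+1 + D * (T * (1 + 3 * D))).
  apply: leq_trans (card_hits (A := dom) (X := \bigcup_(x in Z) nbh x) (P := H) _ _) _.
  - by move=> i j x; apply: dom_disj.
  - move=> i /exists_inP[b bA /exists_inP[y yU a]]; exists b => //.
    by apply/bigcupP; exists y; rewrite // inE.
  by apply: leq_trans (card_nbhs Z) _; rewrite leq_mul2l card_Z orbT.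
exact: leq_add card_not_clean c2.
Qed.

Lemma clean_next i u z : clean i -> u \in dom i -> z \in rest i.+1 ->
  adj u z = (z \in dom i.+1).
Proof.
case/andP=> _ /forall_inP H uA zR.
have /eqP/setP/(_ z) := H _ uA.
by rewrite [LHS]inE [in LHS]inE zR andbT => ->.
Qed.

(** In a window of good steps consecutive choice sets are completely joined. For the converse let
    [u] be a neighbour of some [x] in [dom i.+1]. If [u] is still available, it is in [dom i.+2]. If
    it was removed at an earlier step [l], this step is clean because [u] is not in [Z], so [x] is
    in [dom l.+1] and [l = i]. *)
Lemma path_segment M :
  (T * (1 + 3 * D) + D * (D.+1 + D * (T * (1 + 3 * D)))).+1 * M <= size p ->
  exists B : nat -> {set G}, segment B M.
Proof.
move=> le; have [i0 [i0M H]] := good_window card_not_good le.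
exists (fun j => dom (i0 + j)); split.
- move=> j jM; have /andP[cl _] : good (i0 + j).
    by apply: H; rewrite leq_addr ltn_add2l.
  by case/andP: cl => /eqP.
- move=> i j _ _ ij; rewrite -setI_eq0; apply/set0Pn => -[x].
  by rewrite inE => /andP[xi xj]; move: ij; rewrite -(eqn_add2l i0) (dom_disj xi xj) eqxx.
move=> j x jM; rewrite !addnS; set i := i0 + j => xA.
have gd l : i <= l <= i.+2 -> good l.
  by case/andP=> h1 h2; apply: H; rewrite (leq_trans (leq_addr j i0) h1) /=;
    apply: leq_ltn_trans h2 _; rewrite /i -!addnS leq_add2l.
have /andP[c0 g0] : good i by apply: gd; rewrite leqnn ltnW.
have /andP[c1 g1] : good i.+1 by apply: gd; rewrite leqnSn ltnS leqnSn.
have xr : x \in rest i.+1 by case/setIP: xA.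
split; first apply/subUsetP; first split; apply/subsetP=> u uA.
- by rewrite inE adjC (clean_next c0 uA xr).
- by rewrite inE (clean_next c1 xA) //; case/setIP: uA.
have xu : adj x u by move: uA; rewrite inE.
have uZ : u \notin Z.
  apply: contra g1 => uZ; apply/exists_inP; exists x => //.
  by apply/exists_inP; exists u; rewrite // adjC.
have uW : u \in W0 by apply: contraR uZ => h; rewrite !inE h.
rewrite !in_setU; case: (rest_or_dom i.+2 uW) => [ur|[l li ul]].
  by rewrite -(clean_next c1 xA ur) xu orbT.
move: li; rewrite ltnS leq_eqVlt => /predU1P[<-|li]; first by rewrite ul orbT.
case: (boolP (clean l)) => cl.
  have xl : x \in rest l.+1 by apply: (subsetP (rest_sub (_ : l.+1 <= i.+1))).
  have : x \in dom l.+1 by rewrite -(clean_next cl ul xl) adjC.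
  by move=> /(dom_disj xA)[e]; rewrite e ul.
case/negP: uZ; rewrite inE; apply/orP; right.
have lp : l < size p.
  by apply: leq_trans i0M; apply: leq_trans li _; rewrite /i -addnS leq_add2l; lia.
by apply/bigcupP; exists (Ordinal lp).
Qed.

End Segment.

(** * Counting holes by induced paths *)

Section Counting.
Variable G : sgraph.
Implicit Types (x y u v a b s : G) (S W Y U : {set G}) (p : seq G).

Lemma count_paths (F : {set {set G}}) (X : {set G}) (A B W : G -> {set G}) :
  (forall S, S \in F -> exists v a b p, [/\ v \in X, a \in A v, b \in B v,
     p \in paths b #|G| a (W v) & S = v |: (a |: (b |: [set x in p]))]) ->
  #|F| <= \sum_(v in X) \sum_(a in A v) \sum_(b in B v) size (paths b #|G| a (W v)).
Proof.
move=> H.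
pose L := flatten [seq flatten [seq flatten [seq
  [seq v |: (a |: (b |: [set x in p])) | p <- paths b #|G| a (W v)]
  | b <- enum (B v)] | a <- enum (A v)] | v <- enum X].
have -> : \sum_(v in X) \sum_(a in A v) \sum_(b in B v) size (paths b #|G| a (W v)) = size L.
  rewrite /L size_flatten /shape -map_comp sumnE big_map big_enum /=.
  apply: eq_bigr => v _; rewrite size_flatten /shape -map_comp sumnE big_map big_enum /=.
  apply: eq_bigr => a _; rewrite size_flatten /shape -map_comp sumnE big_map big_enum /=.
  by apply: eq_bigr => b _; rewrite size_map.
apply: leq_trans (card_size L); apply/subset_leq_card/subsetP=> S /H.
case=> v [a [b [p [vX aA bB pP ->]]]].
apply/flatten_mapP; exists v; rewrite ?mem_enum //.
apply/flatten_mapP; exists a; rewrite ?mem_enum //.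
apply/flatten_mapP; exists b; rewrite ?mem_enum //.
exact: map_f.
Qed.

Lemma card_nbh1 v : #|v |: nbh v| = #|nbh v|.+1.
Proof. by rewrite cardsU1 inE adjxx. Qed.

(** A hole through [v] has only two neighbours of [v], so the rest of it avoids the whole
    neighbourhood. *)
Lemma hole_at v S : hole S -> v \in S -> exists a b p,
  [/\ a \in nbh v, b \in nbh v, p \in paths b #|G| a (~: (v |: nbh v))
    & S = v |: (a |: (b |: [set x in p]))].
Proof.
move=> hS vS; have [a [b [p [/andP[va vb] ab SE up H]]]] := hole_ipath hS vS.
have [a' [b' [ab' aS' bS' _ Hn]]] := hole_nbrs hS vS.
exists a, b, p; rewrite !inE; split=> //.
move: up; rewrite /= !inE !negb_or => /and4P[/and3P[_ _ vp] /andP[_ ap] bp up].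
apply: mem_paths.
  by rewrite -(card_uniqP up) max_card.
apply: (H _ _).1 => x xp; rewrite !inE negb_or.
have xS : x \in S by rewrite SE !inE xp !orbT.
have aS : a \in S by rewrite SE !inE eqxx orbT.
have bS : b \in S by rewrite SE !inE eqxx !orbT.
apply/andP; split; first by apply: contraNneq vp => <-.
have xa : x != a by apply: contraNneq ap => <-.
have xb : x != b by apply: contraNneq bp => <-.
rewrite Hn //; apply/negP=> h; move: va vb h; rewrite !Hn //.
move: xa xb ab ab'; clear; do 3![case/orP=> /eqP ->|]; rewrite ?eqxx //.
by move=> xa xb ab ab' /orP[]/eqP e1 /orP[]/eqP e2 /orP[]/eqP e3; subst; rewrite ?eqxx in xa xb ab.
Qed.

Lemma holes_at_le v : 3 * #|[set S : {set G} | hole S & v \in S]| <=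
  #|G| * #|G| * tgrow (#|G| - #|nbh v|.+1).
Proof.
apply: leq_trans (_ : 3 * (\sum_(u in [set v]) \sum_(a in nbh u) \sum_(b in nbh u)
    size (paths b #|G| a (~: (u |: nbh u)))) <= _).
  rewrite leq_mul2l /=; apply: count_paths => S; rewrite inE => /andP[hS vS].
  have [a [b [p [aA bA pP SE]]]] := hole_at hS vS.
  by exists v, a, b, p; split=> //; rewrite inE.
rewrite big_set1 big_distrr /=.
apply: leq_trans (_ : \sum_(a in nbh v) #|G| * tgrow (#|G| - #|nbh v|.+1) <= _).
  apply: leq_sum => a _; rewrite big_distrr /=.
  apply: leq_trans (_ : \sum_(b in nbh v) tgrow (#|G| - #|nbh v|.+1) <= _).
    apply: leq_sum => b _; by rewrite -card_nbh1 -(cardsC (v |: nbh v)) addKn; apply: paths_le.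
  by rewrite sum_nat_const leq_mul2r max_card orbT.
by rewrite sum_nat_const mulnA leq_mul2r leq_mul2r max_card !orbT.
Qed.

Lemma holes_cover : num_holes G <= \sum_(v : G) #|[set S : {set G} | hole S & v \in S]|.
Proof.
rewrite /num_holes -sum1_card.
under [X in _ <= X]eq_bigr do rewrite -sum1_card.
rewrite (exchange_big_dep (fun S => S \in [set S : {set G} | hole S])) /=; last first.
  by move=> v S _; rewrite !inE => /andP[].
apply: leq_sum => S; rewrite inE => hS; rewrite sum1_card.
have /card_gt0P[v vS] : 0 < #|S| by apply: leq_trans (hole_card hS).
by apply/card_gt0P; exists v; change (S \in [set S0 : {set G} | hole S0 & v \in S0]);
  rewrite inE hS.
Qed.

Lemma holes_rough : 3 * num_holes G <= #|G| ^ 3 * tgrow #|G|.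
Proof.
apply: leq_trans (leq_mul (leqnn 3) holes_cover) _.
rewrite big_distrr /=.
have -> : #|G| ^ 3 * tgrow #|G| = \sum_(v : G) #|G| * #|G| * tgrow #|G|.
  by rewrite sum_nat_const !expnS expn0 muln1 !mulnA.
apply: leq_sum => v _; apply: leq_trans (holes_at_le v) _.
by rewrite leq_mul2l leq_tgrow ?leq_subr ?orbT.
Qed.

Lemma many_paths X : #|G| ^ 3 * X < num_holes G ->
  exists v a b, [/\ a \in nbh v, b \in nbh v & X < size (paths b #|G| a (~: (v |: nbh v)))].
Proof.
move=> lt; case: (boolP [exists v : G, exists a in nbh v, exists b in nbh v,
   X < size (paths b #|G| a (~: (v |: nbh v)))]) => [|H].
  by case/existsP=> v /exists_inP[a aA /exists_inP[b bB h]]; exists v, a, b.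
move: lt; rewrite ltnNge => /negP[].
apply: leq_trans holes_cover _.
have -> : #|G| ^ 3 * X = \sum_(v : G) #|G| * (#|G| * X).
  by rewrite sum_nat_const !expnS expn0 muln1 !mulnA.
apply: leq_sum => v _.
apply: leq_trans (_ : (\sum_(u in [set v]) \sum_(a in nbh u) \sum_(b in nbh u)
    size (paths b #|G| a (~: (u |: nbh u)))) <= _).
  apply: count_paths => S; rewrite inE => /andP[hS vS].
  have [a [b [p [aA bA pP SE]]]] := hole_at hS vS.
  by exists v, a, b, p; split=> //; rewrite inE.
rewrite big_set1.
apply: leq_trans (_ : \sum_(a in nbh v) \sum_(b in nbh v) X <= _).
  apply: leq_sum => a aA; apply: leq_sum => b bB; rewrite leqNgt.
  move: H; rewrite negb_exists => /forallP/(_ v); rewrite negb_exists_in.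
  by move=> /forall_inP/(_ _ aA); rewrite negb_exists_in => /forall_inP/(_ _ bB).
by rewrite !sum_nat_const; apply: leq_mul; rewrite ?max_card // leq_mul2r max_card orbT.
Qed.

Definition induced_vertex U : finType := {x : G | x \in U}.
Definition induced_adj U (x y : induced_vertex U) := adj (val x) (val y).
Fact induced_sym U : symmetric (@induced_adj U).
Proof. by move=> x y; apply: adj_sym. Qed.
Fact induced_irr U : irreflexive (@induced_adj U).
Proof. by move=> x; apply: adj_irrefl. Qed.
Definition induced U := SGraph (@induced_sym U) (@induced_irr U).

Lemma card_induced U : #|induced U| = #|U|.
Proof. by rewrite card_sig; apply: eq_card. Qed.

Lemma holes_induced U :
  #|[set S : {set G} | hole S & S \subset U]| <= num_holes (induced U).
Proof.
case: (set_0Vmem [set S : {set G} | hole S & S \subset U]) => [->|[S1]].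
  by rewrite cards0.
rewrite inE => /andP[h1 S1U].
have /card_gt0P[x0 x0S] : 0 < #|S1| by apply: leq_trans (hole_card h1).
(* A default value for [insubd], available because some hole lies in [U]. *)
pose u0 : induced U := exist _ x0 (subsetP S1U _ x0S).
pose f x : induced U := insubd u0 x.
have fK x : x \in U -> val (f x) = x by move=> xU; rewrite /f val_insubd xU.
have vK S : S \subset U -> [set val z | z in f @: S] = S.
  move=> SU; apply/setP=> x; apply/imsetP/idP => [[z /imsetP[y yS ->] ->]|xS].
    by rewrite fK ?(subsetP SU).
  by exists (f x); rewrite ?imset_f ?fK ?(subsetP SU).
rewrite -(@card_in_imset _ _ (fun S : {set G} => f @: S)) => [|S S']; last first.
  by rewrite !inE => /andP[_ SU] /andP[_ SU'] e; rewrite -(vK S) // e vK.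
apply/subset_leq_card/subsetP=> _ /imsetP[S + ->].
rewrite !inE => /andP[hS SU]; apply: hole_transfer hS => x y xS yS.
  by move=> e; rewrite -(fK x) ?(subsetP SU) // e fK ?(subsetP SU).
by rewrite /= /induced_adj !fK ?(subsetP SU).
Qed.

Lemma card_C4s : #|[set S : {set G} | #|S| == 4]| <= #|G| ^ 4.
Proof.
rewrite card_draws; apply: leq_trans (_ : #|G| ^_ 4 <= _).
  by rewrite -bin_ffact leq_pmulr.
move: #|G| 4 => n m; elim: m n => [|m IH] n; first by rewrite ffactn0 expn0.
rewrite ffactnS expnS leq_mul2l; apply/orP; right.
apply: leq_trans (IH _) _; case: (m) => [|m']; first by rewrite !expn0.
by rewrite leq_exp2r // leq_pred.
Qed.

End Counting.

(** * Holes that meet a braid segment *)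

Lemma hole_other (G : sgraph) (S : {set G}) (p b : G) :
  hole S -> p \in S -> b \in S -> adj p b ->
  exists r, [/\ r \in S, r != b, adj p r & ~~ adj r b].
Proof.
move=> hS pS bS pb; have [u [v [uv uS vS nuv Hn]]] := hole_nbrs hS pS.
move: (pb); rewrite Hn // => /orP[/eqP e|/eqP e]; subst b.
  by exists v; rewrite eq_sym uv Hn // eqxx orbT adjC.
by exists u; rewrite uv Hn // eqxx.
Qed.

Lemma addn2_neq j : j.+2 <> j. Proof. lia. Qed.

Section Crossing.
Variables (G : sgraph) (B : nat -> {set G}) (M : nat).
Hypothesis seg : segment B M.
Implicit Types (x y u v a b : G) (S W : {set G}).

Lemma seg_next j x y : j.+2 < M -> x \in B j.+1 -> y \in B j.+2 -> adj x y.
Proof.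
case: seg => _ _ H jM xB yB; have [/subsetP/(_ y) + _] := H _ _ jM xB.
by rewrite !inE yB orbT => ->.
Qed.

Lemma seg_prev j x y : j.+2 < M -> x \in B j.+1 -> y \in B j -> adj x y.
Proof.
case: seg => _ _ H jM xB yB; have [/subsetP/(_ y) + _] := H _ _ jM xB.
by rewrite !inE yB => ->.
Qed.

Lemma seg_adj j x y : j.+2 < M -> x \in B j.+1 -> adj x y ->
  [|| y \in B j, y \in B j.+1 | y \in B j.+2].
Proof.
case: seg => _ _ H jM xB xy; have [_ /subsetP/(_ y)] := H _ _ jM xB.
by rewrite !inE xy -orbA => ->.
Qed.

Lemma seg_disj i j x : i < M -> j < M -> x \in B i -> x \in B j -> i = j.
Proof.
case: seg => _ H _ iM jM xi xj; apply/eqP; apply: contraT => /(H _ _ iM jM).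
by move/pred0P/(_ x); rewrite /= xi xj.
Qed.

Variable S : {set G}.
Hypotheses (hS : hole S) (S4 : #|S| != 4).

Lemma no_C4 p b q r : p \in S -> b \in S -> q \in S -> r \in S -> p != q -> b != r ->
  adj p b -> adj b q -> adj q r -> adj r p -> False.
Proof.
move=> pS bS qS rS pq br pb bq qr rp; have e := hole_C4 hS pS bS qS rS pq br pb bq qr rp.
have := hole_card hS; rewrite leq_eqVlt eq_sym (negbTE S4) /= e.
rewrite -!setUA ltnNge => /negP[].
do 3![apply: leq_trans (leq_card_setU _ _) _; rewrite cards1 ?add1n ?ltnS].
by rewrite cards1.
Qed.

Section Center.
Variables (j : nat) (b : G).
Hypotheses (jM : j.+4 < M) (bS : b \in S) (bB : b \in B j.+2).

Let jM3 : j.+3 < M. Proof. exact: ltnW. Qed.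
Let jM2 : j.+2 < M. Proof. exact: ltnW. Qed.

(** Otherwise [q] is in the part of [b] as well, since the adjacent parts are joined to [p]. The
    part having three vertices, it is {p, b, q}, so the second hole neighbour of [p] lies in an
    adjacent part and is joined to [b] too, which is impossible. *)
Lemma cross_out p q : p \in S -> q \in S -> p != q -> adj b p -> adj b q ->
  ~~ adj p q -> p \notin B j.+2.
Proof.
move=> pS qS pq bp bq /negP npq; apply/negP=> pB.
have qB : q \in B j.+2.
  have /or3P[qB|//|qB] := seg_adj jM3 bB bq.
    by case: npq; apply: seg_prev pB qB.
  by case: npq; apply: seg_next pB qB.
have bE : B j.+2 = [set p; b; q].
  apply/esym/eqP; rewrite eqEcard; apply/andP; split.
    by apply/subsetP=> x; rewrite !inE => /orP[/orP[]|] /eqP->.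
  have [-> // _ _] := seg; rewrite -setUA cardsU1 cards2 !inE negb_or pq.
  have -> : p != b by apply: contraTneq bp => ->; rewrite adjxx.
  by have -> : b != q by apply: contraTneq bq => <-; rewrite adjxx.
have [r [rS rb pr /negP nrb]] := hole_other hS pS bS (etrans (adjC _ _) bp).
have /or3P[rB|rB|rB] := seg_adj jM3 pB pr.
- by case: nrb; rewrite adjC; apply: seg_prev bB rB.
- move: rB; rewrite bE !inE (negbTE rb) orbF => /orP[]/eqP e; subst r.
    by rewrite adjxx in pr.
  by [].
- by case: nrb; rewrite adjC; apply: seg_next bB rB.
Qed.

(** The second hole neighbour [r] of [p] is not in the part of [p], all of which is joined to [b].
    Hence it is joined to [q] as well, and p, b, q, r form a cycle of length 4. *)
Lemma cross_prev p q : p \in S -> q \in S -> p != q -> adj b p -> adj b q ->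
  p \in B j.+1 -> q \in B j.+1 -> False.
Proof.
move=> pS qS pq bp bq pB qB; have pb : adj p b by rewrite adjC.
have [r [rS rb pr /negP nrb]] := hole_other hS pS bS pb.
have qr : adj q r.
  have /or3P[rB|rB|rB] := seg_adj jM2 pB pr.
  - exact: seg_prev qB rB.
  - by case: nrb; apply: seg_next rB bB.
  - exact: seg_next qB rB.
by apply: (no_C4 pS bS qS rS pq _ pb bq qr); rewrite 1?eq_sym // adjC.
Qed.

Lemma cross_next p q : p \in S -> q \in S -> p != q -> adj b p -> adj b q ->
  p \in B j.+3 -> q \in B j.+3 -> False.
Proof.
move=> pS qS pq bp bq pB qB; have pb : adj p b by rewrite adjC.
have [r [rS rb pr /negP nrb]] := hole_other hS pS bS pb.
have qr : adj q r.
  have /or3P[rB|rB|rB] := seg_adj jM pB pr.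
  - exact: seg_prev qB rB.
  - by case: nrb; apply: seg_prev rB bB.
  - exact: seg_next qB rB.
by apply: (no_C4 pS bS qS rS pq _ pb bq qr); rewrite 1?eq_sym // adjC.
Qed.

Lemma hole_cross : exists p q,
  [/\ S :&: B j.+1 = [set p], S :&: B j.+2 = [set b], S :&: B j.+3 = [set q] &
      forall x, x \in S -> adj b x = (x == p) || (x == q)].
Proof.
have [p0 [q0 [pq0 pS0 qS0 npq0 Hn0]]] := hole_nbrs hS bS.
have [p [q [pB qB [pS qS] Hn]]] : exists p q, [/\ p \in B j.+1, q \in B j.+3,
    p \in S /\ q \in S & forall x, x \in S -> adj b x = (x == p) || (x == q)].
  have bp0 : adj b p0 by rewrite Hn0 ?eqxx.
  have bq0 : adj b q0 by rewrite Hn0 ?eqxx ?orbT.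
  have := cross_out pS0 qS0 pq0 bp0 bq0 npq0.
  have := seg_adj jM3 bB bp0.
  have qp0 : q0 != p0 by rewrite eq_sym.
  have nqp0 : ~~ adj q0 p0 by rewrite adjC.
  have := cross_out qS0 pS0 qp0 bq0 bp0 nqp0.
  have := seg_adj jM3 bB bq0.
  case/or3P=> [q1|->//|q1] _ /or3P[p1|->//|p1] _.
  - by case: (cross_prev pS0 qS0 pq0 bp0 bq0 p1 q1).
  - by exists q0, p0; split=> // x xS; rewrite Hn0 // orbC.
  - by exists p0, q0.
  - by case: (cross_next pS0 qS0 pq0 bp0 bq0 p1 q1).
exists p, q; split=> //.
- apply/setP=> x; rewrite !inE; apply/andP/eqP => [[xS xB]|->//].
  have bx : adj b x by rewrite adjC; apply: seg_next xB bB.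
  move: bx; rewrite Hn // => /orP[]/eqP // e; subst x.
  by have /addn2_neq := seg_disj jM3 (ltnW jM2) qB xB.
- apply/setP=> x; rewrite !inE; apply/andP/eqP => [[xS xB]|->//].
  apply/eqP; apply: contraT => xb; exfalso.
  have pb : adj p b by apply: seg_next pB bB.
  have bq : adj b q by apply: seg_next bB qB.
  have qx : adj q x by apply: seg_prev qB xB.
  have xp : adj x p by apply: seg_prev xB pB.
  have pq : p != q.
    apply: contraTneq pB => ->; apply/negP=> qB'.
    by have /addn2_neq := seg_disj jM3 (ltnW jM2) qB qB'.
  by apply: (no_C4 pS bS qS xS pq _ pb bq qx xp); rewrite eq_sym.
- apply/setP=> x; rewrite !inE; apply/andP/eqP => [[xS xB]|->//].
  have bx : adj b x by apply: seg_next bB xB.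
  move: bx; rewrite Hn // => /orP[]/eqP // e; subst x.
  by have /addn2_neq := seg_disj jM3 (ltnW jM2) xB pB.
Qed.

End Center.

(** By [hole_cross] the hole extends from each part to both adjacent ones: it is followed down to
    [B 3], or up from [B 2]. *)
Lemma hits_three j : 5 < M -> j.+4 < M -> S :&: B j.+2 != set0 -> S :&: B 3 != set0.
Proof.
move=> M5; elim: j => [|j IH] jM /set0Pn[b]; rewrite inE => /andP[bS bB].
  have [p [q [_ _ -> _]]] := hole_cross jM bS bB.
  by apply/set0Pn; exists q; rewrite inE.
case: j IH jM bB => [|j] IH jM bB; first by apply/set0Pn; exists b; rewrite inE bS.
apply: IH; first exact: ltnW.
have [p [q [-> _ _ _]]] := hole_cross jM bS bB.
by apply/set0Pn; exists p; rewrite inE.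
Qed.

End Crossing.

(** * Counting the holes of a graph with a braid segment *)

Section SegmentCount.
Variables (G : sgraph) (B : nat -> {set G}) (M : nat).
Hypotheses (seg : segment B M) (M5 : 5 < M).
Implicit Types (x y u v a b : G) (S W : {set G}).

Let W : {set G} := ~: (B 2 :|: B 3 :|: B 4).

Let ltM i : i < 6 -> i < M. Proof. by move=> ?; apply: leq_trans M5. Qed.

Lemma disjB i j : i < 6 -> j < 6 -> i != j -> B i :&: B j = set0.
Proof.
move=> i6 j6 ij; apply/setP=> x; rewrite !inE; apply/andP=> -[xi xj].
by move: ij; rewrite (seg_disj seg (ltM i6) (ltM j6) xi xj) eqxx.
Qed.

Lemma card_core : #|B 2 :|: B 3 :|: B 4| = 9.
Proof.
have [c _ _] := seg; rewrite !cardsU !setIUl !disjB // setU0 cards0 !subn0.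
by rewrite !c // ltM.
Qed.

Lemma card_W : #|W| = #|G| - 9.
Proof. by rewrite -(cardsC (B 2 :|: B 3 :|: B 4)) card_core addKn. Qed.

Lemma card_ge9 : 9 <= #|G|.
Proof. by rewrite -card_core max_card. Qed.

Definition crossing := [set S : {set G} | [&& hole S, #|S| != 4 & S :&: B 3 != set0]].

Lemma crossing_paths : #|crossing| <=
  \sum_(v in B 3) \sum_(a in B 4) \sum_(b in B 2) size (paths b #|G| a W).
Proof.
apply: (count_paths (A := fun=> B 4) (B := fun=> B 2) (W := fun=> W)) => S.
rewrite inE => /and3P[hS S4 /set0Pn[v]]; rewrite inE => /andP[vS vB].
have [x [y [E2 E3 E4 Hn]]] := hole_cross seg hS S4 (M5 : 1.+4 < M) vS vB.
have [a [b [p [/andP[va vb] ab SE up H]]]] := hole_ipath hS vS.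
have /setIP[xS xB] : x \in S :&: B 2 by rewrite E2 inE.
have /setIP[yS yB] : y \in S :&: B 4 by rewrite E4 inE.
have aS : a \in S by rewrite SE !inE eqxx orbT.
have bS : b \in S by rewrite SE !inE eqxx !orbT.
move: up; rewrite /= !inE !negb_or => /and4P[/and3P[_ _ vp] /andP[_ ap] bp up].
have szp : size p <= #|G| by rewrite -(card_uniqP up) max_card.
have pW : a \in [set x; y] -> b \in [set x; y] -> {subset p <= W}.
  move=> axy bxy z zp; have zS : z \in S by rewrite SE !inE zp !orbT.
  have za : z != a by apply: contraNneq ap => <-.
  have zb : z != b by apply: contraNneq bp => <-.
  have zv : z != v by apply: contraNneq vp => <-.
  have [zx zy] : z != x /\ z != y.
    move: axy bxy za zb ab; rewrite !inE.
    by move=> /orP[]/eqP-> /orP[]/eqP-> h1 h2; rewrite ?eqxx.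
  rewrite !inE; apply/negP=> /orP[/orP[]|] zB.
  - by have : z \in S :&: B 2; [rewrite inE zS|rewrite E2 inE (negbTE zx)].
  - by have : z \in S :&: B 3; [rewrite inE zS|rewrite E3 inE (negbTE zv)].
  - by have : z \in S :&: B 4; [rewrite inE zS|rewrite E4 inE (negbTE zy)].
move: (va) (vb); rewrite !Hn // => /orP[]/eqP ea /orP[]/eqP eb; subst a b.
- by rewrite eqxx in ab.
- exists v, y, x, (rev p); split=> //.
    apply: mem_paths; rewrite ?size_rev //; apply: (H _ _).2; apply: pW; by rewrite !inE eqxx ?orbT.
  rewrite SE; apply/setP=> z; rewrite !inE mem_rev; by do 3![case: eqP => //= _].
- exists v, y, x, p; split=> //.
  by apply: mem_paths => //; apply: (H _ _).1; apply: pW; rewrite !inE eqxx ?orbT.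
- by rewrite eqxx in ab.
Qed.

(** [hole_cross] needs two parts of the segment on either side, so the outer two at each end stay in
    [U]. *)
Let U : {set G} := ~: \bigcup_(j < M - 4) B j.+2.

Lemma card_U_seg : #|U| + 3 * (M - 4) = #|G|.
Proof.
rewrite -(cardsC (\bigcup_(j < M - 4) B j.+2)) addnC; congr (_ + _); apply/esym.
have [c _ _] := seg.
have : forall m, m <= M - 4 -> #|\bigcup_(j < m) B j.+2| = 3 * m.
  elim=> [|m IH] le; first by rewrite big_ord0 cards0.
  rewrite big_ord_recr /= cardsU IH; last exact: ltnW.
  rewrite c; last by lia.
  rewrite (_ : _ :&: _ = set0) ?cards0 ?subn0; first by lia.
  apply/setP=> x; rewrite inE in_set0; apply/andP=> -[/bigcupP[i _ xi] xm].
  have := seg_disj seg _ _ xi xm; have := ltn_ord i; lia.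
by apply.
Qed.

Lemma holes_split : num_holes G <= #|G| ^ 4 + num_holes (induced U) + #|crossing|.
Proof.
apply: leq_trans (_ : #|[set S : {set G} | #|S| == 4] :|:
   [set S : {set G} | hole S & S \subset U] :|: crossing| <= _).
  apply/subset_leq_card/subsetP=> S; rewrite !inE => hS; rewrite hS /=.
  case: eqP => //= /eqP S4; case: (boolP (S :&: B 3 == set0)) => //=; rewrite ?orbT // orbF => S3.
  apply/subsetP=> x xS; rewrite inE; apply/bigcupP=> -[j _ xB].
  have jM : j.+4 < M by have := ltn_ord j; lia.
  have : S :&: B 3 != set0; last by rewrite S3.
  by apply: (hits_three seg hS S4 M5 jM); apply/set0Pn; exists x; rewrite inE xS.
apply: leq_trans (leq_card_setU _ _) _; rewrite leq_add2r.
apply: leq_trans (leq_card_setU _ _) _; apply: leq_add; first exact: card_C4s.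
exact: holes_induced.
Qed.

Lemma tgrow_core : tgrow #|G| = 27 * tgrow #|W|.
Proof. by rewrite card_W -{1}(subnK card_ge9) !addnS addn0 !tgrowD3 !mulnA. Qed.

Lemma crossing_le c : (forall a b, a \in B 4 -> b \in B 2 ->
    size (paths b #|G| a W) <= c) -> #|crossing| <= 27 * c.
Proof.
move=> H; apply: leq_trans crossing_paths _.
have [cB _ _] := seg.
apply: leq_trans (_ : \sum_(v in B 3) 9 * c <= _); last first.
  by rewrite sum_nat_const cB ?ltM // mulnA.
apply: leq_sum => v _; apply: leq_trans (_ : \sum_(a in B 4) 3 * c <= _); last first.
  by rewrite sum_nat_const cB ?ltM // mulnA.
apply: leq_sum => a aB; apply: leq_trans (_ : \sum_(b in B 2) c <= _); last first.
  by rewrite sum_nat_const cB ?ltM.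
by apply: leq_sum => b bB; apply: H.
Qed.

(** A crossing hole is given by one vertex in each of three parts and a path through [W]. The 27
    choices match the factor 27 of [tgrow_core], so nothing is lost in the leading term. *)
Lemma segment_upper :
  3 * num_holes G <= 3 * #|G| ^ 4 + #|U| ^ 3 * tgrow #|U| + tgrow #|G|.
Proof.
have h1 := holes_split; have h2 := holes_rough (induced U).
rewrite card_induced in h2.
have h3 : #|crossing| <= 27 * (tgrow #|W| %/ 3).
  by apply: crossing_le => a b _ _; rewrite leq_divRL // mulnC paths_le.
have h4 := leq_trunc_div (tgrow #|W|) 3; rewrite tgrow_core; lia.
Qed.

(** Either [paths_stable] saves 1/100 for every pair of ends, hence for all crossing holes, or a
    single pair of ends already reveals the layers of [W]. *)
Lemma segment_dichotomy :
  300 * num_holes G <= 300 * #|G| ^ 4 +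
     100 * (#|U| ^ 3 * tgrow #|U|) + 99 * tgrow #|G| \/
  exists a b rk r, [/\ a \in B 4, b \in B 2, layered b a W rk r &
     3 * \prod_(i < r) #|layer W rk i.+1| = tgrow #|W|].
Proof.
case: (boolP [forall a in B 4, forall b in B 2,
   100 * (3 * size (paths b #|G| a W)) <= 99 * tgrow #|W|]) => [/forall_inP Hs|].
  left; have h1 := holes_split; have h2 := holes_rough (induced U).
  rewrite card_induced in h2.
  have h3 : #|crossing| <= 27 * (99 * tgrow #|W| %/ 300).
    apply: crossing_le => a b aB bB; rewrite leq_divRL //.
    have /forall_inP/(_ _ bB) := Hs _ aB; by rewrite mulnA [_ * 300]mulnC.
  have h4 := leq_trunc_div (99 * tgrow #|W|) 300; rewrite tgrow_core; lia.
rewrite negb_forall_in => /exists_inP[a aB]; rewrite negb_forall_in => /exists_inP[b bB].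
move=> big; right.
have aW : a \notin W by rewrite !inE aB orbT.
have bW : b \notin W by rewrite !inE bB.
have ab : a != b.
  apply/eqP=> e; have := disjB (i := 4) (j := 2) isT isT isT.
  by move/setP/(_ a); rewrite !inE aB e bB.
have [le|[rk [r [lay pr]]]] := paths_stable #|G| aW bW ab; first by rewrite le in big.
by exists a, b, rk, r.
Qed.

End SegmentCount.

(** * Closing a segment to a cyclic braid *)

Definition braided (G : sgraph) k (pos : G -> 'I_k) : Prop :=
  (forall x y, pos y = ordS (pos x) -> adj x y) /\
  (forall x y, adj x y -> [|| pos x == pos y, pos y == ordS (pos x) | pos x == ordS (pos y)]).

Section Close.
Variables (G : sgraph) (B : nat -> {set G}) (M : nat).
Hypotheses (seg : segment B M) (M5 : 5 < M).
Implicit Types (x y u v : G).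

Let W : {set G} := ~: (B 2 :|: B 3 :|: B 4).
Variables (a b : G) (rk : G -> nat) (r : nat).
Hypotheses (aB : a \in B 4) (bB : b \in B 2) (lay : layered b a W rk r)
  (pr : 3 * \prod_(i < r) #|layer W rk i.+1| = tgrow #|W|).

Let ltM i : i < 6 -> i < M. Proof. by move=> ?; apply: leq_trans M5. Qed.

Let dj i j x : i < 6 -> j < 6 -> i != j -> x \in B i -> x \notin B j.
Proof.
move=> i6 j6 ij xi; apply/negP=> xj.
by move: ij; rewrite (seg_disj seg (ltM i6) (ltM j6) xi xj) eqxx.
Qed.

Let inW x : x \in W = [&& x \notin B 2, x \notin B 3 & x \notin B 4].
Proof. by rewrite !inE !negb_or -andbA. Qed.

Let rab : ~~ adj a b.
Proof.
apply/negP=> ab; have := seg_adj seg (ltM (isT : 5 < 6)) aB ab.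
by rewrite !(negbTE (dj _ _ _ bB)).
Qed.

Lemma r_gt0 : 0 < r.
Proof.
rewrite lt0n; apply: contra rab => /eqP r0; case: lay => ra rb _ _ H.
by case: (H a b); rewrite ?in_setU1 ?eqxx ?orbT // ra rb r0 => ->.
Qed.

(** Within [W] all vertices of [B 4] have the same neighbours, those in [B 5]. So the layering found
    from the single vertex [a] is valid for the whole part. *)
Lemma adjB4 x y : x \in B 4 -> y \in W -> adj x y = (rk y == 1).
Proof.
move=> xB yW; have E z : z \in B 4 -> adj z y = (y \in B 5).
  move=> zB; apply/idP/idP => [zy|yB]; last exact: (seg_next seg (ltM (isT : 5 < 6)) zB yB).
  have := seg_adj seg (ltM (isT : 5 < 6)) zB zy.
  by move: yW; rewrite inW => /and3P[_ /negbTE -> /negbTE ->].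
rewrite E // -(E a) //; case: lay => ra rb Hr _ H.
case: (H a y); rewrite ?in_setU1 ?eqxx ?yW ?orbT // ra => H1 H2.
apply/idP/eqP => [ay|]; last exact: H1.
have /andP[r1 _] := Hr _ yW; apply/eqP; rewrite eqn_leq r1 andbT leqNgt.
by apply/negP=> /H2; rewrite ay.
Qed.

Lemma adjB2 x y : x \in B 2 -> y \in W -> adj x y = (rk y == r).
Proof.
move=> xB yW; have E z : z \in B 2 -> adj z y = (y \in B 1).
  move=> zB; apply/idP/idP => [zy|yB]; last exact: (seg_prev seg (ltM (isT : 3 < 6)) zB yB).
  have := seg_adj seg (ltM (isT : 3 < 6)) zB zy.
  by move: yW; rewrite inW => /and3P[/negbTE -> /negbTE -> _]; rewrite /= orbF.
by rewrite E // -(E b) // adjC (layered_t lay yW).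
Qed.

Definition place x : nat :=
  if x \in B 3 then 0 else if x \in B 4 then 1
  else if x \in B 2 then r.+2 else (rk x).+1.

Lemma place_lt x : place x < r.+3.
Proof.
rewrite /place; case: ifP => // n3; case: ifP => // n4; case: ifP => // n2.
case: lay => _ _ /(_ x) + _ _; rewrite inW n2 n3 n4 => /(_ isT)/andP[_ le].
by rewrite !ltnS; apply: leqW.
Qed.

Let p3 x : x \in B 3 -> place x = 0. Proof. by rewrite /place => ->. Qed.
Let p4 x : x \in B 4 -> place x = 1.
Proof. by move=> xB; rewrite /place xB (negbTE (dj _ _ _ xB)). Qed.
Let p2 x : x \in B 2 -> place x = r.+2.
Proof. by move=> xB; rewrite /place xB !(negbTE (dj _ _ _ xB)). Qed.
Let pW x : x \in W -> place x = (rk x).+1.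
Proof. by rewrite inW /place => /and3P[/negbTE-> /negbTE-> /negbTE->]. Qed.

Let kind x : [\/ x \in B 3, x \in B 4, x \in B 2 | x \in W].
Proof.
case: (boolP (x \in B 3)) => h3; first by constructor 1.
case: (boolP (x \in B 4)) => h4; first by constructor 2.
case: (boolP (x \in B 2)) => h2; first by constructor 3.
by constructor 4; rewrite inW h2 h3 h4.
Qed.

Let rkW x : x \in W -> 0 < rk x <= r. Proof. by case: lay => _ _ H _ _ /H. Qed.

Let nx i j := if i == r.+2 then j == 0 else j == i.+1.

Let adj33 x y : x \in B 3 -> y \in W -> adj x y = false.
Proof.
move=> xB; rewrite inW => /and3P[h2 h3 h4]; apply/negP=> xy.
by have := seg_adj seg (ltM (isT : 4 < 6)) xB xy; rewrite (negbTE h2) (negbTE h3) (negbTE h4).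
Qed.

Let adj42 x y : x \in B 4 -> y \in B 2 -> adj x y = false.
Proof.
move=> xB yB; apply/negP=> xy; have := seg_adj seg (ltM (isT : 5 < 6)) xB xy.
by rewrite !(negbTE (dj _ _ _ yB)).
Qed.

Lemma place_next x y : nx (place x) (place y) -> adj x y.
Proof.
have r0 := r_gt0.
have s3 i : (0 == i.+2) = false by [].
case: (kind x) => xB; case: (kind y) => yB;
  rewrite /nx ?(p3 xB) ?(p4 xB) ?(p2 xB) ?(pW xB) ?(p3 yB) ?(p4 yB) ?(p2 yB) ?(pW yB) //=.
- by move=> _; apply: (seg_next seg (ltM (isT : 4 < 6)) xB yB).
- by have := rkW yB; case: (rk y).
- by rewrite eqSS; case: (r) r0.
- by rewrite eqSS => h; rewrite adjB4.
- by rewrite eqxx => _; apply: (seg_next seg (ltM (isT : 3 < 6)) xB yB).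
- by rewrite eqxx.
- by rewrite eqxx; case: (r).
- by rewrite eqxx.
- by case: eqP => // -[e]; have := rkW xB; rewrite e ltnn andbF.
- by case: eqP => // _; rewrite eqSS; have := rkW xB; case: (rk x).
- case: eqP => // _; rewrite !eqSS => /eqP e.
  by rewrite adjC adjB2 // e.
- case: eqP => // _; rewrite eqSS => /eqP e.
  by apply: (layered_adj lay).
Qed.

Lemma adj_place x y : adj x y ->
  [|| place x == place y, nx (place x) (place y) | nx (place y) (place x)].
Proof.
have r0 := r_gt0; move=> xy; have yx : adj y x by rewrite adjC.
have rW z : z \in W -> (rk z == r.+1) = false.
  by move=> /rkW/andP[_ le]; rewrite ltn_eqF.
case: (kind x) => xB; case: (kind y) => yB;
  rewrite /nx ?(p3 xB) ?(p4 xB) ?(p2 xB) ?(pW xB) ?(p3 yB) ?(p4 yB) ?(p2 yB) ?(pW yB) ?eqxx ?orbT //=.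
- by rewrite adj33 in xy.
- by rewrite adj42 in xy.
- move: xy; rewrite adjB4 // => /eqP->; rewrite !eqSS.
  by case: (r) r0 => //= r' _; rewrite ?orbT.
- by rewrite adj42 in yx.
- by move: xy; rewrite adjB2 // => /eqP->; rewrite !eqSS (ltn_eqF (ltnSn r)) eqxx orbT.
- by rewrite adj33 in yx.
- move: yx; rewrite adjB4 // => /eqP->; rewrite !eqSS.
  by case: (r) r0 => //= r' _; rewrite ?orbT.
- by move: yx; rewrite adjB2 // => /eqP->; rewrite !eqSS (ltn_eqF (ltnSn r)) eqxx.
rewrite !eqSS !rW //.
have := layered_le lay xB yB xy; have := layered_le lay yB xB yx.
move=> le2 le1; case: (ltngtP (rk x) (rk y)) => lt; last by [].
  by apply/or3P; constructor 2; rewrite eqn_leq le1 lt.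
by apply/or3P; constructor 3; rewrite eqn_leq le2 lt.
Qed.

Let pos x : 'I_r.+3 := Ordinal (place_lt x).

Let ordS_nx (i j : 'I_r.+3) : (j == ordS i) = nx i j.
Proof.
rewrite /nx -val_eqE /=; case: (eqVneq (val i) r.+2) => [/= ->|ne]; first by rewrite modnn.
by rewrite modn_small // ltnS ltn_neqAle ne -ltnS ltn_ord.
Qed.

Lemma closed_braid : exists k (p : G -> 'I_k), braided p /\
  3 * \prod_i #|[set x | p x == i]| = tgrow #|G|.
Proof.
exists r.+3, pos; split.
  split=> x y; first by move/eqP; rewrite ordS_nx => /place_next.
  by move/adj_place; rewrite !ordS_nx -val_eqE.
have [c _ _] := seg.
have cl i (A : {set G}) : (forall x, (place x == val i) = (x \in A)) -> #|[set x | pos x == i]| = #|A|.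
  by move=> h; apply: eq_card => x; rewrite inE -val_eqE h.
have e : tgrow #|G| = 27 * tgrow #|W|.
  by rewrite (card_W seg M5) -{1}(subnK (card_ge9 seg M5)) !addnS addn0 !tgrowD3 !mulnA.
rewrite e -pr big_ord_recl big_ord_recl big_ord_recr /=.
rewrite (cl _ (B 3)); last first.
  move=> x; apply/eqP/idP => [|/p3//]; rewrite /place; case: ifP => //= _.
  by case: ifP => // _; case: ifP.
rewrite (cl _ (B 4)); last first.
  move=> x; apply/eqP/idP => [|/p4//]; case: (kind x) => // xB; first by rewrite p3.
    by rewrite p2.
  by rewrite pW //= => -[e']; have := rkW xB; rewrite e'.
rewrite (cl _ (B 2)); last first.
  move=> x; apply/eqP/idP => [|/p2//]; case: (kind x) => // xB; first by rewrite p3.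
    by rewrite p4.
  rewrite pW //= /bump /= !add1n => -[e'].
  by have := rkW xB; rewrite e' ltnn andbF.
rewrite !c ?ltM // (eq_bigr (fun i : 'I_r => #|layer W rk i.+1|)) => [|i _]; first by lia.
apply: cl => x; rewrite /layer inE /= /bump !leq0n !add1n.
apply/eqP/andP => [|[xW /eqP e']]; last by rewrite pW // e'.
case: (kind x) => xB; rewrite ?(p3 xB) ?(p4 xB) ?(p2 xB) ?(pW xB) //.
  by move=> [e']; have := ltn_ord i; rewrite -e' ltnn.
by move=> [->].
Qed.

End Close.

(** * The holes of a cyclic braid *)

Lemma iter_ordS k n (i : 'I_k) : val (iter n (@ordS k) i) = (i + n) %% k.
Proof.
elim: n => [|n IH]; first by rewrite addn0 modn_small.
by rewrite iterS /= IH -addn1 modnDml addn1 addnS.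
Qed.

Lemma iter_ordS_neq k n (i : 'I_k) : 0 < n < k -> iter n (@ordS k) i != i.
Proof.
move=> /andP[n0 nk]; rewrite -val_eqE iter_ordS -[X in _ == X](modn_small (ltn_ord i)).
by rewrite -[X in _ == X %[mod _]]addn0 eqn_modDl mod0n modn_small // -lt0n.
Qed.

Lemma hole4I (G : sgraph) (x u y v : G) : uniq [:: x; u; y; v] ->
  adj x u -> adj u y -> adj y v -> adj v x -> ~~ adj x y -> ~~ adj u v ->
  hole [set x; u; y; v].
Proof.
move=> un xu uy yv vx /negbTE xy /negbTE uv; apply/holeP; exists [:: x; u; y; v]; last first.
  by apply/setP=> z; rewrite !inE -!orbA.
split=> //; move: un; rewrite /= !inE !negb_or !andbT.
move=> /and3P[/and3P[n1 n2 n3] /andP[n4 n5] n6].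
have E := (negbTE n1, negbTE n2, negbTE n3, negbTE n4, negbTE n5, negbTE n6, eqxx).
have [F1 F2 F3] : [/\ (u == x) = false, (y == x) = false & (v == x) = false].
  by split; rewrite eq_sym E.
have [F4 F5 F6] : [/\ (y == u) = false, (v == u) = false & (v == y) = false].
  by split; rewrite eq_sym E.
have [ux yu vy] : [/\ adj u x, adj y u & adj v y].
  by split; rewrite adjC.
have xv : adj x v by rewrite adjC.
have yx : adj y x = false by rewrite adjC.
have vu : adj v u = false by rewrite adjC.
move=> z w; rewrite !inE.
have R := (E, F1, F2, F3, F4, F5, F6, adjxx, xy, uv, yx, vu, (xu, uy, yv, vx, ux, yu, vy, xv)).
by case/or4P=> /eqP->; case/or4P=> /eqP->; do 6?[rewrite !R /=].
Qed.

Lemma setU3_parts (T : finType) (A B C X Y Z : {set T}) :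
  A :&: B = set0 -> A :&: C = set0 -> B :&: C = set0 ->
  X \subset A -> Y \subset B -> Z \subset C ->
  [/\ (X :|: Y :|: Z) :&: A = X, (X :|: Y :|: Z) :&: B = Y & (X :|: Y :|: Z) :&: C = Z].
Proof.
move=> AB AC BC /subsetP XA /subsetP YB /subsetP ZC.
have dis (P Q : {set T}) x : P :&: Q = set0 -> x \in P -> x \in Q -> False.
  by move=> PQ xP xQ; have := in_set0 x; rewrite -PQ inE xP xQ.
split; apply/setP=> x; rewrite !inE; apply/idP/idP.
- case/andP=> /orP[/orP[]|] // h xA; first by case: (dis _ _ _ AB xA (YB _ h)).
  by case: (dis _ _ _ AC xA (ZC _ h)).
- by move=> xX; rewrite xX XA.
- case/andP=> /orP[/orP[]|] // h xB; first by case: (dis _ _ _ AB (XA _ h) xB).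
  by case: (dis _ _ _ BC xB (ZC _ h)).
- by move=> xY; rewrite xY YB // orbT.
- case/andP=> /orP[/orP[]|] // h xC; first by case: (dis _ _ _ AC (XA _ h) xC).
  by case: (dis _ _ _ BC (YB _ h) xC).
- by move=> xZ; rewrite xZ ZC // orbT.
Qed.

Lemma card_profile (T : finType) (A B C : {set T}) a b c :
  A :&: B = set0 -> A :&: C = set0 -> B :&: C = set0 ->
  #|[set S : {set T} | [&& S \subset A :|: B :|: C, #|S :&: A| == a,
        #|S :&: B| == b & #|S :&: C| == c]]| = 'C(#|A|, a) * 'C(#|B|, b) * 'C(#|C|, c).
Proof.
move=> AB AC BC.
rewrite -(cards_draws A a) -(cards_draws B b) -(cards_draws C c) -!cardsX.
set P := setX _ _.
have inP X : X \in P -> [/\ X.1.1 \subset A, X.1.2 \subset B & X.2 \subset C] /\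
    [/\ #|X.1.1| == a, #|X.1.2| == b & #|X.2| == c].
  by case: X => [[X1 X2] X3]; rewrite !inE /= => /andP[/andP[/andP[-> ->] /andP[-> ->]] /andP[-> ->]].
rewrite -(@card_in_imset _ _ (fun X : {set T} * {set T} * {set T} => X.1.1 :|: X.1.2 :|: X.2) P).
  apply: eq_card => S; rewrite inE; apply/idP/imsetP => [/and4P[sub c1 c2 c3]|[X XP ->]].
    exists (S :&: A, S :&: B, S :&: C); first by rewrite !inE /= !subsetIr c1 c2 c3.
    by rewrite /= -!setIUr (setIidPl sub).
  have [[sA sB sC] [c1 c2 c3]] := inP _ XP.
  have [-> -> ->] := setU3_parts AB AC BC sA sB sC.
  by rewrite c1 c2 c3 !andbT !setUSS.
move=> [[X1 X2] X3] [[Y1 Y2] Y3] /inP[/= [a1 a2 a3] _] /inP[/= [b1 b2 b3] _] e.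
have [e1 e2 e3] := setU3_parts AB AC BC a1 a2 a3.
have [f1 f2 f3] := setU3_parts AB AC BC b1 b2 b3.
have /= e' := e.
have g1 : X1 = Y1 by rewrite -e1 -f1 e'.
have g2 : X2 = Y2 by rewrite -e2 -f2 e'.
have g3 : X3 = Y3 by rewrite -e3 -f3 e'.
by rewrite g1 g2 g3.
Qed.

Section Braid.
Variables (G : sgraph) (k : nat) (pos : G -> 'I_k).
Hypotheses (br : braided pos) (k5 : 4 < k).
Implicit Types (x y u v a b p q : G) (S : {set G}) (i j : 'I_k).

Definition part i : {set G} := [set x | pos x == i].

Definition inner S := [exists x in S, [exists y in S, adj x y && (pos x == pos y)]].

Lemma part_disj i j : i != j -> part i :&: part j = set0.
Proof.
move=> ij; apply/setP=> x; rewrite !inE; apply/andP=> -[/eqP e1 /eqP e2].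
by move: ij; rewrite -e1 -e2 eqxx.
Qed.

Lemma ordS_neq i : ordS i != i.
Proof. by apply: (@iter_ordS_neq k 1); lia. Qed.
Lemma ordS2_neq i : ordS (ordS i) != i.
Proof. by apply: (@iter_ordS_neq k 2); lia. Qed.
Lemma ordS3_neq i : ordS (ordS (ordS i)) != i.
Proof. by apply: (@iter_ordS_neq k 3); lia. Qed.
Lemma ordS4_neq i : ordS (ordS (ordS (ordS i))) != i.
Proof. by apply: (@iter_ordS_neq k 4); lia. Qed.

Lemma br_next x y : pos y = ordS (pos x) -> adj x y. Proof. by case: br => H _ /H. Qed.
Lemma br_prev x y : pos x = ordS (pos y) -> adj x y.
Proof. by move=> e; rewrite adjC; apply: br_next. Qed.
Lemma br_adj x y : adj x y -> pos x != pos y -> pos y = ordS (pos x) \/ pos x = ordS (pos y).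
Proof.
case: br => _ H /H /or3P[->//|/eqP|/eqP]; by [left|right].
Qed.

(** A hole vertex in an adjacent part would form a triangle with the ends of the inner edge. *)
Lemma inner_hole S : hole S -> inner S -> exists i, S \subset part i.
Proof.
move=> hS /exists_inP[x xS /exists_inP[y yS /andP[xy /eqP pxy]]]; exists (pos x).
suff <- : S :&: part (pos x) = S by apply: subsetIr.
apply: hole_closed => //; first exact: subsetIl.
  by apply/set0Pn; exists x; rewrite !inE xS /=.
move=> z w; rewrite !inE => /andP[zS /eqP pz] wS zw; rewrite wS /=.
apply: contraT => ne; exfalso.
have : pos z != pos w by rewrite pz eq_sym.
case/(br_adj zw) => e.
  apply: (@hole_notri _ S x y w hS xS yS wS xy); apply: br_next;
    by rewrite e pz // pxy.
by apply: (@hole_notri _ S x y w hS xS yS wS xy); apply: br_prev; rewrite -?pxy -pz.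
Qed.

Section Plain.
Variable S : {set G}.
Hypotheses (hS : hole S) (nS : ~~ inner S).

Lemma plain_adj x y : x \in S -> y \in S -> adj x y ->
  pos y = ordS (pos x) \/ pos x = ordS (pos y).
Proof.
move=> xS yS xy; apply: br_adj => //; apply: contra nS => e.
by apply/exists_inP; exists x => //; apply/exists_inP; exists y; rewrite // xy.
Qed.

Lemma card4 p b q r : p \in S -> b \in S -> q \in S -> r \in S -> p != q -> b != r ->
  adj p b -> adj b q -> adj q r -> adj r p -> #|S| = 4.
Proof.
move=> pS bS qS rS pq br' pb bq qr rp.
by apply/eqP; apply: contraT => S4; case: (no_C4 hS S4 pS bS qS rS pq br' pb bq qr rp).
Qed.

(** Without inner edges, hole vertices in the same part have the same hole neighbours. So two
    neighbours of [b] in one part, or a second hole vertex in the part of [b], would give a cycle of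
    length 4. *)
Lemma long_next b : #|S| != 4 -> b \in S ->
  [/\ S :&: part (pos b) = [set b] & exists2 q, q \in S & pos q = ordS (pos b)].
Proof.
move=> S4 bS; have [p [q [pq pS qS npq Hn]]] := hole_nbrs hS bS.
have bp : adj b p by rewrite Hn ?eqxx.
have bq : adj b q by rewrite Hn ?eqxx ?orbT.
have pb : adj p b by rewrite adjC.
have same u v : u \in S -> v \in S -> u != v -> adj b u -> adj b v -> pos u != pos v.
  move=> uS vS uv bu bv; apply: contra S4 => /eqP e.
  have ub : adj u b by rewrite adjC.
  have [r [rS rb ur nrb]] := hole_other hS uS bS ub.
  have vr : adj v r.
    by case: (plain_adj uS rS ur) => e'; [apply: br_next|apply: br_prev]; rewrite -e.
  by apply/eqP; apply: (card4 uS bS vS rS uv _ ub bv vr); rewrite 1?eq_sym // adjC.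
have sp := same _ _ pS qS pq bp bq.
have [u [v [uS vS uv [eu ev]]]] : exists u v, [/\ u \in S, v \in S, u != v &
    pos u = ordS (pos b) /\ pos b = ordS (pos v)].
  case: (plain_adj bS pS bp) (plain_adj bS qS bq) => e1 [] e2.
  - by move: sp; rewrite e1 e2 eqxx.
  - by exists p, q; split.
  - by exists q, p; split=> //; rewrite eq_sym.
  - by move: sp; rewrite -(inj_eq (@ordS_inj k)) -e1 -e2 eqxx.
split; last by exists u.
apply/setP=> z; rewrite !inE; apply/andP/eqP => [[zS /eqP ez]|->]; last by rewrite eqxx.
apply/eqP; apply: contraT => zb; case/negP: S4; apply/eqP.
have vb : adj v b by apply: br_next.
have bu : adj b u by apply: br_next.
have uz : adj u z by apply: br_prev; rewrite ez.
have zv : adj z v by apply: br_prev; rewrite ez.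
by apply: (card4 vS bS uS zS _ _ vb bu uz zv); rewrite eq_sym.
Qed.

Lemma long_all i : #|S| != 4 -> #|S :&: part i| = 1.
Proof.
move=> S4; have [b bS] : exists b, b \in S.
  by apply/card_gt0P; apply: leq_trans (hole_card hS).
have [n ->] : exists n, i = iter n (@ordS k) (pos b).
  (* The distance from [pos b] to [i], plus [k] to avoid truncated subtraction. *)
  exists (i + (k - pos b)); apply: val_inj; rewrite iter_ordS addnCA.
  have le : pos b <= k by apply: ltnW.
  by rewrite subnKC // modnDr modn_small.
elim: n => [|n [IH]].
  by have [-> _] := long_next S4 bS; rewrite cards1.
have /card_gt0P[c] : 0 < #|S :&: part (iter n (@ordS k) (pos b))| by rewrite IH.
rewrite !inE => /andP[cS /eqP ec]; have [_ [q qS eq]] := long_next S4 cS.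
by have [+ _] := long_next S4 qS; rewrite eq ec /= => ->; rewrite cards1.
Qed.

End Plain.
(* The holes of length 4 of an empty braid, each listed once: two vertices in part
   i, and two in part i + 1 or one in each of the parts i - 1 and i + 1. *)
Definition fam i (t : bool) : {set {set G}} :=
  [set S : {set G} | [&& S \subset part i :|: part (ordS i) :|: part (ord_pred i),
     #|S :&: part i| == 2, #|S :&: part (ordS i)| == (if t then 2 else 1) &
     #|S :&: part (ord_pred i)| == (if t then 0 else 1)]].

Lemma ord_pred_neq i : ord_pred i != i.
Proof. by rewrite -(inj_eq (@ordS_inj k)) ord_predK eq_sym ordS_neq. Qed.
Lemma ord_pred_neqS i : ordS i != ord_pred i.
Proof. by rewrite -(inj_eq (@ordS_inj k)) ord_predK ordS2_neq. Qed.

Lemma card_fam i t : #|fam i t| = 'C(#|part i|, 2) *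
  'C(#|part (ordS i)|, if t then 2 else 1) * 'C(#|part (ord_pred i)|, if t then 0 else 1).
Proof.
apply: card_profile; apply: part_disj; rewrite ?ord_pred_neqS //.
  by rewrite eq_sym ordS_neq.
by rewrite eq_sym ord_pred_neq.
Qed.

Lemma famI i t x y u v S : S = [set x; y; u; v] -> x != y -> u != v ->
  pos x = i -> pos y = i -> pos u = ordS i -> pos v = (if t then ordS i else ord_pred i) ->
  S \in fam i t.
Proof.
move=> SE xy uv px py pu pv.
pose X := [set x; y]; pose Y := if t then [set u; v] else [set u].
pose Z := if t then set0 else [set v].
have {SE}-> : S = X :|: Y :|: Z.
  rewrite SE /X /Y /Z; case: (t); first by rewrite setU0 -!setUA.
  by rewrite -!setUA.
have XA : X \subset part i.
  by apply/subsetP=> z; rewrite !inE => /orP[]/eqP->; rewrite ?px ?py.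
have YB : Y \subset part (ordS i).
  by rewrite /Y; case: (t) pv => pv; apply/subsetP=> z; rewrite !inE;
    [case/orP=> /eqP->; rewrite ?pu ?pv|move/eqP->; rewrite pu].
have ZC : Z \subset part (ord_pred i).
  rewrite /Z; case: (t) pv => pv; first exact: sub0set.
  by apply/subsetP=> z; rewrite !inE => /eqP->; rewrite pv.
have AB : part i :&: part (ordS i) = set0 by apply: part_disj; rewrite eq_sym ordS_neq.
have AC : part i :&: part (ord_pred i) = set0 by apply: part_disj; rewrite eq_sym ord_pred_neq.
have BC := part_disj (ord_pred_neqS i).
have [e1 e2 e3] := setU3_parts AB AC BC XA YB ZC.
rewrite inE e1 e2 e3 !setUSS //=.
by rewrite /X /Y /Z; case: (t); rewrite ?cards2 ?cards1 ?cards0 ?xy ?uv.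
Qed.

(** The four edges are steps of 1 or -1 around the cycle of parts. As [k > 4], their sum is 0 and
    not just a multiple of [k], so two opposite vertices share a part. *)
Lemma plain_C4_fam S : hole S -> ~~ inner S -> #|S| = 4 -> exists i t, S \in fam i t.
Proof.
move=> hS nS S4; have [b bS] : exists b, b \in S by apply/card_gt0P; rewrite S4.
have [p [q [pq pS qS npq Hn]]] := hole_nbrs hS bS.
have bp : adj b p by rewrite Hn ?eqxx.
have bq : adj b q by rewrite Hn ?eqxx ?orbT.
have pb : adj p b by rewrite adjC.
have [r [rS rb pr nrb]] := hole_other hS pS bS pb.
have rp : r != p by apply: contraTneq pr => ->; rewrite adjxx.
have rq : r != q by apply: contraNneq nrb => ->; rewrite adjC.
have bp' : b != p by apply: contraTneq bp => ->; rewrite adjxx.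
have bq' : b != q by apply: contraTneq bq => ->; rewrite adjxx.
have br' : b != r by rewrite eq_sym.
have SE : S = [set b; r; p; q].
  apply/esym/eqP; rewrite eqEcard; apply/andP; split.
    by apply/subsetP=> z; rewrite !inE => /orP[/orP[/orP[]|]|]/eqP->.
  by rewrite S4 -!setUA cardsU1 cardsU1 cards2 !inE !negb_or bp' bq' br' rp rq pq.
have qr : adj q r.
  have [u [v [uv uS vS _ Hr]]] := hole_nbrs hS rS.
  have nb z : z \in S -> adj r z -> (z == p) || (z == q).
    move=> zS rz; move: zS; rewrite SE !inE => /orP[/orP[/orP[]|]|] /eqP e; rewrite e ?eqxx ?orbT //.
      by move: nrb; rewrite -e rz.
    by move: rz; rewrite e adjxx.
  have := nb u uS; have := nb v vS; rewrite !Hr // !eqxx orbT => /(_ isT) hv /(_ isT) hu.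
  rewrite adjC Hr //; case/orP: hu => /eqP eu; case/orP: hv => /eqP ev; subst; rewrite ?eqxx ?orbT //.
  - by rewrite eqxx in uv.
have S2 : S = [set p; q; r; b].
  by rewrite SE; apply/setP=> z; rewrite !inE; case: (z == b); case: (z == r); rewrite ?orbT ?orbF.
have S3 : S = [set p; q; b; r].
  by rewrite SE; apply/setP=> z; rewrite !inE; case: (z == b); case: (z == r); rewrite ?orbT ?orbF.
have SE' : S = [set b; r; q; p] by rewrite SE -!setUA (setUC [set p]).
have qp : q != p by rewrite eq_sym.
have predE i j : j = ordS i -> i = ord_pred j.
  by move=> ->; apply: (@ordS_inj k); rewrite ord_predK.
case: (plain_adj nS bS pS bp) => ep; case: (plain_adj nS bS qS bq) => eq.
- case: (plain_adj nS pS rS pr) => er.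
    by exists (pos p), false; apply: (famI S2) => //; rewrite ?eq ?ep //; apply: predE.
  have e : pos r = pos b by apply: (@ordS_inj k); rewrite -er ep.
  by exists (pos b), true; apply: (famI SE).
- case: (plain_adj nS pS rS pr) => er; last first.
    have e : pos r = pos b by apply: (@ordS_inj k); rewrite -er ep.
    by exists (pos b), false; apply: (famI SE) => //; apply: predE.
  case: (plain_adj nS qS rS qr) => er'.
    exists (pos b), false; apply: (famI SE) => //; last exact: predE.
    by rewrite er' -eq.
  exfalso; have := ordS4_neq (pos r); rewrite -er' -eq -ep -er eqxx.
  by [].
- case: (plain_adj nS qS rS qr) => er; last first.
    have e : pos r = pos b by apply: (@ordS_inj k); rewrite -er eq.
    by exists (pos b), false; apply: (famI SE') => //; apply: predE.
  case: (plain_adj nS pS rS pr) => er'.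
    exists (pos b), false; apply: (famI SE') => //; last exact: predE.
    by rewrite er' -ep.
  exfalso; have := ordS4_neq (pos r); rewrite -er' -ep -eq -er eqxx.
  by [].
- have epq : pos q = pos p by apply: (@ordS_inj k); rewrite -eq ep.
  case: (plain_adj nS pS rS pr) => er.
    exists (pos p), true; apply: (famI S3) => //.
  by exists (pos p), false; apply: (famI S3) => //; apply: predE.
Qed.

Definition transversals : {set {set G}} := [set S | [forall i, #|S :&: part i| == 1]].

Lemma card_transversals : #|transversals| = \prod_i #|part i|.
Proof.
pose F : {set {ffun 'I_k -> G}} := [set f : {ffun 'I_k -> G} | [forall i, f i \in part i]].
have -> : \prod_i #|part i| = #|F|.
  rewrite (_ : #|F| = #|family (fun i => mem (part i))|); last first.
    by apply: eq_card => f; rewrite inE; apply/forallP/familyP.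
  by rewrite card_family foldrE big_map big_enum.
have posF (f : {ffun 'I_k -> G}) i : f \in F -> pos (f i) = i.
  by rewrite inE => /forallP/(_ i); rewrite inE => /eqP.
rewrite -(@card_in_imset _ _ (fun f : {ffun 'I_k -> G} => [set f i | i : 'I_k]) F).
  apply: eq_card => S; rewrite inE; apply/forallP/imsetP => [H|[f fF ->] i].
    have /fin_all_exists[f Hf] : forall i, exists x, S :&: part i == [set x].
      by move=> i; have /cards1P[x ->] := H i; exists x.
    have Hin i : f i \in S :&: part i by rewrite (eqP (Hf i)) inE.
    exists (finfun f).
      by rewrite inE; apply/forallP=> i; rewrite ffunE; case/setIP: (Hin i).
    apply/setP=> x; apply/idP/imsetP => [xS|[i _ ->]]; last by rewrite ffunE; case/setIP: (Hin i).
    exists (pos x) => //; rewrite ffunE; apply/set1P; rewrite -(eqP (Hf _)).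
    by rewrite !inE xS /=.
  apply/cards1P; exists (f i); apply/setP=> x; rewrite !inE; apply/andP/eqP => [[/imsetP[j _ ->]]|->].
    by rewrite posF // => /eqP->.
  by rewrite posF // imset_f.
move=> f g fF gF e; apply/ffunP=> i.
have : f i \in [set g i | i : 'I_k] by rewrite -e imset_f.
by case/imsetP=> j _ ej; rewrite ej; congr (g _); rewrite -(posF f i fF) ej posF.
Qed.

(** A part of size at most 3 contains no hole, so only transversals and holes of length 4 remain.
    For each index these are at most 9 with two vertices in each of two parts and 27 spread over
    three parts. *)
Lemma holes_upper : (forall i, #|part i| <= 3) ->
  num_holes G <= \prod_i #|part i| + 36 * k.
Proof.
move=> c3; rewrite -card_transversals.
have noin S : hole S -> ~~ inner S.
  move=> hS; apply/negP=> /(inner_hole hS)[i /subset_leq_card le].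
  by have := leq_trans (hole_card hS) (leq_trans le (c3 i)).
apply: leq_trans (_ : #|transversals :|: \bigcup_i (fam i true :|: fam i false)| <= _).
  apply/subset_leq_card/subsetP=> S; rewrite !inE => hS.
  have nS := noin S hS; case: (eqVneq #|S| 4) => S4.
    have [i [t Sf]] := plain_C4_fam hS nS S4; apply/orP; right.
    by apply/bigcupP; exists i => //; rewrite inE; case: t Sf => ->; rewrite ?orbT.
  by apply/orP; left; apply/forallP=> i; rewrite long_all.
apply: leq_trans (leq_card_setU _ _) _; rewrite leq_add2l.
have b2 n : n <= 3 -> 'C(n, 2) <= 3 by case: n => [|[|[|[|n]]]].
have b1 n : n <= 3 -> 'C(n, 1) <= 3 by rewrite bin1.
apply: leq_trans (_ : \sum_(i < k) 36 <= _); last by rewrite sum_nat_const card_ord mulnC.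
elim/big_rec2: _ => [|i m A _ le]; first by rewrite cards0.
apply: leq_trans (leq_card_setU _ _) _; apply: leq_add le.
apply: leq_trans (leq_card_setU _ _) _; rewrite !card_fam bin0 muln1.
by apply: (@leq_add _ _ 9 27); rewrite ?(@leq_mul _ _ 9 3) ?(@leq_mul _ _ 3 3) ?b1 ?b2.
Qed.

Section Empty.
Hypothesis empty : forall x y, pos x = pos y -> ~~ adj x y.

Lemma fam_hole i t S : S \in fam i t -> hole S /\ #|S| = 4.
Proof.
rewrite inE => /and4P[sub /cards2P[x [y [xy XE]]] cB cC].
have xA : x \in S :&: part i by rewrite XE !inE eqxx.
have yA : y \in S :&: part i by rewrite XE !inE eqxx orbT.
move: xA yA; rewrite !inE => /andP[xS /eqP px] /andP[yS /eqP py].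
have [u [v [uv YE pu pv]]] : exists u v, [/\ u != v,
    S :&: part (ordS i) :|: S :&: part (ord_pred i) = [set u; v],
    pos u = ordS i & pos v = ordS i \/ pos v = ord_pred i].
  case: t cB cC => [/cards2P[u [v [uv e]]]|/cards1P[u e]].
    rewrite cards_eq0 => /eqP e0; exists u, v; rewrite e0 e setU0.
    have : u \in S :&: part (ordS i) by rewrite e !inE eqxx.
    have : v \in S :&: part (ordS i) by rewrite e !inE eqxx orbT.
    by rewrite !inE => /andP[_ /eqP ->] /andP[_ /eqP ->]; split=> //; left.
  move=> /cards1P[v e']; exists u, v; rewrite e e'.
  have : u \in S :&: part (ordS i) by rewrite e inE.
  have : v \in S :&: part (ord_pred i) by rewrite e' inE.
  rewrite !inE => /andP[_ /eqP pv] /andP[_ /eqP pu]; split=> //; last by right.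
  by apply: contraTneq (ord_pred_neqS i) => e''; rewrite -pu -pv e'' eqxx.
have SE : S = [set x; u; y; v].
  rewrite -(setIidPl sub) !setIUr XE -setUA YE.
  by apply/setP=> z; rewrite !inE; case: (z == u); case: (z == y); rewrite ?orbT ?orbF.
have adju z : pos z = i -> adj z u by move=> e; apply: br_next; rewrite e.
have adjv z : pos z = i -> adj z v.
  move=> e; case: pv => e'; first by apply: br_next; rewrite e.
  by apply: br_prev; rewrite e e' ord_predK.
have nu z : pos z = i -> z != u by move=> /adju; apply: contraTneq => ->; rewrite adjxx.
have nv z : pos z = i -> z != v by move=> /adjv; apply: contraTneq => ->; rewrite adjxx.
have un : uniq [:: x; u; y; v].
  by rewrite /= !inE !negb_or !andbT nu // xy nv // uv nv // eq_sym nu.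
split; last by rewrite SE -!setUA cardsU1 cardsU1 cards2 !inE !negb_or; move: un;
  rewrite /= !inE !negb_or !andbT => /and3P[-> -> ->].
rewrite SE; apply: hole4I => //.
- exact: adju.
- by rewrite adjC adju.
- exact: adjv.
- by rewrite adjC adjv.
- by apply: empty; rewrite px py.
case: pv => e; first by apply: empty; rewrite pu e.
apply/negP=> uv'; have : pos u != pos v by rewrite pu e ord_pred_neqS.
case/(br_adj uv'); rewrite pu e ?ord_predK => /eqP.
  by rewrite -(inj_eq (@ordS_inj k)) ord_predK eq_sym (negbTE (ordS3_neq _)).
by rewrite (negbTE (ordS_neq _)).
Qed.

(** A part that meets [S] twice is [i] or its successor; if the two indices differed, each would be
    the successor of the other. *)
Lemma fam_inj i t i' t' S : S \in fam i t -> S \in fam i' t' -> i = i' /\ t = t'.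
Proof.
have two j s j' s' : S \in fam j s -> S \in fam j' s' -> j' = j \/ j' = ordS j.
  rewrite !inE => /and4P[sub _ _ cC] /and4P[_ /eqP c2 _ _].
  have [x [y [xy XE]]] : exists x y, x != y /\ S :&: part j' = [set x; y].
    by apply/cards2P; rewrite c2.
  have xA : x \in S :&: part j' by rewrite XE !inE eqxx.
  have yA : y \in S :&: part j' by rewrite XE !inE eqxx orbT.
  move: xA yA; rewrite !inE => /andP[xS /eqP px] /andP[yS /eqP py].
  have := subsetP sub x xS; rewrite !inE px => /orP[/orP[]|] /eqP e; [by left|by right|].
  move: cC; rewrite -e c2; by case: (s).
move=> h h'; have e : i = i'.
  case: (two _ _ _ _ h h') => // e; case: (two _ _ _ _ h' h) => // e'.
  by have := ordS2_neq i'; rewrite -e' -e eqxx.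
split=> //; move: h h'; rewrite -e !inE => /and4P[_ _ /eqP-> _] /and4P[_ _ + _].
by case: t; case: t'.
Qed.

Lemma transversal_hole S : S \in transversals -> hole S /\ #|S| = k.
Proof.
rewrite inE => /forallP H.
have /fin_all_exists[f Hf] : forall i, exists x, S :&: part i == [set x].
  by move=> i; have /cards1P[x ->] := H i; exists x.
have Hin i : f i \in S :&: part i by rewrite (eqP (Hf i)) inE.
have pf i : pos (f i) = i by have := Hin i; rewrite !inE => /andP[_ /eqP].
have fI : injective f by move=> i j e; rewrite -(pf i) e pf.
have SE : S = [set x in [seq f i | i <- enum 'I_k]].
  apply/setP=> x; rewrite inE; apply/idP/mapP => [xS|[i _ ->]]; last by case/setIP: (Hin i).
  exists (pos x); rewrite ?mem_enum //; apply/set1P; rewrite -(eqP (Hf _)).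
  by rewrite !inE xS /=.
have un : uniq [seq f i | i <- enum 'I_k] by rewrite map_inj_uniq ?enum_uniq.
have sz : size [seq f i | i <- enum 'I_k] = k by rewrite size_map size_enum_ord.
split; last by rewrite SE cardsE (card_uniqP un) sz.
have nxt i : next (enum 'I_k) i = ordS i.
  have i0 : 'I_k := i; rewrite -{1}(nth_ord_enum i0 i) next_nthE ?enum_uniq ?size_enum_ord //.
  have lt : i.+1 %% k < k by rewrite ltn_mod; apply: leq_ltn_trans (ltn_ord i).
  by rewrite (_ : i.+1 %% k = Ordinal lt) ?nth_ord_enum //; apply: val_inj.
have nm i : next [seq f j | j <- enum 'I_k] (f i) = f (ordS i).
  by rewrite (next_map fI (enum_uniq _)); congr f; exact: nxt.
apply/holeP; eexists; last exact: SE.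
split=> //; first by rewrite sz; apply: ltnW.
move=> _ _ /mapP[i _ ->] /mapP[j _ ->]; rewrite !nm !(inj_eq fI).
apply/idP/orP => [fij|[]/eqP e]; last 2 first.
- by apply: br_next; rewrite !pf.
- by apply: br_prev; rewrite !pf.
have : pos (f i) != pos (f j).
  by apply/negP=> /eqP e; have := empty e; rewrite fij.
by case/(br_adj fij); rewrite !pf => ->; [left|right].
Qed.

Lemma holes_lower : \prod_i #|part i| + \sum_i (#|fam i true| + #|fam i false|) <= num_holes G.
Proof.
rewrite -card_transversals.
pose F (j : 'I_k * bool) := fam j.1 j.2.
have -> : \sum_i (#|fam i true| + #|fam i false|) = \sum_(j : 'I_k * bool) #|F j|.
  rewrite -(pair_bigA _ (fun i t => #|F (i, t)|)) /=.
  by apply: eq_bigr => i _; rewrite big_bool.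
pose Q : {set {set G}} := [set S | hole S & #|S| == 4].
have FQ : \sum_(j : 'I_k * bool) #|F j| <= #|Q|.
  have -> : #|Q| = \sum_(S in Q) 1 by rewrite sum1_card.
  under [X in X <= _]eq_bigr do rewrite -sum1_card.
  rewrite (exchange_big_dep (fun S => S \in Q)) /=; last first.
    by move=> [i t] S _ /fam_hole[hS S4]; rewrite inE hS S4.
  apply: leq_sum => S _; rewrite sum1_card; rewrite leqNgt; apply/negP.
  case/card_gt1P=> -[i t] [[i' t'] [h h' /eqP[]]].
  by have [-> ->] := fam_inj (h : S \in fam i t) (h' : S \in fam i' t').
apply: leq_trans (leq_add (leqnn _) FQ) _.
have dj : transversals :&: Q = set0.
  apply/setP=> S; rewrite !inE; apply/andP=> -[T /andP[_ /eqP S4]].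
  have := transversal_hole (S := S); rewrite inE => /(_ T)[_]; rewrite S4 => e.
  by move: k5; rewrite -e.
rewrite -cardsUI dj cards0 addn0; apply/subset_leq_card/subsetP=> S.
move=> ST; rewrite in_set; move: ST; rewrite in_setU; case/orP=> [/transversal_hole[]//|].
by rewrite inE => /andP[].
Qed.

End Empty.

End Braid.

(** * Comparison with the extremal braid *)

Definition extremal_size (n : nat) : nat := match n %% 3 with 0 => 3 | 1 => 4 | _ => 2 end.

Lemma prod_le_tgrow (s : seq nat) : 3 * \prod_(d <- s) d <= tgrow (\sum_(d <- s) d).
Proof.
elim: s => [|d s IH]; first by rewrite !big_nil.
rewrite !big_cons mulnCA; apply: leq_trans (tgrow_le _ _).
by rewrite leq_mul2l IH orbT.
Qed.

(** Equality for the whole product forces a [tight] first factor and equality for the rest; the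
    residue of the sum of the rest then decides which factors may be added. *)
Lemma tight_sizes (s : seq nat) : 3 * \prod_(d <- s) d = tgrow (\sum_(d <- s) d) ->
  all (fun d => d \in [:: 2; 3; 4]) s /\
  match (\sum_(d <- s) d) %% 3 with
  | 0 => count_mem 2 s = 0 /\ count_mem 4 s = 0
  | 1 => count_mem 2 s = 0 /\ count_mem 4 s = 1 \/ count_mem 2 s = 2 /\ count_mem 4 s = 0
  | _ => count_mem 2 s = 1 /\ count_mem 4 s = 0
  end.
Proof.
elim: s => [|d s IH]; first by rewrite !big_nil.
rewrite !big_cons mulnCA; set m := \sum_(i <- s) i in IH *.
have le := prod_le_tgrow s; rewrite -/m in le.
move=> E; have tg := tgrow_gt0 (d + m).
have le' : tgrow (d + m) <= d * tgrow m by rewrite -E leq_mul2l le orbT.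
have := tgrow_step d m; case: ifP => [td eqd|_]; last by lia.
have d0 : 0 < d by case: d td {E tg le' eqd}.
have IHp : 3 * \prod_(i <- s) i = tgrow m.
  by apply/eqP; rewrite -(eqn_pmul2l d0) E eqd.
have [al cnt] := IH IHp; move: td; rewrite /tight -modnDmr /=.
have := ltn_pmod m (isT : 0 < 3); case: (m %% 3) cnt => [|[|[|r]]] // cnt _.
- case/or3P=> [/eqP->|/andP[/eqP-> _]|/andP[/eqP-> _]] //; rewrite al /=; split=> //;
    by case: cnt => -> ->; try left.
- by case/or3P=> [/eqP->|/andP[/eqP-> //]|/andP[/eqP-> //]]; rewrite al /=.
- case/or3P=> [/eqP->|/andP[/eqP-> _]|/andP[/eqP-> //]] //; rewrite al /=; split=> //;
    by case: cnt => -> ->; try right.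
Qed.

Lemma sum_sizes (s : seq nat) : all (fun d => d \in [:: 2; 3; 4]) s ->
  \sum_(d <- s) d + count_mem 2 s = 3 * size s + count_mem 4 s.
Proof.
elim: s => [|d s IH]; first by rewrite big_nil.
rewrite big_cons /= !inE => /andP[dE /IH e].
by case/or3P: dE => /eqP->; rewrite /=; move: e;
  move: (count_mem 2 s) (count_mem 4 s) (\sum_(j <- s) j) (size s) => a b c l; lia.
Qed.

(** Corresponding fibres are matched by position in their enumerations. *)
Lemma fibre_bijection (X Y : finType) (I : finType) (p : X -> I) (q : Y -> I) :
  (forall i, #|[set x | p x == i]| = #|[set y | q y == i]|) ->
  exists f : X -> Y, bijective f /\ forall x, q (f x) = p x.
Proof.
move=> H; pose A i := enum [set x | p x == i]; pose C i := enum [set y | q y == i].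
have szE i : size (A i) = size (C i) by rewrite -!cardE.
have inA x : x \in A (p x) by rewrite mem_enum inE.
have /fin_all_exists[f Hf] : forall x, exists y, q y = p x /\ index y (C (p x)) = index x (A (p x)).
  move=> x; have lt : index x (A (p x)) < size (C (p x)) by rewrite -szE index_mem.
  have [y0 _] : exists y0, y0 \in C (p x).
    by case: (C (p x)) lt => // y0 c _; exists y0; rewrite mem_head.
  exists (nth y0 (C (p x)) (index x (A (p x)))).
  rewrite index_uniq ?enum_uniq //; split=> //.
  by have := mem_nth y0 lt; rewrite mem_enum inE => /eqP.
have fI : injective f.
  move=> x x' e; have [q1 i1] := Hf x; have [q2 i2] := Hf x'.
  have pp : p x = p x' by rewrite -q1 -q2 e.
  have : index x (A (p x)) = index x' (A (p x)) by rewrite -i1 e {1}pp i2 pp.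
  move=> ei; rewrite -(nth_index x (inA x)) ei nth_index // pp; exact: inA.
exists f; split; last by move=> x; case: (Hf x).
apply: inj_card_bij => //.
rewrite -(cardsT X) -(cardsT Y).
have tot (Z : finType) (g : Z -> I) : #|[set: Z]| = \sum_i #|[set z | g z == i]|.
  rewrite -sum1_card (partition_big g xpredT) //=; apply: eq_bigr => i _.
  by rewrite -[RHS]sum1_card; apply: eq_bigl => z; rewrite !inE.
by rewrite (tot X p) (tot Y q); apply: leq_sum => i _; rewrite H.
Qed.

(** * The number of holes of H_n *)

Section HGraph.
Variable n : nat.
Hypothesis n20 : 20 <= n.

Let K := Hgraph_length n.
Let K5 : 4 < K. Proof. by rewrite /K /Hgraph_length; lia. Qed.

Definition hpos (u : Hgraph n) : 'I_(Hgraph_length n) := tag u.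

Lemma Hgraph_adj (u v : Hgraph n) : adj u v =
  (hpos v == ordS (hpos u)) || (hpos u == ordS (hpos v)).
Proof.
rewrite /adj /= /braid_adj -/(hpos u) -/(hpos v).
have [e|//] := eqVneq (hpos u) (hpos v).
by rewrite e eq_sym (negbTE (ordS_neq _ _)).
Qed.

Lemma Hgraph_braided : braided hpos.
Proof.
split=> x y; first by rewrite Hgraph_adj => ->; rewrite eqxx.
by rewrite Hgraph_adj => ->; rewrite orbT.
Qed.

Lemma Hgraph_empty (x y : Hgraph n) : hpos x = hpos y -> ~~ adj x y.
Proof. by rewrite Hgraph_adj => ->; rewrite eq_sym orbb (negbTE (ordS_neq _ _)). Qed.

Lemma card_hpart i : #|part hpos i| = Hgraph_size i.
Proof. exact: (card_cluster (@Hgraph_size n) i). Qed.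

Lemma hlast_subproof : K.-1 < K. Proof. by rewrite prednK //; lia. Qed.
Definition hlast : 'I_(Hgraph_length n) := Ordinal hlast_subproof.

Lemma Hgraph_sizeE (i : 'I_(Hgraph_length n)) :
  Hgraph_size i = if i == hlast then extremal_size n else 3.
Proof.
rewrite /Hgraph_size /extremal_size -val_eqE /=; congr (if _ then _ else _).
by rewrite -/K -[X in _ == X](prednK (ltnW (ltnW (ltnW (ltnW K5))))) eqSS.
Qed.

Lemma prod_Hgraph_size : 3 * \prod_i Hgraph_size (n := n) i = tgrow n.
Proof.
under eq_bigr do rewrite Hgraph_sizeE.
rewrite (bigD1 hlast) //= eqxx (eq_bigr (fun=> 3)) => [|i /negbTE->//].
rewrite prod_nat_const (_ : #|_| = K.-1); last first.
  by have := cardC1 hlast; rewrite card_ord => <-; apply: eq_card => i; rewrite !inE.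
rewrite /extremal_size /tgrow /K /Hgraph_length.
have := divn_eq n 3; have := ltn_pmod n (isT : 0 < 3).
move: (n %% 3) (n %/ 3) => r q r3 nE.
have -> : n.+1 %/ 3 = (r == 2) + q by rewrite nE; lia.
have q0 : 0 < q by lia.
case: q q0 {nE} => // q _; case: r r3 => [|[|[|//]]] _ /=;
  rewrite ?add0n ?add1n /= ?expnS; lia.
Qed.

Lemma Hgraph_holes_ge : tgrow n <= 3 * num_holes (Hgraph n).
Proof.
have := holes_lower Hgraph_braided K5 Hgraph_empty.
rewrite -prod_Hgraph_size leq_mul2l /=; apply: leq_trans.
by under [X in _ <= X + _]eq_bigr do rewrite card_hpart; rewrite leq_addr.
Qed.

(** The rival with two clusters of size 2 has length K + 1 and the same product, hence by
    [holes_upper] at most 36 K + 36 holes besides that product; 37 beats this. In H_n the cluster of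
    size 4 raises the contribution of its own index from 36 to 72 and that of the previous one to at
    least 45. *)
Lemma Hgraph_holes_one : n %% 3 = 1 -> tgrow n + 3 * (36 * K + 37) <= 3 * num_holes (Hgraph n).
Proof.
move=> n1; have := holes_lower Hgraph_braided K5 Hgraph_empty.
under [X in X + _]eq_bigr do rewrite card_hpart.
rewrite -prod_Hgraph_size -mulnDr leq_mul2l /=; apply: leq_trans; rewrite leq_add2l.
have ext : extremal_size n = 4 by rewrite /extremal_size n1.
have sz3 i : 3 <= #|part hpos i|.
  by rewrite card_hpart Hgraph_sizeE ext; case: ifP.
have b2 m : 3 <= m -> 3 <= 'C(m, 2).
  by move=> m3; apply: leq_trans (leq_bin2l 2 m3).
pose F i := #|fam hpos i true| + #|fam hpos i false|.
have F36 i : 36 <= F i.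
  rewrite /F !card_fam // bin0 muln1; apply: (@leq_add 9 27).
    by apply: (@leq_mul 3 3); apply: b2.
  by apply: (@leq_mul 9 3); rewrite ?bin1 //; apply: (@leq_mul 3 3); rewrite ?bin1 // b2.
have Fl : 72 <= F hlast.
  rewrite /F !card_fam // bin0 muln1.
  have -> : #|part hpos hlast| = 4 by rewrite card_hpart Hgraph_sizeE eqxx ext.
  apply: (@leq_add 18 54).
    by apply: (@leq_mul 6 3) => //; apply: b2.
  by apply: (@leq_mul 18 3); rewrite ?bin1 //; apply: (@leq_mul 6 3); rewrite ?bin1.
have Fp : 45 <= F (ord_pred hlast).
  rewrite /F !card_fam // bin0 muln1 ord_predK.
  have -> : #|part hpos hlast| = 4 by rewrite card_hpart Hgraph_sizeE eqxx ext.
  apply: (@leq_add 18 27).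
    by apply: (@leq_mul 3 6) => //; apply: b2.
  by apply: (@leq_mul 9 3); rewrite ?bin1 //; apply: (@leq_mul 3 3) => //; apply: b2.
have np : ord_pred hlast != hlast by apply: ord_pred_neq.
rewrite -/F (bigD1 hlast) //= (bigD1 (ord_pred hlast)) //=.
apply: leq_trans (_ : 72 + (45 + 36 * K.-2) <= _); first by lia.
apply: leq_add => //; apply: leq_add => //.
apply: leq_trans (_ : \sum_(i | (i != hlast) && (i != ord_pred hlast)) 36 <= _);
  last by apply: leq_sum => i _; apply: F36.
rewrite sum_nat_const [X in _ <= X]mulnC leq_mul2l /=.
have := cardsC [set hlast; ord_pred hlast]; rewrite cards2 eq_sym np card_ord -/K => e.
apply: leq_trans (_ : #|~: [set hlast; ord_pred hlast]| <= _); first by rewrite -e.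
by apply/subset_leq_card/subsetP=> i; rewrite !inE negb_or.
Qed.

End HGraph.

Section Compare.
Variables (G : sgraph) (k : nat) (pos : G -> 'I_k).
Hypotheses (br : braided pos) (prodE : 3 * \prod_i #|part pos i| = tgrow #|G|)
  (n20 : 20 <= #|G|).
Implicit Types (x y : G) (S : {set G}).

Lemma sum_parts : \sum_i #|part pos i| = #|G|.
Proof.
rewrite -[RHS]sum1_card (partition_big pos xpredT) //=; apply: eq_bigr => i _.
by rewrite -sum1_card; apply: eq_bigl => z; rewrite !inE.
Qed.

Let sizes := [seq #|part pos i| | i <- enum 'I_k].

Let sizes_sum : \sum_(d <- sizes) d = #|G|.
Proof. by rewrite big_map big_enum /= sum_parts. Qed.

Let sizes_prod : 3 * \prod_(d <- sizes) d = tgrow (\sum_(d <- sizes) d).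
Proof. by rewrite sizes_sum big_map big_enum /= prodE. Qed.

Let count_sizes d : count_mem d sizes = #|[pred i | #|part pos i| == d]|.
Proof. by rewrite count_map -sum1_count -sum1_card big_enum_cond. Qed.

Let size_sizes : size sizes = k. Proof. by rewrite size_map size_enum_ord. Qed.

Lemma part_bounds i : 2 <= #|part pos i| <= 4.
Proof.
have [/allP al _] := tight_sizes sizes_prod.
have /al : #|part pos i| \in sizes by apply: map_f; rewrite mem_enum.
by rewrite !inE => /or3P[]/eqP->.
Qed.

Lemma two_types : (k = Hgraph_length #|G| /\ exists i0, #|part pos i0| = extremal_size #|G| /\
    forall i, i != i0 -> #|part pos i| = 3) \/
  [/\ #|G| %% 3 = 1, k = (Hgraph_length #|G|).+1 & forall i, #|part pos i| <= 3].
Proof.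
have [al cnt] := tight_sizes sizes_prod; have sz := sum_sizes al.
rewrite sizes_sum size_sizes in sz; rewrite sizes_sum in cnt.
rewrite !count_sizes in cnt; rewrite !count_sizes in sz.
have k0 : 0 < k.
  rewrite lt0n; apply/eqP=> k0; have := sum_parts; rewrite big1 => [e|i _].
    by move: n20; rewrite -e.
  by have := ltn_ord i; rewrite {2}k0.
have in234 i : [|| #|part pos i| == 2, #|part pos i| == 3 | #|part pos i| == 4].
  by have := part_bounds i; case: #|_| => [|[|[|[|[|]]]]].
have no d : #|[pred i | #|part pos i| == d]| = 0 -> forall i, #|part pos i| == d = false.
  by move=> /card0_eq h i; have := h i; rewrite !inE.
have one d : #|[pred i | #|part pos i| == d]| = 1 ->
    exists i0, #|part pos i0| = d /\ forall i, i != i0 -> #|part pos i| == d = false.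
  move=> c1; have /card_gt0P[i0] : 0 < #|[pred i | #|part pos i| == d]| by rewrite c1.
  rewrite inE => /eqP e; exists i0; split=> // i ne; apply/negP=> e'.
  have : 1 < #|[pred i | #|part pos i| == d]|; last by rewrite c1.
  by apply/card_gt1P; exists i, i0; rewrite !inE e' e eqxx.
have dE := divn_eq #|G| 3; move: cnt; rewrite /extremal_size /Hgraph_length.
have := ltn_pmod #|G| (isT : 0 < 3).
case E: (#|G| %% 3) => [|[|[|//]]] _.
- case=> c2 c4; rewrite c2 c4 in sz; left; split; first by lia.
  exists (Ordinal k0); have h i : #|part pos i| = 3.
    by have := in234 i; rewrite (no _ c2) (no _ c4) orbF => /eqP.
  by split.
- case=> -[c2 c4]; rewrite c2 c4 in sz.
    left; split; first by lia.
    have [i0 [e h]] := one _ c4; exists i0; split=> // i /h h4.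
    by have := in234 i; rewrite (no _ c2) h4 orbF => /eqP.
  right; split=> //; first by lia.
  by move=> i; have := in234 i; rewrite (no _ c4) orbF => /orP[]/eqP->.
- case=> c2 c4; rewrite c2 c4 in sz; left; split; first by lia.
  have [i0 [e h]] := one _ c2; exists i0; split=> // i /h h2.
  by have := in234 i; rewrite (no _ c4) h2 orbF => /eqP.
Qed.

Lemma two_twos_worse : #|G| %% 3 = 1 -> k = (Hgraph_length #|G|).+1 ->
  (forall i, #|part pos i| <= 3) -> num_holes G < num_holes (Hgraph #|G|).
Proof.
move=> n1 kE c3; have := Hgraph_holes_one n20 n1.
have k5 : 4 < k by rewrite kE /Hgraph_length; move: n20; lia.
have := holes_upper br k5 c3; rewrite -prodE [in 36 * k]kE.
move: (\prod_i _) (Hgraph_length _) (num_holes _) (num_holes G) => A L a b; lia.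
Qed.

Section SameType.
Hypothesis kE : k = Hgraph_length #|G|.
Variable i0 : 'I_k.
Hypotheses (si0 : #|part pos i0| = extremal_size #|G|)
  (si : forall i, i != i0 -> #|part pos i| = 3).

Let k5 : 4 < k. Proof. by rewrite kE /Hgraph_length; move: n20; lia. Qed.

Lemma same_type_map : exists f : G -> Hgraph #|G|,
  bijective f /\ forall x y, adj (f x) (f y) = adj x y && (pos x != pos y).
Proof.
have K0 : 0 < Hgraph_length #|G| by rewrite -kE; apply: leq_trans k5.
pose cst (i : 'I_k) : 'I_(Hgraph_length #|G|) := cast_ord kE i.
have cstS i : cst (ordS i) = ordS (cst i).
  by apply: val_inj; rewrite /=; congr (_ %% _).
(* The rotation that moves the exceptional part to the last cluster. *)
pose c := (Hgraph_length #|G|).-1 - i0.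
pose r i := iter c (@ordS _) (cst i).
have rS i : r (ordS i) = ordS (r i) by rewrite /r cstS -iterSr.
have rI : injective r.
  move=> i j; rewrite /r; elim: (c) => [|m IH] /=; first by move/cast_ord_inj.
  by move/ordS_inj.
have r0 : r i0 = hlast n20.
  apply: val_inj; rewrite /r iter_ordS /= /c subnKC.
    by rewrite modn_small // prednK.
  by rewrite -ltnS prednK // -kE ltn_ord.
have rsize i : #|part pos i| = #|part (@hpos #|G|) (r i)|.
  rewrite card_hpart (Hgraph_sizeE n20) -r0 (inj_eq rI).
  by case: eqP => [->//|/eqP/si].
have rB : bijective r by apply: inj_card_bij; rewrite // !card_ord kE.
have [f [fB fp]] : exists f : G -> Hgraph #|G|, bijective f /\ forall x, hpos (f x) = r (pos x).
  apply: (fibre_bijection (p := r \o pos)) => j.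
  have [g _ gK] := rB; rewrite -[j]gK -[RHS]rsize.
  by apply: eq_card => x; rewrite !inE /= (inj_eq rI).
exists f; split=> // x y; rewrite (Hgraph_adj n20) !fp -!rS !(inj_eq rI).
have [e|ne] := eqVneq (pos x) (pos y).
  by rewrite e andbF orbb eq_sym (negbTE (ordS_neq k5 _)).
rewrite andbT; apply/orP/idP => [[]/eqP e|xy].
- exact: (br_next br e).
- exact: (br_prev br e).
by case: (br_adj br xy ne) => ->; [left|right].
Qed.

(** Holes without inner edges are also holes of H_n. An inner edge [x y] allows at most one further
    hole, a whole part of size 4. Against this, [x] and [y] form with any two vertices of an
    adjacent part a hole of H_n that is not the image of one; three vertices there provide at least
    two of these. *)
Lemma same_type_compare : num_holes G <= num_holes (Hgraph #|G|) /\
  (num_holes (Hgraph #|G|) <= num_holes G -> isomorphic G (Hgraph #|G|)).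
Proof.
have [f [fB fA]] := same_type_map; have fI := bij_inj fB.
pose P : {set {set G}} := [set S | hole S & ~~ inner pos S].
pose Q : {set {set Hgraph #|G|}} := [set S | hole S].
have fP S : S \in P -> f @: S \in Q.
  rewrite !inE => /andP[hS nS]; apply: hole_transfer hS => x y xS yS; first exact: fI.
  rewrite fA; case xy: (adj x y) => //=; apply: contra nS => e.
  by apply/exists_inP; exists x => //; apply/exists_inP; exists y; rewrite // xy.
have fSI : injective (fun S : {set G} => f @: S) by apply: imset_inj.
pose FP : {set {set Hgraph #|G|}} := [set f @: (S : {set G}) | S in P].
have PQ : FP \subset Q by apply/subsetP=> _ /imsetP[S SP ->]; apply: fP.
have cP : #|FP| = #|P| by rewrite card_imset.
case: (boolP [exists x, [exists y, adj x y && (pos x == pos y)]]) => [|none]; last first.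
  have noadj x y : adj x y -> pos x != pos y.
    move=> xy; apply: contra none => e; apply/existsP; exists x.
    by apply/existsP; exists y; rewrite xy.
  have -> : num_holes G = #|P|.
    apply: eq_card => S; rewrite !inE; case: (hole S) => //=.
    apply/esym/negP=> /exists_inP[x _ /exists_inP[y _ /andP[/noadj]]].
    by move=> /negbTE->.
  split; first by rewrite -cP; apply: subset_leq_card.
  move=> _; exists f => // x y; rewrite fA; case xy: (adj x y) => //=; exact: noadj.
case/existsP=> x /existsP[y /andP[xy /eqP pxy]].
suff lt : num_holes G < num_holes (Hgraph #|G|).
  by split; [apply: ltnW|rewrite leqNgt lt].
have up : num_holes G <= #|P| + 1.
  rewrite -(cards1 (part pos i0)); apply: leq_trans (leq_card_setU _ _).
  apply/subset_leq_card/subsetP=> S; rewrite !inE => hS; rewrite hS /=.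
  case: (boolP (inner pos S)) => //= iS.
  have [i Si] := inner_hole br hS iS.
  have le := subset_leq_card Si; have hc := hole_card hS.
  have ii0 : i = i0.
    by apply/eqP; apply: contraTT (leq_trans hc le) => /si ->.
  rewrite -ii0 eqEcard Si /=; apply: leq_trans hc.
  by have /andP[] := part_bounds i.
(* The exceptional part may have size 2, but at most one of the two adjacent parts is
   exceptional. *)
have [j [jn j3]] : exists j, (j = ordS (pos x) \/ pos x = ordS j) /\ 3 <= #|part pos j|.
  have [e|ne] := eqVneq (ordS (pos x)) i0; last first.
    by exists (ordS (pos x)); rewrite si //; split=> //; left.
  exists (ord_pred (pos x)); rewrite ord_predK si; first by split=> //; right.
  by rewrite -e eq_sym ord_pred_neqS.
have jx z : pos z = pos x -> forall u, u \in part pos j -> adj z u /\ pos z != pos u.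
  move=> ez u; rewrite inE => /eqP eu; case: jn => ej.
    by split; [apply: (br_next br); rewrite eu ez|rewrite eu ej ez eq_sym ordS_neq].
  by split; [apply: (br_prev br); rewrite eu ez|rewrite eu ez ej ordS_neq].
have [u1 [u2 [u3 [u1j u2j u3j [n12 n13 n23]]]]] : exists u1 u2 u3,
    [/\ u1 \in part pos j, u2 \in part pos j, u3 \in part pos j &
      [/\ u1 != u2, u1 != u3 & u2 != u3]].
  have /card_gt2P[u1 [u2 [u3 [[h1 h2 h3] [m1 m2 m3]]]]] := j3.
  by exists u1, u2, u3; split=> //; split; rewrite // eq_sym.
have xy' : x != y by apply: contraTneq xy => ->; rewrite adjxx.
have mk u v : u \in part pos j -> v \in part pos j -> u != v ->
    f @: [set x; u; y; v] \in Q :\: FP.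
  move=> uj vj uv; rewrite inE; apply/andP; split.
    apply/negP=> /imsetP[S SP /fSI e]; move: SP; rewrite inE -e => /andP[_ /negP[]].
    apply/exists_inP; exists x; first by rewrite !inE eqxx.
    by apply/exists_inP; exists y; rewrite ?inE ?eqxx ?orbT // xy pxy /=.
  have py : pos y = pos x by [].
  have [xu xu'] := jx x erefl u uj; have [xv xv'] := jx x erefl v vj.
  have [yu yu'] := jx y py u uj; have [yv yv'] := jx y py v vj.
  have neq a b : pos a != pos b -> a != b by apply: contraNneq => ->.
  have E : f @: [set x; u; y; v] = [set f x; f u; f y; f v] by rewrite !imsetU !imset_set1.
  rewrite E inE; apply: hole4I.
  - rewrite /= !inE !(inj_eq fI) !negb_or !andbT xy' uv (neq _ _ xu') (neq _ _ xv') (neq _ _ yv').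
    by rewrite eq_sym (neq _ _ yu').
  - by rewrite fA xu.
  - by rewrite fA adjC yu eq_sym.
  - by rewrite fA yv.
  - by rewrite fA adjC xv eq_sym.
  - by rewrite fA py eqxx andbF.
  rewrite fA; move: uj vj; rewrite !inE => /eqP-> /eqP->.
  by rewrite eqxx andbF.
have T1 := mk _ _ u1j u2j n12; have T2 := mk _ _ u1j u3j n13.
have T12 : f @: [set x; u1; y; u2] != f @: [set x; u1; y; u3].
  rewrite (inj_eq fSI); apply/eqP=> /setP/(_ u2); rewrite !inE eqxx !orbT.
  have [_ m1] := jx x erefl u2 u2j; have [_ m2] := jx y (esym pxy) u2 u2j.
  rewrite (negbTE n23) ![u2 == _]eq_sym (negbTE n12) !orbF.
  have -> : (x == u2) = false by apply: contraNF m1 => /eqP->.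
  by have -> : (y == u2) = false by apply: contraNF m2 => /eqP->.
have c2 : 1 < #|Q :\: FP|.
  by apply/card_gt1P; exists (f @: [set x; u1; y; u2]), (f @: [set x; u1; y; u3]).
apply: leq_ltn_trans up _; rewrite /num_holes -/Q -(cardsID FP Q).
by rewrite (setIidPr PQ) cP ltn_add2l.
Qed.

End SameType.

Theorem braid_compare : num_holes G <= num_holes (Hgraph #|G|) /\
  (num_holes (Hgraph #|G|) <= num_holes G -> isomorphic G (Hgraph #|G|)).
Proof.
case: two_types => [[kE [i0 [si0 si]]]|[n1 kE c3]].
  exact: (same_type_compare kE si0 si).
have lt := two_twos_worse n1 kE c3.
by split; [apply: ltnW|rewrite leqNgt lt].
Qed.

End Compare.

(** * Large graphs *)

Section EventDiscount.
Import Order.TTheory GRing.Theory Num.Theory.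

Lemma short_paths (G : sgraph) (t : G) k s W l : 0 < #|G| ->
  count (fun p => size p < l) (paths t k s W) <= #|G| ^ l.
Proof.
move=> G0; elim: l k s W => [|l IH] k s W; first by rewrite (@eq_count _ _ pred0) ?count_pred0.
have one : 1 <= #|G| ^ l.+1 by rewrite expn_gt0 G0.
case: k => [|k] /=; case: ifP => _ //=.
rewrite count_flatten -map_comp sumnE big_map big_enum /= expnS.
apply: leq_trans (_ : \sum_(a in nbh s :&: W) #|G| ^ l <= _).
  by apply: leq_sum => a _; rewrite count_map; apply: IH.
by rewrite sum_nat_const leq_mul2r max_card orbT.
Qed.

Lemma geometric_growth (R : archiRealFieldType) (x : R) (m : nat) : (1 < x)%R ->
  exists c : nat, (m%:R <= x ^+ c)%R.
Proof.
move=> x1; have d0 : (0 < x - 1)%R by rewrite subr_gt0.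
have ber n : (1 + n%:R * (x - 1) <= x ^+ n)%R.
  elim: n => [|n IH]; first by rewrite mul0r addr0 expr0.
  have h := ler_wpM2l (ltW (lt_trans ltr01 x1)) IH.
  rewrite exprS; apply: le_trans h; rewrite -natr1.
  have : (0 <= n%:R * (x - 1) * (x - 1))%R.
    by rewrite !mulr_ge0 ?ler0n // ltW.
  by move: (n%:R : R)%R => N; lra.
have a0 : (0 <= m%:R / (x - 1))%R by rewrite divr_ge0 ?ler0n // ltW.
exists (Num.bound (m%:R / (x - 1)))%R; apply: le_trans (ber _).
have := archi_boundP a0; rewrite ltr_pdivrMr // => /ltW h.
by apply: le_trans h _; rewrite lerDr.
Qed.

(* By [potential] the paths with more than c * L events are few, and so are the
   paths that are shorter than K by [short_paths]. *)
Lemma few_events (R : realFieldType) (th : R) (c : nat) :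
  (100 * (100 * (1 - th)) <= 1)%R -> (th < 1)%R -> (16%:R <= th^-1 ^+ c)%R ->
  forall (G : sgraph) (K : nat),
  0 < #|G| -> tgrow #|G| <= 3 * num_holes G -> 8 * #|G| ^ (K + 3) < tgrow #|G| ->
  forall L, 104 * #|G| ^ 3 <= 16 ^ L ->
  exists (v a b : G) p, [/\ a \in nbh v, p \in paths b #|G| a (~: (v |: nbh v)), K <= size p &
     events a (~: (v |: nbh v)) [::] p <= c * L].
Proof.
move=> th_lo th_lt c16 G K G0 hole_ge n_small L L16; set n := #|G| in G0 n_small L16 *.
(* The 4 in place of 3 makes the hypothesis of [many_paths] a strict inequality. *)
pose X := tgrow n %/ (4 * n ^ 3).
have n3 : 0 < 4 * n ^ 3 by rewrite muln_gt0 expn_gt0 G0.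
have [v [a [b [aN bN big]]]] : exists v a b : G, [/\ a \in nbh v, b \in nbh v &
    X < size (paths b #|G| a (~: (v |: nbh v)))].
  apply: many_paths; have := leq_trunc_div (tgrow n) (4 * n ^ 3).
  have := tgrow_gt0 n; rewrite -/n -/X; move: hole_ge; rewrite -/n.
  by rewrite [X * _]mulnC -[4 * _ * X]mulnA; lia.
set W := ~: (v |: nbh v) in big *.
have many : tgrow n < size (paths b n a W) * (4 * n ^ 3).
  apply: leq_trans (_ : X.+1 * (4 * n ^ 3) <= _); first exact: ltn_ceil.
  by rewrite leq_mul2r big orbT.
case: (boolP (has (fun p => (K <= size p) && (events a W [::] p <= c * L)) (paths b n a W))).
  by case/hasP=> p pP /andP[h1 h2]; exists v, a, b, p.
move/hasPn=> none; exfalso.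
have vs : valid_state a W [::].
  by split=> //; rewrite !inE negbK; move: aN; rewrite inE => ->; rewrite orbT.
have pot := potential b th_lo th_lt n vs.
have th0 := th_gt0 th_lo.
have Th1 : (1 <= th^-1)%R by rewrite -invr1 lef_pV2 ?posrE // ltW.
move: c16 pot Th1; set Th := (th^-1)%R => c16 pot Th1.
(* As 104 = 2 * 4 * 13, where 13 comes from [rgrow_tgrow], the long paths are at most half of
   tgrow(n) / (4 n^3), and the short ones are fewer than the other half. *)
have long : (104 * n ^ 3) * count (fun p => K <= size p) (paths b n a W) <= 13 * tgrow n.
  rewrite -(ler_nat R) [leLHS]natrM.
  have h1 : ((count (fun p => (K <= size p)%N) (paths b n a W))%:R * (16 ^ L)%:R <=
      \sum_(p <- paths b n a W) Th ^+ events a W [::] p)%R.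
    rewrite -sum1_count natr_sum mulr_suml [leRHS](bigID (fun p => (K <= size p)%N)) /=.
    rewrite -[leLHS]addr0; apply: lerD; last first.
      by apply: sumr_ge0 => p _; rewrite exprn_ge0 // (le_trans ler01).
    rewrite big_seq_cond [leRHS]big_seq_cond; apply: ler_sum => p /andP[pP Kp].
    rewrite mul1r natrX; have := none p pP; rewrite Kp /= -ltnNge => /ltnW lt.
    apply: le_trans (_ : Th ^+ (c * L) <= _)%R; last exact: ler_weXn2l.
    by rewrite exprM lerXn2r // ?nnegrE ?ler0n // exprn_ge0 // (le_trans ler01).
  have h2 : ((rgrow #|W|)%:R * th ^+ mass ([::] : seq {set G}) * rate R a W <= (13 * tgrow n)%:R)%R.
    rewrite (_ : mass _ = 0); last by rewrite /mass big_nil.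
    rewrite expr0 mulr1.
    have /andP[_ r1] := rate_bounds R a W.
    apply: le_trans (_ : (rgrow #|W|)%:R <= _)%R; first by rewrite ler_piMr ?ler0n.
    rewrite ler_nat; apply: leq_trans (rgrow_tgrow _) _.
    by rewrite leq_mul2l leq_tgrow ?max_card.
  have h3 := le_trans h1 (le_trans pot h2).
  rewrite [leLHS]mulrC; apply: le_trans h3; apply: ler_wpM2l; first by rewrite ler0n.
  by rewrite ler_nat.
have short := short_paths b n a W K G0.
have tot : size (paths b n a W) = count (fun p => size p < K) (paths b n a W) +
    count (fun p => K <= size p) (paths b n a W).
  rewrite -(count_predC (fun p => size p < K)); congr (_ + _).
  by apply: eq_count => p; rewrite /= -leqNgt.
rewrite tot mulnDl in many.
have e1 : 8 * n ^ (K + 3) = 2 * (n ^ K * (4 * n ^ 3)) by rewrite expnD; lia.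
have l1 : 2 * (n ^ K * (4 * n ^ 3)) < tgrow n by rewrite -e1.
have l2 := leq_mul short (leqnn (4 * n ^ 3)).
have l3 : 26 * (count (fun p => K <= size p) (paths b n a W) * (4 * n ^ 3)) <= 13 * tgrow n.
  by apply: leq_trans long; rewrite mulnC -mulnA leq_eqVlt; apply/orP; left; apply/eqP; lia.
by move: many l1 l2 l3; move: (n ^ K * _) (count _ _ * _) (count _ _ * _) => A B C; lia.
Qed.

Lemma discount_factor (R : archiRealFieldType) :
  exists th : R, [/\ (100 * (100 * (1 - th)) <= 1)%R, (th < 1)%R &
    exists c, (16%:R <= th^-1 ^+ c)%R].
Proof.
pose h : R := (100 * 100)^-1%R.
have h0 : (0 < h)%R by rewrite invr_gt0 mulr_gt0 ?ltr0n.
have hE : (100 * 100 * h = 1)%R by rewrite mulfV ?mulf_neq0 ?pnatr_eq0.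
have th_lt : (1 - h < 1)%R by rewrite gtrDl oppr_lt0.
have th_lo : (100 * (100 * (1 - (1 - h))) <= 1)%R by rewrite subKr mulrA hE.
exists (1 - h)%R; split=> //; apply: geometric_growth.
by rewrite invf_gt1 // (th_gt0 th_lo).
Qed.

End EventDiscount.

Lemma tgrow_mul q m : tgrow (3 * q + m) = 3 ^ q * tgrow m.
Proof.
elim: q => [|q IH]; first by rewrite mul1n.
by rewrite mulnS -addnA !addSn add0n tgrowD3 IH expnS mulnA.
Qed.

Lemma tgrow_decay d m : 4 ^ d * tgrow m <= 3 ^ d * tgrow (d + m).
Proof.
elim: d => [|d IH]; first by [].
rewrite !expnS addSn -!mulnA; apply: leq_trans (leq_mul (leqnn 4) IH) _.
by rewrite mulnCA [3 * _]mulnCA leq_mul2l tgrow_pred orbT.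
Qed.

Definition settled (G : sgraph) : Prop := 3 * num_holes G < tgrow #|G| \/
  num_holes G <= num_holes (Hgraph #|G|) /\
  (num_holes (Hgraph #|G|) <= num_holes G -> isomorphic G (Hgraph #|G|)).

Lemma segment_settled (G : sgraph) (B : nat -> {set G}) M :
  segment B M -> 5 < M -> 20 <= #|G| ->
  200 * #|G| ^ 3 < 3 ^ (M - 4) -> 600 * #|G| ^ 4 < tgrow #|G| ->
  300 * num_holes G <= 101 * tgrow #|G| /\ settled G.
Proof.
move=> seg M5 n20 M3 n4; have := segment_upper seg M5.
have := segment_dichotomy seg M5; have cU := card_U_seg seg M5.
set U : {set G} := ~: _ in cU *.
have nU : #|U| ^ 3 <= #|G| ^ 3 by rewrite leq_exp2r // max_card.
have small : 200 * (#|U| ^ 3 * tgrow #|U|) <= tgrow #|G|.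
  rewrite -[in tgrow #|G|]cU addnC tgrow_mul mulnA leq_mul2r; apply/orP; right.
  by apply: leq_trans (ltnW M3); rewrite leq_mul2l nU orbT.
move: small; set E := _ * tgrow #|U| => small dich up; split; first by lia.
case: dich => [le|[a [b [rk [r [aB bB lay pr]]]]]]; first by left; lia.
right; have [k [p [br prE]]] := closed_braid seg M5 aB bB lay pr.
exact: (braid_compare br prE n20).
Qed.

(** Holes through [z] are counted by paths that avoid its neighbourhood. Each vertex avoided costs a
    factor 3/4 of the bound, and the [D]-th power of this outweighs the choice of two neighbours. *)
Lemma high_degree (G : sgraph) (z : G) D : D < #|nbh z| ->
  100 * (#|G| ^ 2 * 3 ^ D) <= 4 ^ D ->
  300 * num_holes G <= 300 * num_holes (induced [set~ z]) + tgrow #|G|.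
Proof.
move=> zD small.
have split_le : num_holes G <=
    num_holes (induced [set~ z]) + #|[set S : {set G} | hole S & z \in S]|.
  apply: leq_trans (leq_add (holes_induced _) (leqnn _)).
  apply: leq_trans (leq_card_setU _ _); apply/subset_leq_card/subsetP=> S.
  rewrite !inE => hS; rewrite hS /=; case: (boolP (z \in S)) => zS; rewrite ?orbT // orbF.
  by apply/subsetP=> x xS; rewrite !inE; apply: contraNneq zS => <-.
have hz := holes_at_le z.
have Dn : #|nbh z|.+1 <= #|G| by rewrite -card_nbh1 max_card.
have dec : 4 ^ D * tgrow (#|G| - #|nbh z|.+1) <= 3 ^ D * tgrow #|G|.
  apply: leq_trans (tgrow_decay _ _) _; rewrite leq_mul2l leq_tgrow ?orbT //; lia.
have : 100 * (#|G| ^ 2 * tgrow (#|G| - #|nbh z|.+1)) <= tgrow #|G|.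
  rewrite -(@leq_pmul2l (4 ^ D)) ?expn_gt0 // mulnCA [4 ^ D * (_ * _)]mulnCA.
  apply: leq_trans (leq_mul (leqnn 100) (leq_mul (leqnn _) dec)) _.
  by rewrite [#|G| ^ 2 * _]mulnA mulnA leq_mul2r small orbT.
move: hz; rewrite mulnn; set E := _ * tgrow _; lia.
Qed.

(** * Polynomial bounds in the number of binary digits *)

Definition polybound (f : nat -> nat) := exists C d, forall x, f x <= C * x.+1 ^ d.

Lemma polybound_const c : polybound (fun=> c).
Proof. by exists c, 0 => x; rewrite expn0 muln1. Qed.

Lemma polybound_id : polybound id.
Proof. by exists 1, 1 => x; rewrite mul1n expn1. Qed.

Lemma polybound_add f g : polybound f -> polybound g -> polybound (fun x => f x + g x).
Proof.
move=> [C [d Hf]] [C' [d' Hg]]; exists (C + C'), (d + d') => x.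
rewrite mulnDl; apply: leq_add.
  by apply: leq_trans (Hf x) _; rewrite leq_mul2l leq_pexp2l ?leq_addr ?orbT.
by apply: leq_trans (Hg x) _; rewrite leq_mul2l leq_pexp2l ?leq_addl ?orbT.
Qed.

Lemma polybound_mul f g : polybound f -> polybound g -> polybound (fun x => f x * g x).
Proof.
move=> [C [d Hf]] [C' [d' Hg]]; exists (C * C'), (d + d') => x.
by rewrite expnD mulnACA; apply: leq_mul.
Qed.

(** With [q] the quotient of [x] by [d.+1], use x + 1 <= (q + 1)(d + 1) and q + 1 <= 2^q. *)
Lemma power_exp d x : x.+1 ^ d.+1 <= d.+1 ^ d.+1 * 2 ^ x.
Proof.
have lt := ltn_ceil x (ltn0Sn d); set q := x %/ d.+1 in lt *.
apply: leq_trans (_ : (q.+1 * d.+1) ^ d.+1 <= _); first by rewrite leq_exp2r.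
rewrite expnMn mulnC leq_mul2l; apply/orP; right.
apply: leq_trans (_ : (2 ^ q) ^ d.+1 <= _); first by rewrite leq_exp2r // ltn_expl.
by rewrite -expnM leq_pexp2l // leq_trunc_div.
Qed.

Lemma polybound_exp f : polybound f -> exists N, forall x, N <= x -> f x <= 2 ^ x.
Proof.
move=> [C [d H]]; exists (C * d.+1 ^ d.+1) => x le; apply: leq_trans (H x) _.
rewrite -(@leq_pmul2r x.+1) // -mulnA -expnSr.
apply: leq_trans (leq_mul (leqnn C) (power_exp d x)) _.
by rewrite mulnA mulnC leq_mul2l (leq_trans le (leqnSn x)) orbT.
Qed.

Section Asymptotics.
Variable c : nat.

(* x stands for the number of binary digits of the order of the graph. *)
Definition degree_bound (x : nat) := 10 * x.
Definition event_bound (x : nat) := c * (x + 2).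
(** After subtracting the four outer parts of the segment, 3 * x + 6 remain: 3 ^ (3 * x) exceeds n^3
    and 3 ^ 6 exceeds 200. *)
Definition run (x : nat) := 3 * x + 10.
Definition bad (x : nat) := let T := event_bound x in let D := degree_bound x in
  T * (1 + 3 * D) + D * (D.+1 + D * (T * (1 + 3 * D))).
Definition path_length (x : nat) := (bad x).+1 * run x.

Lemma polybound_length : polybound (fun x => 2 * (3 * (x * (path_length x + 3) + 4) + 3)).
Proof.
have pc := polybound_const; have pid := polybound_id.
have pa := polybound_add; have pm := polybound_mul.
have pD : polybound degree_bound by apply: (pm (fun=> 10) id).
have pT : polybound event_bound.
  by apply: (pm (fun=> c)) => //; apply: (pa id (fun=> 2)).
have pr : polybound run by apply: (pa (fun x => 3 * x) (fun=> 10)) => //; apply: (pm (fun=> 3) id).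
have pN : polybound (fun x => event_bound x * (1 + 3 * degree_bound x)).
  by apply: (pm _ _) => //; apply: (pa (fun=> 1)) => //; apply: (pm (fun=> 3)).
have pB : polybound (fun x => 1 + bad x).
  apply: (pa (fun=> 1)) => //; apply: (pa _ _) => //; apply: (pm _ _) => //.
  apply: (pa _ _); last by apply: (pm _ _).
  by have [C [d H]] := pa (fun=> 1) _ (pc 1) pD; exists C, d.
have pK : polybound path_length.
  by have [C [d H]] := pm _ _ pB pr; exists C, d.
apply: (pm (fun=> 2)) => //; apply: (pa _ (fun=> 3)) => //; apply: (pm (fun=> 3)) => //.
by apply: (pa _ (fun=> 4)) => //; apply: (pm id) => //; apply: (pa _ _).
Qed.

Lemma large_order : exists N, forall n, N <= n -> exists x,
  [/\ n < 2 ^ x, 20 <= n, x * (path_length x + 3) + 4 <= n %/ 3 & 0 < x].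
Proof.
have [N H] := polybound_exp polybound_length.
exists (2 ^ (N + 5)) => n le; exists (trunc_log 2 n).+1.
have n0 : 0 < n by apply: leq_trans le; rewrite expn_gt0.
have /andP[lo hi] := trunc_log_bounds (isT : 1 < 2) n0.
have Nx : N + 5 <= trunc_log 2 n by apply: trunc_log_max.
split=> //.
  apply: leq_trans le; apply: leq_trans (_ : 2 ^ 5 <= _) => //.
  by rewrite leq_pexp2l // leq_addl.
have := H (trunc_log 2 n).+1; rewrite expnS leq_mul2l /= => Hx.
have {}Hx : 3 * ((trunc_log 2 n).+1 * (path_length (trunc_log 2 n).+1 + 3) + 4) + 3 <= n.
  apply: leq_trans lo; apply: Hx; lia.
by rewrite leq_divRL // mulnC; apply: leq_trans Hx; apply: leq_addr.
Qed.

End Asymptotics.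

Lemma expn3_lt_tgrow n : 3 ^ (n %/ 3) < tgrow n.
Proof.
have e3 : 0 < 3 ^ (n %/ 3) by rewrite expn_gt0.
by rewrite /tgrow; case: (n %% 3) => [|[|r]]; rewrite ltn_Pmull.
Qed.

Lemma power_le_tgrow m n : 3 * (m + 9) <= n -> 300 * 2 ^ m <= tgrow n.
Proof.
move=> mn; apply: leq_trans (ltnW (expn3_lt_tgrow n)).
apply: (@leq_trans (2 ^ (m + 9))); first by rewrite expnD mulnC leq_mul2l orbC.
apply: (@leq_trans (3 ^ (m + 9))); last by rewrite leq_pexp2l // leq_divRL // mulnC.
by rewrite leq_exp2r // addn_gt0 orbT.
Qed.

Section Orders.
Variables (c n x : nat).
Hypotheses (nx : n < 2 ^ x) (n20 : 20 <= n)
  (big : x * (path_length c x + 3) + 4 <= n %/ 3) (x0 : 0 < x).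

Let K := path_length c x.

Lemma order_power : 8 * n ^ (K + 3) < tgrow n.
Proof.
apply: leq_ltn_trans (expn3_lt_tgrow n); apply: leq_trans (_ : 2 ^ (n %/ 3) <= _); last first.
  by rewrite leq_exp2r // (leq_trans _ big) // addn4.
apply: leq_trans (_ : 2 ^ (x * (K + 3) + 3) <= _); last first.
  by rewrite leq_pexp2l // (leq_trans _ big) // leq_add2l.
have -> : 2 ^ (x * (K + 3) + 3) = 8 * (2 ^ x) ^ (K + 3) by rewrite expnD -expnM mulnC.
by rewrite leq_mul2l leq_exp2r ?(ltnW nx) ?orbT // addn3.
Qed.

Lemma order_events : 104 * n ^ 3 <= 16 ^ (x + 2).
Proof.
rewrite expnD mulnC; apply: leq_mul => //.
apply: leq_trans (_ : (2 ^ x) ^ 3 <= _); first by rewrite leq_exp2r // ltnW.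
by rewrite -expnM mulnC expnM leq_exp2r.
Qed.

(** The 10 in [degree_bound] comes from 4 * 3^5 <= 4^5: the power (4/3)^(10 x) is at least 4^(2 x),
    of which one factor 4^x covers n^2 and the other covers 100. *)
Lemma order_degree : 100 * (n ^ 2 * 3 ^ degree_bound x) <= 4 ^ degree_bound x.
Proof.
have -> : degree_bound x = 5 * (2 * x) by rewrite /degree_bound; lia.
have h1 : (4 * 3 ^ 5) ^ (2 * x) <= 4 ^ (5 * (2 * x)).
  by rewrite [4 ^ (5 * _)]expnM leq_exp2r ?muln_gt0.
apply: leq_trans h1; rewrite expnMn [3 ^ (5 * _)]expnM mulnA leq_mul2r; apply/orP; right.
have n2 : n ^ 2 <= 4 ^ x.
  by rewrite -[4]/(2 ^ 2) -expnM mulnC expnM leq_exp2r // ltnW.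
have x5 : 5 <= x.
  by rewrite leqNgt; apply/negP=> lt; move: (leq_trans (leq_ltn_trans n20 nx)
    (leq_pexp2l (isT : 0 < 2) (lt : x <= 4))).
rewrite mul2n -addnn expnD; apply: leq_mul n2.
by apply: leq_trans (leq_pexp2l (isT : 0 < 4) x5).
Qed.

Lemma order_run : 200 * n ^ 3 < 3 ^ (run x - 4).
Proof.
have -> : run x - 4 = 6 + 3 * x by rewrite /run; lia.
rewrite expnD; apply: leq_ltn_trans (_ : 200 * 3 ^ (3 * x) < _); last first.
  by rewrite ltn_pmul2r // expn_gt0.
rewrite leq_mul2l /= mulnC expnM leq_exp2r //.
by apply: leq_trans (ltnW nx) _; rewrite leq_exp2r.
Qed.

Lemma order_four : 600 * n ^ 4 < tgrow n.
Proof.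
apply: leq_ltn_trans order_power.
have K9 : 9 <= K.
  rewrite /K /path_length; apply: leq_trans (_ : run x <= _); first by rewrite /run; lia.
  by rewrite mulSn leq_addr.
have -> : K + 3 = 2 + (4 + (K - 3)) by lia.
rewrite expnD mulnA; apply: leq_mul.
  by apply: leq_trans (_ : 8 * 20 ^ 2 <= _) => //; rewrite leq_mul2l leq_exp2r.
by rewrite leq_pexp2l ?leq_addr //; apply: leq_trans n20.
Qed.

Lemma low_degree (R : realFieldType) (th : R) (G : sgraph) :
  (100 * (100 * (1 - th)) <= 1)%R -> (th < 1)%R -> (16%:R <= th^-1 ^+ c)%R ->
  #|G| = n -> (forall z : G, #|nbh z| <= degree_bound x) ->
  300 * num_holes G <= 101 * tgrow #|G| /\ settled G.
Proof.
move=> th_lo th_lt c16 Gn deg.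
case: (ltnP (3 * num_holes G) (tgrow #|G|)) => [lt|ge].
  by split; [lia|left].
have G0 : 0 < #|G| by rewrite Gn; apply: leq_trans n20.
have [v [a [b [p [aN pP Kp ev]]]]] := few_events th_lo th_lt c16 G0 ge
  (etrans (congr1 (fun m => 8 * m ^ (K + 3) < tgrow m) Gn) order_power)
  (etrans (congr1 (fun m => 104 * m ^ 3 <= 16 ^ (x + 2)) Gn) order_events).
have W0c : #|~: ~: (v |: nbh v)| <= (degree_bound x).+1.
  by rewrite setCK card_nbh1 ltnS deg.
have [B seg] := path_segment deg ev W0c (Kp : (bad c x).+1 * run x <= size p).
apply: (segment_settled seg); rewrite ?Gn //; first by rewrite /run; lia.
  exact: order_run.
exact: order_four.
Qed.

End Orders.

(** * Deleting vertices of large degree *)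

Lemma num_holes_le (G : sgraph) : num_holes G <= 2 ^ #|G|.
Proof.
rewrite -cardsT -card_powerset; apply/subset_leq_card/subsetP=> S _.
by rewrite inE subsetT.
Qed.

(** A vertex of large degree is deleted at most once in the final comparison, but the smaller graph
    may again have one. The crude bound [rough], proved by induction on the order, covers it. *)
Lemma eventually_settled : exists N, forall G : sgraph, N <= #|G| ->
  num_holes G <= num_holes (Hgraph #|G|) /\
  (num_holes (Hgraph #|G|) <= num_holes G -> isomorphic G (Hgraph #|G|)).
Proof.
have [th [th_lo th_lt [c c16]]] := discount_factor rat.
have [N HN] := large_order c.
have step (G : sgraph) : N <= #|G| ->
    300 * num_holes G <= 101 * tgrow #|G| /\ settled G \/
    exists z, 300 * num_holes G <= 300 * num_holes (@induced G [set~ z]) + tgrow #|G|.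
  move=> /HN[x [nx n20 big x0]].
  case: (boolP [forall z : G, #|nbh z| <= degree_bound x]) => [/forallP deg|].
    by left; apply: (low_degree nx n20 big x0 th_lo th_lt c16 erefl deg).
  rewrite negb_forall => /existsP[z]; rewrite -ltnNge => zD; right; exists z.
  by apply: (high_degree zD); apply: order_degree nx n20 big x0.
have card_del (G : sgraph) (z : G) : #|@induced G [set~ z]| = #|G|.-1.
  by rewrite card_induced cardsC1.
(* The constant 110 is at least 101, reproduces itself under deletion since 110 * 3/4 + 1 <= 110,
   and gives a strict deficit after one more deletion: 110 * 3/4 + 2 < 100. The last term accounts
   for orders below [N]. *)
have rough m (G : sgraph) : #|G| = m -> N <= m ->
    300 * num_holes G <= 110 * tgrow m + 300 * 2 ^ N.
  elim: m G => [|m IH] G Gm Nm.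
    apply: leq_trans (leq_addl _ _); rewrite leq_mul2l /=.
    by apply: leq_trans (num_holes_le G) _; rewrite Gm expn_gt0.
  have := step G; rewrite Gm => /(_ Nm)[[le _]|[z le]].
    apply: leq_trans le _; apply: leq_trans (leq_addr _ _).
    by apply: leq_mul (leqnn _); lia.
   have dm : #|induced [set~ z]| = m := etrans (card_del G z) (congr1 predn Gm).
  have tp := tgrow_pred m.
  case: (leqP N m) => [Nle|lt]; first by have := IH (induced _) dm Nle; lia.
  have h : num_holes (induced [set~ z]) <= 2 ^ N.
    apply: (leq_trans (num_holes_le _)); apply: (leq_pexp2l (isT : 0 < 2)).
    by move: (ltnW lt); clear -dm; rewrite dm.
  by apply: leq_trans le _; move: h tp; clear; move: (2 ^ N) (num_holes _) => E h; lia.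
exists (N + 3 * (N + 9) + 20) => G GN.
have GN1 : N < #|G| by lia.
have n20 : 20 <= #|G| by lia.
have H_ge := Hgraph_holes_ge n20.
have E : 300 * 2 ^ N <= tgrow #|G| by apply: power_le_tgrow; lia.
have strict : 3 * num_holes G < tgrow #|G| -> num_holes G <= num_holes (Hgraph #|G|) /\
    (num_holes (Hgraph #|G|) <= num_holes G -> isomorphic G (Hgraph #|G|)).
  by move=> lt; split=> [|le]; [lia|exfalso; lia].
case: (step G (ltnW GN1)) => [[_ [/strict//|//]]|[z le]]; apply: strict.
have dm := card_del G z; have Gm : #|G|.-1.+1 = #|G| by apply: ltn_predK GN1.
have := rough _ (induced _) dm; have tp := tgrow_pred #|G|.-1; rewrite Gm in tp.
have Nle : N <= #|G|.-1 by rewrite -ltnS Gm.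
by move=> /(_ Nle); lia.
Qed.

Theorem corollary1p4 :
  exists n0 : nat, forall n : nat, n0 <= n ->
    max_holes n (Hgraph n) /\
    forall G : sgraph, max_holes n G -> isomorphic G (Hgraph n).
Proof.
have [N HN] := eventually_settled; exists (N + 8) => n nN.
have cH : #|Hgraph n| = n by apply: card_Hgraph; lia.
split.
  split=> // G Gn; have := HN G; rewrite Gn => /(_ (leq_trans (leq_addr 8 N) nN)).
  by case.
move=> G [Gn Gmax]; have := HN G; rewrite Gn => /(_ (leq_trans (leq_addr 8 N) nN))[_].
by apply; apply: Gmax.
Qed.
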